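(* Let $b\ge 1$ be a constant integer. Consider Naïve Sort under random adjacent rank swaps, in the model described in the context where every sorting step is followed by exactly $b$ mixing steps. Then there exists a constant $c=c(b)>0$ such that, for all sufficiently large $n$, for every initial permutation $\pi_0\in S_n$ and every integer $m\ge 16\cdot128\cdot4\cdot(b+1)\,n^2$, \[ \Pr\big[\mathrm{dev}(\pi_m)\le c\,n\big]\ \ge\ 1-n^{-2}. \]
   Context: Let $n\ge 2$, $[n]=\{1,\dots,n\}$, and $S_n$ the set of permutations of $[n]$. For $\pi\in S_n$, $\mathrm{dev}(\pi)=\sum_{i\in[n]}|\pi(i)-i|$ (total deviation). The process is a sequence $\pi_0,\pi_1,\dots\in S_n$; the steps are: one sorting step, then $b$ mixing steps, then one sorting step, then $b$ mixing steps, and so on. Sorting step $t$ (Naïve Sort): choose $i\in[n-1]$ uniformly at random; if $\pi_{t-1}(i)>\pi_{t-1}(i+1)$, $\pi_t$ is $\pi_{t-1}$ with the entries at positions $i,i+1$ exchanged; otherwise $\pi_t=\pi_{t-1}$. Mixing step $t$ (random adjacent rank swap): choose $i\in[n-1]$ uniformly at random and let $\pi_t$ be obtained from $\pi_{t-1}$ by exchanging the values $i$ and $i+1$, i.e. $\pi_t(k)=i+1$ if $\pi_{t-1}(k)=i$, $\pi_t(k)=i$ if $\pi_{t-1}(k)=i+1$, and $\pi_t(k)=\pi_{t-1}(k)$ otherwise. All random choices are independent. *)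

(* Defs.v *)
From HB Require Import structures.
From mathcomp Require Import all_boot all_order all_fingroup all_algebra.
From mathcomp Require Import reals.

Set Implicit Arguments.
Unset Strict Implicit.
Unset Printing Implicit Defensive.

Import Order.TTheory GRing.Theory Num.Theory.

(* Positions and values [1..n] are represented by 'I_n = {0, .., n-1}, and the
   random index in [1..n-1] by 'I_n.-1; [lo i] and [hi i] stand for i and i+1. *)
Lemma hi_subproof n (i : 'I_n.-1) : i.+1 < n.
Proof. by rewrite -ltn_predRL. Qed.

Definition lo n (i : 'I_n.-1) : 'I_n := widen_ord (leq_pred n) i.
Definition hi n (i : 'I_n.-1) : 'I_n := Ordinal (hi_subproof i).

Definition dev n (p : 'S_n) : nat := \sum_(i < n) `|p i - i|%N.

(* In {perm T}, (s * t) x = t (s x): multiplying by a transposition on the left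
   exchanges the entries at two positions, on the right two values. *)
Definition sort_step n (p : 'S_n) (i : 'I_n.-1) : 'S_n :=
  if p (hi i) < p (lo i) then (tperm (lo i) (hi i) * p)%g else p.

Definition mix_step n (p : 'S_n) (i : 'I_n.-1) : 'S_n :=
  (p * tperm (lo i) (hi i))%g.

(* [t] is the number of steps already performed, so step t+1 is a sorting step
   exactly when b+1 divides t. *)
Definition step b n (t : nat) (p : 'S_n) (i : 'I_n.-1) : 'S_n :=
  if b.+1 %| t then sort_step p i else mix_step p i.

Fixpoint run_from b n (t : nat) (p : 'S_n) (w : seq 'I_n.-1) : 'S_n :=
  if w is i :: w' then run_from b t.+1 (step b t p i) w' else p.

(* The permutation reached from p after size w steps, where the t-th item of w
   is the index chosen at the t-th step. *)
Definition run b n (p : 'S_n) (w : seq 'I_n.-1) : 'S_n := run_from b 0 p w.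

(* On m.-tuple 'I_n.-1 the uniform distribution is the joint law of m
   independent uniform choices. *)
Definition uniform_prob (R : realType) (T : finType) (E : {set T}) : R :=
  (#|E|%:R / #|T|%:R)%R.

(* Main.v *)
(* Let e_k(j) = j + k - 2 #{i < j : pi(i) < k}. Each row e_k is a path with steps
   +1 and -1 above the baseline |j - k|, and dev(pi) is at most the sum of the
   diagonal heights e_k(k). Weight a position of a row by 2^e, sum over windows of
   length 4 rho, raise the sum to a small power P = 2^-m, subtract the value at
   the baseline, and add over windows and rows: this is a potential Phi_P.

   A sorting step at a descent lowers by 2 the peak it causes in every row where
   it is one. Sliding a window by one position halves its sum up to the mass at
   up-steps, which is carried by the peaks, so the peaks control Phi_P, and in
   mean a sorting step removes a fraction of order P / n of Phi_P. Swapping the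
   values k - 1 and k changes row k only, into e_(k-1) + e_(k+1) - e_k; Chebyshev's
   sum inequality then bounds the product of the old and new window sums by that
   of the neighbouring rows, so that the first order cancels in mean and a mixing
   step adds only a fraction of order P^2 / n. For P small against 1 / b, a cycle
   thus contracts Phi_P up to an additive constant.

   For a probability bound, take a second potential Phi_Q with Q = P / 8. The
   fourth power of its increments is dominated in mean by (Phi_P + n) / n, hence
   (Phi_Q - K n)_+^4 + lam n Phi_P contracts up to an additive C n. After order
   n^2 cycles the exponential initial value has decayed, the mean is O(n^2), and
   Markov's inequality at level (K n)^4 gives the error n^-2. *)
Require Import Defs.
From HB Require Import structures.
From mathcomp Require Import all_boot all_order all_fingroup all_algebra.
From mathcomp Require Import reals.
From mathcomp Require Import zify ring lra.

Set Implicit Arguments.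
Unset Strict Implicit.
Unset Printing Implicit Defensive.

Import Order.TTheory GRing.Theory Num.Theory.
Local Open Scope ring_scope.

(** * Iterated square roots *)

(** Peaks fail to control a window that ends in the middle of an ascent: the up-steps there lead to
    a peak outside it. Such a tail is dominated by the peaks inside, or is light and passes to the
    next window with a factor 5/8, or is heavy. Up to a constant, heavy tails are charged to the
    excess of the windows shifted by 2 rho to 3 rho: these still contain the tail, and their
    baseline sum is smaller than its mass by a factor 2^(2^m). Within rho consecutive windows heavy
    tails have increasing heights, so they sum geometrically and the charge costs only order 2^m /
    rho of the excess. Hence rho is taken large against 2^m.

    The second obstacle is the kink of the baseline at the diagonal. The linear comparison between
    neighbouring rows balances the baselines on one side only, so it must change form there, which
    leaves a first-order term in two windows per row. Up to a constant, each of them holds at most a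
    fraction 2 / 2^m of the excess of its row, and the term becomes second order.

    The constants are chosen in the order m, rho, K: the contraction of the fourth-power function
    has constants independent of K, so K can be enlarged last. *)

Section Roots.
Variable R : rcfType.
Implicit Types (m n : nat) (x y z : R).

(** The power of [x] with exponent [2 ^- m]. Exponents of this form allow every concavity bound to
    be reduced to Bernoulli's inequality for integer powers. *)
Definition root2 m x : R := iter m Num.sqrt x.

Lemma root2_ge0 m x : 0 <= x -> 0 <= root2 m x.
Proof. by elim: m => //= m IH x0; exact: sqrtr_ge0. Qed.

Lemma root2_gt0 m x : 0 < x -> 0 < root2 m x.
Proof. by elim: m => //= m IH x0; rewrite sqrtr_gt0 IH. Qed.

Lemma root2K m x : 0 <= x -> root2 m x ^+ (2 ^ m) = x.
Proof.
elim: m => [|m IH] x0; first by rewrite expr1.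
by rewrite expnS exprM /= sqr_sqrtr ?root2_ge0 // IH.
Qed.

Lemma root2_1 m : root2 m 1 = 1.
Proof. by elim: m => //= m ->; rewrite sqrtr1. Qed.

Lemma root2M m x y : 0 <= x -> root2 m (x * y) = root2 m x * root2 m y.
Proof. by elim: m => //= m IH x0; rewrite IH // sqrtrM // root2_ge0. Qed.

Lemma root2V m x : 0 < x -> root2 m x^-1 = (root2 m x)^-1.
Proof.
move=> x0; apply: (mulfI (lt0r_neq0 (root2_gt0 m x0))).
by rewrite -root2M ?ltW // !mulfV ?root2_1 ?lt0r_neq0 // root2_gt0.
Qed.

Lemma root2_le m x y : x <= y -> root2 m x <= root2 m y.
Proof. by elim: m => //= m IH xy; rewrite ler_wsqrtr // IH. Qed.

Lemma root2X m n x : 0 <= x -> root2 m (x ^+ n) = root2 m x ^+ n.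
Proof.
by move=> x0; elim: n => [|n IH]; rewrite ?expr0 ?root2_1 // !exprS root2M // IH.
Qed.

Lemma root2_add3 m x : 0 <= x -> root2 (m + 3) x ^+ 8 = root2 m x.
Proof. by move=> x0; rewrite addnC /root2 iterD (@root2K 3) // root2_ge0. Qed.

Lemma bernoulli n x : -1 <= x -> 1 + n%:R * x <= (1 + x) ^+ n.
Proof.
move=> x1; elim: n => [|n IH]; first by rewrite mul0r addr0 expr0.
rewrite exprS; apply: (@le_trans _ _ ((1 + x) * (1 + n%:R * x))); last first.
  by rewrite ler_wpM2l //; lra.
rewrite -natr1 -subr_ge0.
rewrite (_ : _ - _ = n%:R * x ^+ 2); first by rewrite mulr_ge0 ?sqr_ge0.
by ring.
Qed.

Lemma root2_bernoulli m x : -1 <= x -> root2 m (1 + x) <= 1 + x / (2 ^ m)%:R.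
Proof.
move=> x1; set q := (2 ^ m)%N.
have q0 : (0 < q)%N by rewrite expn_gt0.
have q0' : (0 : R) < q%:R by rewrite ltr0n.
have q1 : (1 : R) <= q%:R by rewrite ler1n.
have xq : -1 <= x / q%:R.
  by rewrite ler_pdivlMr //; lra.
rewrite -(@ler_pXn2r _ q) // ?nnegrE ?root2_ge0 //; try lra.
rewrite root2K; last lra.
apply: le_trans (bernoulli q xq).
by rewrite mulrCA mulfV ?mulr1 // lt0r_neq0.
Qed.

(** The quotient is, up to the factor [2 ^- m], the derivative of the root, which is nonincreasing
    by concavity. *)
Lemma root2_div_le m x y : 0 < x -> x <= y -> root2 m y / y <= root2 m x / x.
Proof.
move=> x0 xy; have y0 : 0 < y by exact: lt_le_trans xy.
rewrite ler_pdivrMr // mulrAC ler_pdivlMr //.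
have -> : y = x * (y / x) by rewrite mulrCA mulfV ?mulr1 // lt0r_neq0.
set t := y / x.
have t1 : 1 <= t by rewrite ler_pdivlMr // mul1r.
have x0' := ltW x0.
rewrite root2M // -mulrA ler_wpM2l ?root2_ge0 //.
rewrite mulrC ler_wpM2l //.
have := @root2_bernoulli m (t - 1) ltac:(lra).
rewrite addrCA subrr addr0 => /le_trans; apply.
have q1 : (1 : R) <= (2 ^ m)%:R by rewrite ler1n expn_gt0.
suff : (t - 1) / (2 ^ m)%:R <= t - 1 by lra.
by rewrite ler_pdivrMr; [rewrite ler_peMr //; lra | lra].
Qed.

(** A concave function lies below its tangent at [x]. *)
Lemma root2_drop_ge m x d : 0 < x -> 0 <= d <= x ->
  root2 m (x - d) <= root2 m x - root2 m x / x * d / (2 ^ m)%:R.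
Proof.
move=> x0 /andP[d0 dx].
have -> : x - d = x * (1 + - (d / x)).
  by field; rewrite lt0r_neq0.
rewrite root2M ?(ltW x0) //.
have dx1 : d / x <= 1 by rewrite ler_pdivrMr // mul1r.
have := @root2_bernoulli m (- (d / x)) ltac:(lra).
move=> /(ler_wpM2l (ltW (root2_gt0 m x0))) /le_trans; apply.
by rewrite le_eqVlt; apply/orP; left; apply/eqP; field;
  rewrite ?lt0r_neq0 // ltr0n expn_gt0.
Qed.

(** Converse of the tangent bound, from Bernoulli applied to the inverse ratio. The factor 4 bounds
    [1 / (1 - z)] for [z <= 3 / 4]. *)
Lemma root2_drop_le m x d : 0 < x -> 0 <= d -> d <= 3 / 4 * x ->
  root2 m x - root2 m (x - d) <= 4 * (root2 m x / x) * d / (2 ^ m)%:R.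
Proof.
move=> x0 d0 dx; set q : R := (2 ^ m)%:R.
have q0 : 0 < q by rewrite ltr0n expn_gt0.
set z := d / x.
have z0 : 0 <= z by rewrite /z divr_ge0 ?(ltW x0).
have z1 : z <= 3 / 4 by rewrite /z ler_pdivrMr.
have -> : x - d = x * (1 - z).
  by rewrite /z; field; rewrite lt0r_neq0.
rewrite root2M ?(ltW x0) //.
have -> : 4 * (root2 m x / x) * d / q = root2 m x * (4 * z / q).
  by rewrite /z; field; rewrite !lt0r_neq0.
rewrite -[X in X - _]mulr1 -mulrBr ler_wpM2l ?root2_ge0 ?(ltW x0) //.
have b0 : 0 < root2 m (1 - z) by apply: root2_gt0; lra.
have zz : 0 < 1 - z by lra.
have h := @root2_bernoulli m (z / (1 - z)) ltac:(have := divr_ge0 z0 (ltW zz); lra).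
have e1 : 1 + z / (1 - z) = (1 - z)^-1 by field; rewrite lt0r_neq0.
rewrite e1 root2V // -/q in h.
have h2 : z / (1 - z) <= 4 * z.
  by rewrite ler_pdivrMr //; nra.
have h3 : (root2 m (1 - z))^-1 <= 1 + 4 * z / q.
  by apply: (le_trans h); rewrite lerD2l ler_pM2r ?invr_gt0.
have h4 : 1 <= root2 m (1 - z) * (1 + 4 * z / q).
  by rewrite -ler_pdivrMl // mulr1.
have h5 : 0 <= 4 * z / q.
  by apply: divr_ge0; [rewrite mulr_ge0 | exact: ltW].
nra.
Qed.

(** The factor gained by the root of a window sum when the path is raised by one; it is [1] plus
    order [2 ^- m]. *)
Definition s2 m : R := root2 m 2.

Lemma s2_gt0 m : 0 < s2 m. Proof. exact: root2_gt0. Qed.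

Lemma s2_ge1 m : 1 <= s2 m.
Proof. by rewrite -(root2_1 m); apply: root2_le; lra. Qed.

Lemma s2_le2 m : s2 m <= 2.
Proof.
have := @root2_bernoulli m 1 ltac:(lra).
have q1 : (1 : R) <= (2 ^ m)%:R by rewrite ler1n expn_gt0.
rewrite -/(s2 m) => /le_trans; apply.
suff : 1 / (2 ^ m)%:R <= (1 : R) by lra.
by rewrite ler_pdivrMr; lra.
Qed.

Lemma s2_ub m : s2 m <= 1 + 1 / (2 ^ m)%:R.
Proof. by apply: (@root2_bernoulli m 1); lra. Qed.

Lemma s2_lb m : 1 / 2 / (2 ^ m)%:R <= 1 - (s2 m)^-1.
Proof.
have := @root2_bernoulli m (- (1/2)) ltac:(lra).
have -> : (1 : R) + - (1 / 2) = 2^-1 by field.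
rewrite root2V // -/(s2 m) => h.
have : - (1/2) / (2 ^ m)%:R = - (1 / 2 / (2 ^ m)%:R) :> R by rewrite !mulNr.
lra.
Qed.

Lemma s2K m : s2 m ^+ (2 ^ m) = 2.
Proof. exact: root2K. Qed.

Lemma root2_pow m n : root2 m (2 ^+ n) = s2 m ^+ n.
Proof. by rewrite root2X. Qed.

Lemma root2_half m x : 0 <= x -> root2 m (x / 2) = root2 m x / s2 m.
Proof. by move=> x0; rewrite root2M // root2V. Qed.

End Roots.

(** * Windows of unit-step paths *)

Section Paths.
Variable R : rcfType.
Implicit Types (e : nat -> nat) (w k j l d : nat).

Definition winsum w e l : R := \sum_(l <= j < l + w.+1) 2 ^+ e j.

Definition peak e j := [&& 0 < j, e j.-1 < e j & e j.+1 < e j]%N.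

Definition peaksum w e l : R := \sum_(l <= j < l + w.+1 | peak e j) 2 ^+ e j.

Definition upsum w e l : R := \sum_(l <= j < l + w.+1 | (e j < e j.+1)%N) 2 ^+ e j.

Definition base k j : nat := (j - k + (k - j))%N.

Definition unit_steps N e :=
  forall j, (j < N)%N -> e j.+1 = (e j).+1 \/ e j = (e j.+1).+1.

Lemma exp2_gt0 n : 0 < 2 ^+ n :> R. Proof. by rewrite exprn_gt0. Qed.
Lemma exp2_ge0 n : 0 <= 2 ^+ n :> R. Proof. exact: ltW (exp2_gt0 n). Qed.
Lemma exp2_ge1 n : 1 <= 2 ^+ n :> R. Proof. by apply: exprn_ege1; lra. Qed.
Lemma exp2_le i n : (i <= n)%N -> 2 ^+ i <= 2 ^+ n :> R.
Proof. by move=> h; apply: ler_weXn2l => //; lra. Qed.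

Lemma winsum_gt0 w e l : 0 < winsum w e l.
Proof.
rewrite /winsum addnS big_nat_recr ?leq_addr //=.
by rewrite ltr_wpDl ?exp2_gt0 // sumr_ge0 // => i _; exact: exp2_ge0.
Qed.

Lemma peaksum_ge0 w e l : 0 <= peaksum w e l.
Proof. by apply: sumr_ge0 => i _; exact: exp2_ge0. Qed.

Lemma upsum_ge0 w e l : 0 <= upsum w e l.
Proof. by apply: sumr_ge0 => i _; exact: exp2_ge0. Qed.

Lemma upsum_le w e l : upsum w e l <= winsum w e l.
Proof.
rewrite /upsum big_mkcond /=; apply: ler_sum => i _.
by case: ifP => // _; exact: exp2_ge0.
Qed.

Lemma winsum_ge1 w e l j : (l <= j <= l + w)%N -> 2 ^+ e j <= winsum w e l.
Proof.
move=> /andP[lj jl]; rewrite /winsum (big_cat_nat (n := j)) //=; last by lia.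
rewrite [X in _ + X]big_ltn; last by lia.
set a := \sum_(_ <= _ < _) _; set b := \sum_(_ <= _ < _) _.
have a0 : 0 <= a by apply: sumr_ge0 => i _; exact: exp2_ge0.
have b0 : 0 <= b by apply: sumr_ge0 => i _; exact: exp2_ge0.
lra.
Qed.

Lemma peaksum_ge1 w e l j : (l <= j <= l + w)%N -> peak e j ->
  2 ^+ e j <= peaksum w e l.
Proof.
move=> /andP[lj jl] pj; rewrite /peaksum (big_cat_nat (n := j)) //=; last by lia.
rewrite [X in _ + X]big_ltn_cond; last by lia.
rewrite pj; set a := \sum_(_ <= _ < _ | _) _; set b := \sum_(_ <= _ < _ | _) _.
have a0 : 0 <= a by apply: sumr_ge0 => i _; exact: exp2_ge0.
have b0 : 0 <= b by apply: sumr_ge0 => i _; exact: exp2_ge0.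
lra.
Qed.

Lemma winsum_le_const w e l M :
  (forall j, (l <= j <= l + w)%N -> (e j <= M)%N) -> winsum w e l <= w.+1%:R * 2 ^+ M.
Proof.
move=> hM; rewrite /winsum.
apply: (@le_trans _ _ (\sum_(l <= j < l + w.+1) 2 ^+ M)).
  by apply: ler_sum_nat => j hj; apply: exp2_le; apply: hM; lia.
by rewrite sumr_const_nat addKn mulr_natl.
Qed.

Lemma winsum_mono w e1 e2 l :
  (forall j, (l <= j <= l + w)%N -> (e1 j <= e2 j)%N) -> winsum w e1 l <= winsum w e2 l.
Proof. by move=> h; apply: ler_sum_nat => j hj; apply: exp2_le; apply: h; lia. Qed.

Lemma eq_winsum w e1 e2 l :
  (forall j, (l <= j <= l + w)%N -> e1 j = e2 j) -> winsum w e1 l = winsum w e2 l.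
Proof. by move=> h; apply: eq_big_nat => j hj; rewrite h //; lia. Qed.

(* A path that moves by one step at a time doubles or halves [2 ^+ e] : shifting
   the window by one halves its sum, up to the mass at the up-steps. *)
Lemma winsum_shift N w e l : unit_steps N e -> (l + w < N)%N ->
  winsum w e l.+1 = winsum w e l / 2 + 3 / 2 * upsum w e l.
Proof.
move=> ue lN; rewrite /winsum /upsum addSn big_add1 /=.
rewrite mulr_suml mulr_sumr [X in _ = _ + X]big_mkcond -big_split /=.
apply: eq_big_nat => j hj.
have [E|E] := ue j ltac:(lia); rewrite E.
  by rewrite ltnSn exprS; field.
by rewrite ltnNge leqnSn /= addr0 exprS; field.
Qed.

(* Every up-step climbs along its run to a peak, or to the end of the window. *)
Lemma upsum_le_peaks N e l d : unit_steps N e -> (l + d < N)%N ->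
  upsum d e l <= \sum_(l.+1 <= j < l + d.+1 | peak e j) 2 ^+ e j
    + (e (l + d) < e (l + d).+1)%N%:R * 2 ^+ e (l + d).+1.
Proof.
move=> ue; rewrite /upsum; elim: d => [|d IH] lN.
  rewrite addn0 addn1 big_mkcond big_nat1 [X in _ <= X + _]big_geq // add0r.
  by case: ifP => E; rewrite ?mul1r ?mul0r // exp2_le // ltnW.
have := IH ltac:(lia); rewrite [in X in _ -> X](addnS l d.+1) => IH'.
rewrite big_mkcond big_nat_recr /=; last by lia.
rewrite -big_mkcond [X in _ <= X + _]big_mkcond big_nat_recr /=; last by lia.
rewrite -big_mkcond /= !addnS in IH' *.
apply: (le_trans (lerD IH' (lexx _))).
set P := \sum_(_ <= _ < _ | _) _.
rewrite -!addrA lerD2l /peak /=.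
have := ue (l + d)%N ltac:(lia); have := ue (l + d).+1 ltac:(lia).
move: (e (l + d)%N) (e (l + d).+1) (e (l + d).+2) => a b c [E2|E2] [E1|E1].
- have -> : (a < b)%N by lia.
  have -> : (c < b)%N = false by lia.
  have -> : (b < c)%N by lia.
  by rewrite E2 /= !mul1r add0r exprS; lra.
- have -> : (a < b)%N = false by lia.
  have -> : (b < c)%N by lia.
  by rewrite /= !mul1r mul0r !add0r exp2_le //; lia.
- have -> : (a < b)%N by lia.
  have -> : (c < b)%N by lia.
  have -> : (b < c)%N = false by lia.
  by rewrite /= !mul1r mul0r !addr0.
- have -> : (a < b)%N = false by lia.
  have -> : (b < c)%N = false by lia.
  by rewrite /= !mul0r !addr0.
Qed.

End Paths.

(** * Roots of window sums, their excess over the baseline, and tails *)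

Section Potential.
Variable R : rcfType.
Implicit Types (m w k l : nat) (e : nat -> nat).

Definition rootsum m w e l : R := root2 m (winsum R w e l).

Definition excess m w k e l : R := rootsum m w e l - rootsum m w (base k) l.

(** Up to the factor [2 ^- m], the derivative of the root of the window sum in the direction of the
    peak mass: the first-order gain available from sorting. *)
Definition peakterm m w e l : R :=
  rootsum m w e l / winsum R w e l * peaksum R w e l.

(** The last position lies inside an ascent whose peak is outside the window; this mass stands in
    for that peak. *)
Definition tailmass w e l : R :=
  if (e (l + w).-1 < e (l + w)%N < e (l + w).+1)%N then 2 ^+ e (l + w)%N else 0.

Definition tailterm m w e l : R := rootsum m w e l / winsum R w e l * tailmass w e l.

(** The tails absorbed neither by the peaks of the window nor by passing to the next one; the
    threshold 6 is what [y_cases] requires. *)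
Definition tail_heavy w e l := [&& (e (l + w).-1 < e (l + w)%N)%N,
  (e (l + w)%N < e (l + w).+1)%N, peaksum R w e l < 2 ^+ e (l + w)%N
  & winsum R w e l <= 6 * 2 ^+ e (l + w)%N].

Lemma rootsum_gt0 m w e l : 0 < rootsum m w e l.
Proof. exact: root2_gt0 (winsum_gt0 _ _ _ _). Qed.

Lemma rootsum_mono m w e1 e2 l :
  (forall j, (l <= j <= l + w)%N -> (e1 j <= e2 j)%N) ->
  rootsum m w e1 l <= rootsum m w e2 l.
Proof. by move=> h; apply: root2_le; exact: winsum_mono. Qed.

Lemma peakterm_ge0 m w e l : 0 <= peakterm m w e l.
Proof.
apply: mulr_ge0; last exact: peaksum_ge0.
by apply: divr_ge0; apply: ltW; [exact: rootsum_gt0 | exact: winsum_gt0].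
Qed.

(** Read from the largest term downwards, the sum is dominated by a geometric series of ratio
    [1 / s2], whose value is at most [2 * 2 ^ m]. *)
Lemma sum_pow_increasing m (P : pred nat) (E : nat -> nat) a b (T : R) :
  0 <= T ->
  (forall i j, (a <= i)%N -> (i < j < b)%N -> P i -> P j -> (E i < E j)%N) ->
  (forall i, (a <= i < b)%N -> P i -> s2 R m ^+ E i <= T) ->
  \sum_(a <= i < b | P i) s2 R m ^+ E i <= 2 * (2 ^ m)%:R * T.
Proof.
have q0 : (0 : R) < (2 ^ m)%:R by rewrite ltr0n expn_gt0.
elim: b T => [|b IH] T T0 Einc ET.
  by rewrite big_geq // mulr_ge0 // mulr_ge0 // ltW.
have [ab|ba] := leqP a b; last first.
  by rewrite big_geq // mulr_ge0 // mulr_ge0 // ltW.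
rewrite big_mkcond big_nat_recr //= -big_mkcond /=.
have [Pb|Pb] := boolP (P b); last first.
  rewrite addr0; apply: IH => //; first by move=> i j ai ij; apply: Einc; lia.
  by move=> i ai; apply: ET; lia.
set s := s2 R m; have s0 : 0 < s by exact: s2_gt0.
have sE0 : 0 < s ^+ E b by rewrite exprn_gt0.
have := IH (s ^+ E b / s) (divr_ge0 (ltW sE0) (ltW s0)).
move=> /(_ ltac:(move=> i j ai ij; apply: Einc; lia)).
move=> /(_ _)/wrap[i ai Pi|IH'].
  have Ei : (E i < E b)%N by apply: Einc => //; lia.
  rewrite ler_pdivlMr // -exprSr; apply: ler_weXn2l => //; exact: s2_ge1.
apply: le_trans (_ : 2 * (2 ^ m)%:R * s ^+ E b <= _); last first.
  by rewrite ler_pM2l ?mulr_gt0 // ET //; lia.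
have lb := s2_lb R m; rewrite -/s in lb.
have : 1 <= 2 * (2 ^ m)%:R * (1 - s^-1).
  have E1 : 2 * (2 ^ m)%:R * (1 / 2 / (2 ^ m)%:R) = 1 :> R by field; rewrite lt0r_neq0.
  by rewrite -{1}E1 ler_pM2l ?mulr_gt0.
move=> /(ler_wpM2l (ltW sE0)); lra.
Qed.

End Potential.

(** * Peaks control the excess of a row *)

Section LeftHalf.
Variable R : rcfType.
Variables (m rho k N : nat) (e : nat -> nat).
Local Notation q := (2 ^ m)%N.
Local Notation w := (4 * rho)%N.
Hypothesis eN : unit_steps N e.
Hypothesis e_ge : forall j, (j <= N)%N -> (base k j <= e j)%N.
Hypothesis e_left : forall j, (j <= w)%N -> e j = base k j.
Hypothesis k_ge : (2 * w <= k)%N.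
Hypothesis k_le : (k + 2 * w <= N)%N.
Hypothesis rho_q : (q + 3 <= rho)%N.
Hypothesis rho5 : (5 <= rho)%N.

Local Notation s := (s2 R m).
Local Notation S := (winsum R w e).
Local Notation C := (peaksum R w e).
Local Notation H := (rootsum R m w e).
Local Notation h := (excess R m w k e).
Local Notation c := (peakterm R m w e).
Local Notation top l := (e (l + w)%N).

Local Notation tail := (tailmass R w e).
Local Notation y := (tailterm R m w e).
Local Notation U := (tail_heavy R w e).

Let q_gt0 : 0 < q%:R :> R. Proof. by rewrite ltr0n expn_gt0. Qed.
Let S_gt0 l : 0 < S l. Proof. exact: winsum_gt0. Qed.
Let H_gt0 l : 0 < H l. Proof. exact: rootsum_gt0. Qed.
Let HS_ge0 l : 0 <= H l / S l. Proof. by apply: divr_ge0; exact: ltW. Qed.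
Let tail_ge0 l : 0 <= tail l.
Proof. by rewrite /tailmass; case: ifP => // _; exact: exp2_ge0. Qed.
Let y_ge0 l : 0 <= y l. Proof. exact: mulr_ge0. Qed.
Let c_ge0 l : 0 <= c l. Proof. exact: peakterm_ge0. Qed.
Let C_ge0 l : 0 <= C l. Proof. exact: peaksum_ge0. Qed.

Let h_ge0 l : (l + w <= N)%N -> 0 <= h l.
Proof.
move=> lN; rewrite subr_ge0; apply: rootsum_mono => j hj.
by apply: e_ge; lia.
Qed.

Let base_shift l : winsum R w (base k) l / 2 <= winsum R w (base k) l.+1.
Proof.
rewrite /winsum addSn big_add1 /= mulr_suml; apply: ler_sum => j _.
rewrite ler_pdivrMr // mulrC -exprS; apply: exp2_le; rewrite /base; lia.
Qed.

Let next_top l : (l + w.+1 < N)%N -> (top l < e (l + w).+1)%N ->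
  2 ^+ e (l + w).+1 <= C l.+1 + tail l.+1.
Proof.
move=> lN up.
have [dn|up'] : (e (l + w).+2 < e (l + w).+1)%N \/ (e (l + w).+1 < e (l + w).+2)%N.
  by have := @eN (l + w).+1 ltac:(lia); lia.
  apply: (@le_trans _ _ (C l.+1)); last by rewrite lerDl.
  have -> : (l + w).+1 = (l.+1 + w)%N by lia.
  apply: peaksum_ge1; first by lia.
  by rewrite /peak addSn /= up dn.
by rewrite /tailmass !addSn /= up up' lerDr.
Qed.

(** The window at [l.+1] contains the top of the last ascent, unless the ascent goes on; in that
    case the tail accounts for it. *)
Let upsum_next l : (l + w.+1 < N)%N -> upsum R w e l <= C l.+1 + tail l.+1.
Proof.
move=> lN; apply: (le_trans (upsum_le_peaks R eN _)); first by lia.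
have E : C l.+1 = \sum_(l.+1 <= j < l + w.+1 | peak e j) 2 ^+ e j
    + (if peak e (l + w).+1 then 2 ^+ e (l + w).+1 else 0).
  rewrite /peaksum addSn addnS [in LHS]big_mkcond big_nat_recr /=; last by lia.
  by rewrite -big_mkcond.
rewrite E -addrA lerD2l /tailmass !addSn /= /peak /=.
have [up|dn] := boolP (e (l + w) < e (l + w).+1)%N; last first.
  by rewrite mul0r /= addr0.
have := @eN (l + w).+1 ltac:(lia); rewrite mul1r /= => h12.
have [lt|ge] := boolP (e (l + w).+2 < e (l + w).+1)%N.
  by rewrite lerDl; case: ifP => // _; exact: exp2_ge0.
have -> : (e (l + w).+1 < e (l + w).+2)%N by lia.
by rewrite /= add0r.
Qed.

Let upsum_same l : (l + w < N)%N -> (top l < e (l + w).+1)%N ->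
  upsum R w e l <= C l + 2 * 2 ^+ top l.
Proof.
move=> lN up; apply: (le_trans (upsum_le_peaks R eN lN)).
rewrite up mul1r; have := eN lN => -[->|]; last by lia.
rewrite -exprS lerD2r /peaksum [in leRHS]big_mkcond big_ltn /=; last by lia.
rewrite -big_mkcond /= lerDr; case: ifP => // _; exact: exp2_ge0.
Qed.

(** The baseline sum at most halves under a shift, whereas the sum of the path halves up to its
    up-mass. The excess therefore shrinks by [s], except for what the up-mass adds. *)
Let h_step l : (l + w.+1 < N)%N ->
  h l.+1 <= h l / s + 6 / q%:R * (c l.+1 + y l.+1).
Proof.
move=> lN; have s0 := s2_gt0 R m.
have E := winsum_shift R eN (ltac:(lia) : (l + w < N)%N).
have O0 := upsum_ge0 R w e l.
(* With the shift identity this gives [2 * upsum <= S l.+1], so the drop [3 / 2 * upsum] is at most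
   [3 / 4] of [S l.+1], as [root2_drop_le] demands. *)
have OS := upsum_le R w e l.
have S1 := S_gt0 l; have S2 := S_gt0 l.+1.
have half : S l / 2 = S l.+1 - 3 / 2 * upsum R w e l by lra.
have D : H l.+1 - H l / s <= 4 * (H l.+1 / S l.+1) * (3 / 2 * upsum R w e l) / q%:R.
  rewrite /rootsum -root2_half ?(ltW S1) // half.
  by apply: root2_drop_le => //; lra.
have B : rootsum R m w (base k) l / s <= rootsum R m w (base k) l.+1.
  rewrite /rootsum -root2_half ?(ltW (winsum_gt0 _ _ _ _)) //.
  exact/root2_le/base_shift.
have D2 : 4 * (H l.+1 / S l.+1) * (3 / 2 * upsum R w e l) / q%:R <=
    6 / q%:R * (c l.+1 + y l.+1).
  have -> : 4 * (H l.+1 / S l.+1) * (3 / 2 * upsum R w e l) / q%:R =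
    6 / q%:R * (H l.+1 / S l.+1 * upsum R w e l) by field; rewrite !lt0r_neq0.
  apply: ler_wpM2l; first by apply: divr_ge0 => //; exact: ltW.
  by rewrite /tailterm /peakterm -mulrDr; apply: ler_wpM2l => //; exact: upsum_next.
rewrite /excess mulrBl; lra.
Qed.

Let h_0 : h 0 = 0.
Proof.
apply/eqP; rewrite subr_eq0; apply/eqP; congr (root2 m _).
by apply: eq_winsum => j hj; apply: e_left; lia.
Qed.

(** Summing the recursion from excess 0: a loss of at least [1 / (2 q)] against a gain of [6 / q]
    yields 12. *)
Let sum_h_le L : (L + w < N)%N ->
  \sum_(0 <= l < L.+1) h l <= 12 * \sum_(0 <= l < L.+1) (c l + y l).
Proof.
move=> LN; set X := \sum_(0 <= l < L.+1) h l; set Y := \sum_(0 <= l < L.+1) (_ + _).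
have s0 := s2_gt0 R m.
have X1 : X <= X / s + 6 / q%:R * Y.
  rewrite [in leLHS]/X big_nat_recl // h_0 add0r.
  apply: (@le_trans _ _ (\sum_(0 <= l < L) (h l / s + 6 / q%:R * (c l.+1 + y l.+1)))).
    by apply: ler_sum_nat => l hl; apply: h_step; lia.
  rewrite big_split /= -mulr_suml -mulr_sumr; apply: lerD.
    apply: ler_wpM2r; first by rewrite invr_ge0 ltW.
    by rewrite /X big_nat_recr //= lerDl h_ge0 //; lia.
  apply: ler_wpM2l; first by apply: divr_ge0 => //; exact: ltW.
  by rewrite /Y [in leRHS]big_nat_recl // lerDr addr_ge0.
have X0 : 0 <= X by rewrite /X big_nat; apply: sumr_ge0 => l hl; apply: h_ge0; lia.
have := ler_wpM2l X0 (s2_lb R m) => X2.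
have X3 : X * (1 / 2 / q%:R) <= 6 / q%:R * Y by lra.
have := ler_wpM2l (mulr_ge0 (ler0n R 2) (ltW q_gt0)) X3.
have -> : 2 * q%:R * (X * (1 / 2 / q%:R)) = X by field; rewrite lt0r_neq0.
have -> : 2 * q%:R * (6 / q%:R * Y) = 12 * Y by field; rewrite lt0r_neq0.
by [].
Qed.

Let ratio_step l : S l.+1 <= 5 / 4 * S l -> H l / S l <= 5 / 4 * (H l.+1 / S l.+1).
Proof.
move=> SS; have S1 := S_gt0 l; have S2 := S_gt0 l.+1.
have [le|lt] := leP (S l) (S l.+1).
  have HH : H l <= H l.+1 by exact: root2_le.
  rewrite ler_pdivrMr // mulrA mulrAC ler_pdivlMr //.
  have := ler_pM (ltW (H_gt0 l)) (ltW S2) HH SS; lra.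
have := root2_div_le m S2 (ltW lt); rewrite -!/(rootsum _ _ _ _ _).
have := HS_ge0 l.+1; lra.
Qed.

(** If the peaks outweigh the tail, [c l] suffices. If the tail is light, the next position carries
    twice its mass while the ratio [H / S] falls by at most [5 / 4], whence [5 / 8]. Being below 1,
    this factor lets the tails be summed away. *)
Let y_cases l : (l + w.+1 < N)%N ->
  y l <= c l + (if U l then y l else 0) + 5 / 8 * (c l.+1 + y l.+1).
Proof.
move=> lN; have c1 := c_ge0 l; have c2 := c_ge0 l.+1; have y2 := y_ge0 l.+1.
have y1 := y_ge0 l.
case: ifP => [|/negP nU]; first by lra.
rewrite /= in c1 c2 y1 y2 *.
suff : [\/ y l = 0, y l <= c l | y l <= 5 / 8 * (c l.+1 + y l.+1)] by case; lra.
rewrite {1 2}/tailterm /tailmass; case: ifP => [/andP[up1 up2]|_]; last by constructor 1; rewrite mulr0.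
have [CB|BC] := leP (2 ^+ top l) (C l).
  by constructor 2; rewrite /peakterm; apply: ler_wpM2l.
have [SB|BS] := leP (S l) (6 * 2 ^+ top l).
  by case: nU; rewrite /tail_heavy up1 up2 BC SB.
constructor 3; rewrite /tailterm.
have lN' : (l + w < N)%N by lia.
have e2 : e (l + w).+1 = (top l).+1 by case: (eN lN') => // E; move: up2; rewrite E; lia.
have E := winsum_shift R eN lN'.
have O1 := upsum_same lN' up2.
(* The up-mass is at most [C l + 2 * 2 ^+ top l], thus below [3 * 2 ^+ top l] and below [S l / 2];
   hence [S l.+1 <= (1 / 2 + 3 / 4) * S l]. *)
have rat := ratio_step ltac:(lra).
have nt := next_top lN up2.
rewrite e2 exprS in nt.
have f0 := exp2_ge0 R (top l).
have := ler_wpM2r f0 rat.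
have := ler_wpM2l (HS_ge0 l.+1) nt.
have -> : tail l = 2 ^+ top l by rewrite /tailmass up1 up2.
rewrite /peakterm; lra.
Qed.

Let run_or_peak r d : (r + d <= N)%N -> (e r < e r.+1)%N ->
  (exists2 t, (r < t < r + d)%N & peak e t /\ (e r < e t)%N) \/
  (forall i, (i <= d)%N -> e (r + i)%N = (e r + i)%N).
Proof.
move=> rN up; elim: d rN => [|d IH] rN.
  by right=> i; rewrite leqn0 => /eqP->; rewrite !addn0.
have [[t ht pt]|run] := IH ltac:(lia); first by left; exists t => //; lia.
have [d0|d0] := posnP d.
  right=> i; rewrite d0; case: i => [|[|//]] _; first by rewrite !addn0.
  by have := @eN r ltac:(lia); rewrite !addn1; lia.
have [E|E] := @eN (r + d)%N ltac:(lia).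
  right=> i; rewrite leq_eqVlt => /orP[/eqP->|hi]; last by apply: run; lia.
  by rewrite addnS E (run d) // addnS.
left; exists (r + d)%N; first by lia.
have := run d (leqnn d); have := run d.-1 ltac:(lia).
have -> : (r + d.-1 = (r + d).-1)%N by lia.
by rewrite /peak => E1 E2; split; [apply/and3P; split; lia | lia].
Qed.

(** A descent after the end of the first window would leave a peak above its top inside the second
    window, whose tail outweighs all its peaks. Without a descent both tops lie on one ascent. *)
Let U_increasing l l' : (l < l' <= l + w)%N -> (l' + w <= N)%N ->
  U l -> U l' -> (top l < top l')%N.
Proof.
move=> ll' l'N /and4P[_ up _ _] /and4P[_ _ C' _].
have [[t ht [pt et]]|run] := @run_or_peak (l + w) (l' - l) ltac:(lia) up.
  have := @peaksum_ge1 R w e l' t ltac:(lia) pt => /le_lt_trans/(_ C').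
  by rewrite ltr_eXn2l; [lia | lra].
have := run _ (leqnn _); have -> : (l + w + (l' - l) = l' + w)%N by lia.
lia.
Qed.

Let y_U l : U l -> y l <= s ^+ top l.
Proof.
move=> /and4P[up1 up2 _ _]; rewrite /tailterm /tailmass up1 up2 /=.
have fS : 2 ^+ top l <= S l by apply: winsum_ge1; lia.
have f0 := exp2_gt0 R (top l).
have := root2_div_le m f0 fS; rewrite -/(rootsum R m w e l) root2_pow.
by move=> /(ler_wpM2r (ltW f0)); rewrite divfK // lt0r_neq0.
Qed.

Local Notation far l := ((l + 7 * rho <= k)%N || (8 * rho <= top l)%N).

(** The end of the window at [l] still belongs to the window at [l'], and the baseline sum of the
    latter, even times [2 ^+ q], stays below its mass. After the root the factor [2 ^+ q] becomes 2,
    so at least half of the root is excess. *)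
Let U_far_root l l' : (l + 2 * rho <= k)%N -> U l -> far l ->
  (l + 2 * rho <= l' < l + 3 * rho)%N -> s ^+ top l <= 2 * h l'.
Proof.
move=> lk /and4P[_ _ _ Sf] Fl hl'.
have fS : 2 ^+ top l <= S l' by apply: winsum_ge1; lia.
have fH : s ^+ top l <= H l' by rewrite -root2_pow; exact: root2_le.
suff : 2 * rootsum R m w (base k) l' <= H l' by rewrite /excess; lra.
have B0 := winsum_gt0 R w (base k) l'.
have -> : 2 * rootsum R m w (base k) l' = root2 m (2 ^+ q * winsum R w (base k) l').
  by rewrite root2M ?exp2_ge0 // root2_pow s2K.
apply: root2_le; apply: le_trans fS.
(* Of the margin [q + rho], the part [rho] absorbs the [4 * rho + 1] terms of the window and [q]
   provides the factor 2. *)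
have [M Mb Me] : exists2 M, (forall j, (l' <= j <= l' + w)%N -> (base k j <= M)%N)
    & (q + rho + M <= top l)%N.
  have [near|nn] := leqP (l + 7 * rho) k.
    exists (k - l - 2 * rho)%N; first by move=> j; rewrite /base; lia.
    (* Heaviness gives [2 ^+ (k - l) <= S l <= 6 * 2 ^+ top l], and 6 is less than 8. *)
    suff : (k - l <= top l + 3)%N by lia.
    have : (2 : R) ^+ (k - l) < 2 ^+ (top l).+3.
      have fl : 2 ^+ e l <= S l by apply: winsum_ge1; lia.
      have := exp2_le R (leq_trans (_ : k - l <= base k l)%N (@e_ge l ltac:(lia))).
      move=> /(_ ltac:(rewrite /base; lia)) kl.
      rewrite !exprS; have := exp2_gt0 R (top l); lra.
    by rewrite ltr_eXn2l; [lia | lra].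
  exists (5 * rho)%N; first by move=> j; rewrite /base; lia.
  by move: Fl; lia.
apply: (@le_trans _ _ (2 ^+ (q + rho + M))); last exact: exp2_le.
rewrite -addnA exprD; apply: ler_wpM2l; first exact: exp2_ge0.
apply: (le_trans (winsum_le_const R Mb)).
rewrite exprD ler_wpM2r ?exp2_ge0 // -natrX ler_nat.
have [d ->] : exists d, rho = (d + 5)%N by exists (rho - 5)%N; lia.
elim: d => [|d IH] //; rewrite addSn expnS; lia.
Qed.

(** Double counting: each far heavy window charges [rho] windows [l'], and each [l'] is charged by
    windows with increasing tops, that is, by a geometric sum of at most [2 q] times [2 * h l']. *)
Let sum_U_far : \sum_(0 <= l < (k - 2 * rho).+1 | U l && far l) s ^+ top l <=
  4 * q%:R / rho%:R * \sum_(0 <= l < (N - w).+1) h l.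
Proof.
have rho0 : 0 < rho%:R :> R by rewrite ltr0n; lia.
set P := fun l => U l && far l.
rewrite mulrAC ler_pdivlMr // mulrC.
have -> : rho%:R * (\sum_(0 <= l < (k - 2 * rho).+1 | P l) s ^+ top l) =
    \sum_(0 <= l < (k - 2 * rho).+1) \sum_(0 <= l' < (N - w).+1)
      (if P l && (l + 2 * rho <= l' < l + 3 * rho)%N then s ^+ top l else 0).
  rewrite mulr_sumr big_mkcond /=; apply: eq_big_nat => l hl.
  have [Pl|Pl] := boolP (P l); last by rewrite big1.
  rewrite (big_cat_nat (n := l + 2 * rho)) //=; last by lia.
  rewrite [X in _ + X](big_cat_nat (n := l + 3 * rho)) //=; [|lia|lia].
  rewrite big_nat_cond big1 ?add0r; last first.
    by move=> i; case: ifP => //; lia.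
  rewrite [X in _ + X]big_nat_cond [X in _ + X]big1 ?addr0; last first.
    by move=> i; case: ifP => //; lia.
  rewrite (eq_big_nat _ _ (F2 := fun=> s ^+ top l)); last by move=> i ->.
  rewrite sumr_const_nat mulr_natl; congr (_ *+ _); lia.
rewrite exchange_big_nat /= mulr_sumr; apply: ler_sum_nat => l' hl'.
rewrite -big_mkcond /= -mulrA; set T := h l'.
have T0 : 0 <= 2 * T by rewrite mulr_ge0 // h_ge0 //; lia.
rewrite (_ : 4 * (q%:R * T) = 2 * q%:R * (2 * T)); last by ring.
apply: (sum_pow_increasing (E := fun l => top l)) => //.
  move=> i j _ ij /andP[/andP[Ui _] hi] /andP[/andP[Uj _] hj].
  by apply: U_increasing => //; lia.
by move=> i hi /andP[/andP[Ui Fi] hi']; apply: U_far_root => //; lia.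
Qed.

Let sum_U_near : \sum_(0 <= l < (k - 2 * rho).+1 | U l && ~~ far l) s ^+ top l <=
  (5 * rho)%:R * s ^+ (8 * rho).
Proof.
have s0 := s2_ge1 R m.
rewrite (big_cat_nat (n := k - 7 * rho + 1)) //=; last by lia.
rewrite big_nat_cond big1 ?add0r; last by move=> i; lia.
apply: (@le_trans _ _ (\sum_(k - 7 * rho + 1 <= l < (k - 2 * rho).+1) s ^+ (8 * rho))).
  rewrite big_mkcond /=; apply: ler_sum => l _; case: ifP => [/andP[_]|_].
    rewrite negb_or => /andP[_ h8]; apply: ler_weXn2l => //; lia.
  by rewrite exprn_ge0 // ltW // s2_gt0.
rewrite sumr_const_nat -[leLHS]mulr_natl; apply: ler_wpM2r.
  by rewrite exprn_ge0 // ltW // s2_gt0.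
by rewrite ler_nat; lia.
Qed.

(** The range ends where the window is centred at [k]. Solving
    [Y <= Cs + YU + 5 / 8 * (Cs + Y + y L.+1)] for the tail sum [Y] and applying the factor 12 of
    [sum_h_le] produces the constants 64, 32 and 20. *)
Lemma left_excess_sum : \sum_(0 <= l < (k - 2 * rho).+1) h l <=
  64 * \sum_(0 <= l < (N - w).+1) c l
  + 128 * q%:R / rho%:R * \sum_(0 <= l < (N - w).+1) h l
  + 32 * (5 * rho)%:R * s ^+ (8 * rho) + 20 * H (k - 2 * rho).+1.
Proof.
set L := (k - 2 * rho)%N; have sh := @sum_h_le L ltac:(lia).
set Cs := \sum_(0 <= l < (N - w).+1) c l.
have cle i : (i <= (N - w).+1)%N -> \sum_(0 <= l < i) c l <= Cs.
  move=> iN; rewrite /Cs [leRHS](big_cat_nat (n := i)) //= lerDl.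
  by apply: sumr_ge0.
set Y := \sum_(0 <= l < L.+1) y l.
set YU := \sum_(0 <= l < L.+1 | U l) s ^+ top l.
have hU : YU <= 4 * q%:R / rho%:R * \sum_(0 <= l < (N - w).+1) h l
    + (5 * rho)%:R * s ^+ (8 * rho).
  rewrite /YU (bigID (fun l => far l)) /=; apply: lerD; [exact: sum_U_far|exact: sum_U_near].
have yL : y L.+1 <= H L.+1.
  rewrite /tailterm /tailmass; case: ifP => _; last by rewrite mulr0 ltW.
  rewrite -{2}(@divfK _ (S L.+1) _ (H L.+1)) ?lt0r_neq0 //.
  by apply: ler_wpM2l => //; apply: winsum_ge1; lia.
have hY : Y <= Cs + YU + 5 / 8 * (Cs + (Y + y L.+1)).
  apply: (@le_trans _ _ (\sum_(0 <= l < L.+1)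
      (c l + (if U l then y l else 0) + 5 / 8 * (c l.+1 + y l.+1)))).
    by apply: ler_sum_nat => l hl; apply: y_cases; lia.
  rewrite !big_split /= -mulr_sumr big_split /=. apply: lerD; first apply: lerD.
  - by apply: cle; lia.
  - rewrite /YU [leRHS]big_mkcond /=; apply: ler_sum => l _.
    by case: ifP => // /y_U.
  - apply: ler_wpM2l; first lra; apply: lerD.
      apply: le_trans (cle L.+2 _); last by lia.
      by rewrite [leRHS]big_nat_recl // lerDr.
    rewrite /Y -[leRHS]big_nat_recr // [leRHS]big_nat_recl // lerDr.
    exact: y_ge0.
have : \sum_(0 <= l < L.+1) (c l + y l) <= Cs + Y.
  by rewrite big_split /= lerD2r; apply: cle; lia.
lra.
Qed.

End LeftHalf.

(** * Whole rows: the right half by reflection, and the windows at the diagonal *)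

Section Rows.
Variable R : rcfType.
Implicit Types (m rho w k N l : nat) (e : nat -> nat).

Lemma sum_from0 (P : pred nat) (F : nat -> R) a b :
  \sum_(a <= i < b | P i) F i = \sum_(0 <= i < b - a | P (i + a)%N) F (i + a)%N.
Proof. by rewrite -{1}[a]add0n big_addn. Qed.

(** The margins of width [w] make the excess vanish at both ends, where the recursions of the two
    halves start. *)
Record row_path w k N e : Prop := RowPath {
  row_step : unit_steps N e;
  row_ge : forall j, (j <= N)%N -> (base k j <= e j)%N;
  row_left : forall j, (j <= w)%N -> e j = base k j;
  row_right : forall j, (N - w <= j <= N)%N -> e j = base k j
}.

Definition row_excess m w N k e : R :=
  \sum_(0 <= l < (N - w).+1) excess R m w k e l.

Definition row_drift m w N e : R :=
  \sum_(0 <= l < (N - w).+1) peakterm R m w e l.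

Lemma excess_ge0 m w k N e l : row_path w k N e -> (l + w <= N)%N ->
  0 <= excess R m w k e l.
Proof.
move=> re lN; rewrite subr_ge0; apply: rootsum_mono => j hj.
by apply: (row_ge re); lia.
Qed.

Lemma row_excess_ge0 m w k N e : (w <= N)%N -> row_path w k N e ->
  0 <= row_excess m w N k e.
Proof.
move=> wN re; rewrite /row_excess big_nat; apply: sumr_ge0 => l hl.
by apply: (excess_ge0 _ re); lia.
Qed.

Definition mirror N e j := e (N - j)%N.

Lemma base_mirror N k j : (k <= N)%N -> (j <= N)%N ->
  base (N - k) j = base k (N - j).
Proof. by rewrite /base; lia. Qed.

Lemma row_path_mirror w k N e : (k <= N)%N -> (w <= N)%N -> row_path w k N e ->
  row_path w (N - k) N (mirror N e).
Proof.
move=> kN wN [st ge le ri]; split; rewrite /mirror.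
- move=> j jN; have E : (N - j = (N - j.+1).+1)%N by lia.
  by rewrite E; case: (st (N - j.+1)%N) => [|->|->]; [lia | right | left].
- by move=> j jN; rewrite base_mirror //; apply: ge; lia.
- by move=> j jw; rewrite base_mirror //; [apply: ri; lia | lia].
- by move=> j jN; rewrite base_mirror //; [apply: le; lia | lia].
Qed.

Lemma winsum_mirror w N e l : (l + w <= N)%N ->
  winsum R w (mirror N e) l = winsum R w e (N - w - l).
Proof.
move=> lN; rewrite /winsum sum_from0 [RHS]sum_from0 !addKn.
rewrite [RHS]big_nat_rev /=; apply: eq_big_nat => j hj.
by rewrite /mirror; congr (_ ^+ e _); lia.
Qed.

(** Only an inequality: a peak at [N] is reflected to index 0, where [peak] is false by
    definition. *)
Lemma peaksum_mirror w N e l : (l + w <= N)%N ->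
  peaksum R w (mirror N e) l <= peaksum R w e (N - w - l).
Proof.
move=> lN; rewrite /peaksum sum_from0 [leRHS]sum_from0 !addKn.
rewrite [leRHS]big_nat_rev /= big_mkcond [leRHS]big_mkcond /=.
apply: ler_sum_nat => j hj.
have [pj|_] := boolP (peak (mirror N e) (j + l)); last first.
  by case: ifP => // _; exact: exp2_ge0.
have -> : (0 + w.+1 - j.+1 + (N - w - l) = N - (j + l))%N by lia.
suff -> : peak e (N - (j + l)) by [].
case/and3P: pj => jl; rewrite /mirror.
have [E|lt] : (j + l = N)%N \/ (j + l < N)%N by lia.
  have -> : (N - (j + l).+1 = N - (j + l))%N by lia.
  by rewrite ltnn.
have -> : (N - (j + l).-1 = (N - (j + l)).+1)%N by lia.
have -> : (N - (j + l).+1 = (N - (j + l)).-1)%N by lia.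
by rewrite /peak => -> ->; rewrite !andbT; lia.
Qed.

Lemma rootsum_mirror m w N e l : (l + w <= N)%N ->
  rootsum R m w (mirror N e) l = rootsum R m w e (N - w - l).
Proof. by move=> lN; rewrite /rootsum winsum_mirror. Qed.

Lemma excess_mirror m w N k e l : (k <= N)%N -> (l + w <= N)%N ->
  excess R m w (N - k) (mirror N e) l = excess R m w k e (N - w - l).
Proof.
move=> kN lN; rewrite /excess rootsum_mirror //; congr (_ - _).
rewrite -rootsum_mirror // /rootsum; congr (root2 m _).
by apply: eq_winsum => j hj; rewrite base_mirror //; lia.
Qed.

Lemma peakterm_mirror m w N e l : (l + w <= N)%N ->
  peakterm R m w (mirror N e) l <= peakterm R m w e (N - w - l).
Proof.
move=> lN; rewrite /peakterm rootsum_mirror // winsum_mirror //.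
apply: ler_wpM2l; last exact: peaksum_mirror.
by apply: divr_ge0; apply: ltW; [exact: rootsum_gt0 | exact: winsum_gt0].
Qed.

Lemma sum_mirror (F : nat -> R) M :
  \sum_(0 <= l < M.+1) F (M - l)%N = \sum_(0 <= l < M.+1) F l.
Proof.
by rewrite [RHS]big_nat_rev /=; apply: eq_big_nat => l hl; congr F; lia.
Qed.

Lemma row_excess_mirror m w N k e : (k <= N)%N -> (w <= N)%N ->
  row_excess m w N (N - k) (mirror N e) = row_excess m w N k e.
Proof.
move=> kN wN; rewrite /row_excess -[RHS]sum_mirror.
by apply: eq_big_nat => l hl; apply: excess_mirror => //; lia.
Qed.

Lemma row_drift_mirror m w N e : (w <= N)%N ->
  row_drift m w N (mirror N e) <= row_drift m w N e.
Proof.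
move=> wN; rewrite /row_drift -[leRHS]sum_mirror.
by apply: ler_sum_nat => l hl; apply: peakterm_mirror; lia.
Qed.

(* Near the diagonal the baseline is bounded, and consecutive windows have
   comparable sums, so a large one contributes [2 ^ m] times to the excess. *)
Lemma rootsum_diag m rho k N e l :
  row_path (4 * rho) k N e -> (2 * (4 * rho) <= k)%N -> (k + 2 * (4 * rho) <= N)%N ->
  (2 ^ m + 3 <= rho)%N -> (k <= l + 2 * rho + 1 <= k + 2)%N ->
  rootsum R m (4 * rho) e l <=
    2 / (2 ^ m)%:R * row_excess m (4 * rho) N k e
    + 2 * ((4 * rho).+1%:R * 2 ^+ (8 * rho)).
Proof.
move=> re k1 k2 rq hl; set w := (4 * rho)%N; set q := (2 ^ m)%N.
set D : R := w.+1%:R * 2 ^+ (8 * rho).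
set H := rootsum R m w e; set s := s2 R m.
have s0 : 0 < s := s2_gt0 R m.
have q0 : 0 < q%:R :> R by rewrite ltr0n expn_gt0.
have D1 : 1 <= D by apply: (@le_trans _ _ (1 * 1)); [lra | apply: ler_pM; rewrite ?exp2_ge1 // ler1n].
have H0 i : 0 < H i by exact: rootsum_gt0.
have Hs i : (i + w < N)%N -> H i / s <= H i.+1.
  move=> iN; rewrite /H /rootsum -root2_half ?(ltW (winsum_gt0 _ _ _ _)) //.
  apply: root2_le; rewrite (winsum_shift R (row_step re) iN).
  by have := upsum_ge0 R w e i; lra.
have Hd d : (d <= q)%N -> H l / s ^+ d <= H (l + d)%N.
  elim: d => [|d IH] dq; first by rewrite expr0 divr1 addn0.
  rewrite addnS; apply: le_trans (Hs _ _); last by lia.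
  rewrite exprSr invfM mulrA; apply: ler_wpM2r; last by apply: IH; lia.
  by rewrite invr_ge0 ltW.
have Hhalf d : (d <= q)%N -> H l / 2 <= H (l + d)%N.
  move=> dq; apply: le_trans (Hd d dq); apply: ler_wpM2l; first exact: ltW.
  rewrite lef_pV2 ?posrE ?exprn_gt0 // -(s2K R m).
  by apply: ler_weXn2l => //; exact: s2_ge1.
have HD d : (d < q)%N -> rootsum R m w (base k) (l + d) <= D.
  move=> dq; apply: (@le_trans _ _ (root2 m D)).
    apply: root2_le; apply: winsum_le_const => j hj; rewrite /base; lia.
  have D0 : 0 < D by lra.
  have D10 : (0 : R) < 1 by [].
  have := root2_div_le m D10 D1; rewrite root2_1 divr1.
  by rewrite ler_pdivrMr // mul1r.
have hsum : q%:R * (H l / 2 - D) <= row_excess m w N k e.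
  rewrite /row_excess (big_cat_nat (n := l)) //=; last by lia.
  rewrite [X in _ <= _ + X](big_cat_nat (n := l + q)) //=; [|lia|lia].
  have a0 : 0 <= \sum_(0 <= i < l) excess R m w k e i.
    by rewrite big_nat; apply: sumr_ge0 => i hi; apply: (excess_ge0 _ re); lia.
  have b0 : 0 <= \sum_(l + q <= i < (N - w).+1) excess R m w k e i.
    by rewrite big_nat; apply: sumr_ge0 => i hi; apply: (excess_ge0 _ re); lia.
  suff : q%:R * (H l / 2 - D) <= \sum_(l <= i < l + q) excess R m w k e i by lra.
  rewrite mulr_natl -[X in _ *+ X](addKn l) -sumr_const_nat.
  apply: ler_sum_nat => i hi; rewrite /excess.
  have -> : i = (l + (i - l))%N by lia.
  have := Hhalf (i - l)%N ltac:(lia); have := HD (i - l)%N ltac:(lia).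
  rewrite -/H; lra.
have : H l / 2 - D <= row_excess m w N k e / q%:R.
  by rewrite ler_pdivlMr // mulrC.
rewrite -/H [2 / _ * _]mulrAC; lra.
Qed.

(** The two halves give 128 times the drift, plus a tenth of the row excess from the heavy tails
    ([rho >= 2560 * q]) and another tenth from the two diagonal windows ([q >= 800]). Moving the
    fifth to the left turns 128 into 160. *)
Lemma row_excess_le_drift m rho : (800 <= 2 ^ m)%N -> (2560 * 2 ^ m <= rho)%N ->
  exists2 K : R, 0 <= K & forall k N e,
    row_path (4 * rho) k N e -> (2 * (4 * rho) <= k)%N ->
    (k + 2 * (4 * rho) <= N)%N ->
    row_excess m (4 * rho) N k e <= 160 * row_drift m (4 * rho) N e + K.
Proof.
move=> q800 rq; set w := (4 * rho)%N.
set D : R := w.+1%:R * 2 ^+ (8 * rho).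
have D0 : 0 <= D by apply: mulr_ge0 => //; exact: exp2_ge0.
set A : R := 32 * (5 * rho)%:R * s2 R m ^+ (8 * rho).
have A0 : 0 <= A by rewrite !mulr_ge0 // exprn_ge0 // ltW // s2_gt0.
exists (5 / 4 * (2 * A + 80 * D)); first lra.
move=> k N e re k1 k2.
have kN : (k <= N)%N by lia.
have wN : (w <= N)%N by lia.
have r5 : (5 <= rho)%N by lia.
have r3 : (2 ^ m + 3 <= rho)%N by lia.
have k1' : (2 * w <= N - k)%N by lia.
have k2' : (N - k + 2 * w <= N)%N by lia.
have l1 : (k <= (k - 2 * rho).+1 + 2 * rho + 1 <= k + 2)%N by lia.
have l2 : (k <= (k - 2 * rho).-1 + 2 * rho + 1 <= k + 2)%N by lia.
have l3 : ((N - k - 2 * rho).+1 + w <= N)%N by lia.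
have E1 : (N - w - (N - k - 2 * rho).+1 = (k - 2 * rho).-1)%N by lia.
have cover : row_excess m w N k e <=
    \sum_(0 <= l < (k - 2 * rho).+1) excess R m w k e l
    + \sum_(0 <= l < (N - k - 2 * rho).+1) excess R m w (N - k) (mirror N e) l.
  rewrite /row_excess (big_cat_nat (n := (k - 2 * rho).+1)) //=; last by lia.
  rewrite lerD2l.
  have -> : \sum_(0 <= l < (N - k - 2 * rho).+1) excess R m w (N - k) (mirror N e) l
      = \sum_(k - 2 * rho <= l < (N - w).+1) excess R m w k e l.
    rewrite [RHS]sum_from0 (_ : ((N - w).+1 - (k - 2 * rho))%N = (N - k - 2 * rho).+1); last by lia.
    rewrite [RHS]big_nat_rev /=; apply: eq_big_nat => l hl.
    rewrite excess_mirror //; last by lia.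
    by congr excess; lia.
  rewrite [leRHS]big_ltn; last by lia.
  by rewrite lerDr; apply: (excess_ge0 _ re); lia.
have q0 : 0 < (2 ^ m)%:R :> R by rewrite ltr0n expn_gt0.
have rho0 : 0 < rho%:R :> R by rewrite ltr0n; lia.
have c1 : 128 * (2 ^ m)%:R / rho%:R <= 1 / 20 :> R.
  rewrite ler_pdivrMr //; have : (2560 * 2 ^ m)%:R <= rho%:R :> R by rewrite ler_nat.
  rewrite natrM; lra.
have c2 : 2 / (2 ^ m)%:R <= 1 / 400 :> R.
  rewrite ler_pdivrMr //; have : 800%:R <= (2 ^ m)%:R :> R by rewrite ler_nat.
  lra.
have re' := row_path_mirror kN wN re.
set Phi := row_excess m w N k e; set Dr := row_drift m w N e.
have Phi0 : 0 <= Phi by exact: (row_excess_ge0 _ wN re).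
have Lf := left_excess_sum R (m := m) (row_step re) (row_ge re) (row_left re) k1 k2 r3 r5.
have Lr := left_excess_sum R (m := m) (row_step re') (row_ge re') (row_left re')
  k1' k2' r3 r5.
rewrite -/w -/(row_drift m w N e) -/(row_excess m w N k e) -/Phi -/Dr -/A in Lf.
rewrite -/w -/(row_drift m w N (mirror N e)) in Lr.
rewrite -/(row_excess m w N (N - k) (mirror N e)) -/A in Lr.
rewrite row_excess_mirror // -/Phi in Lr.
have dm : row_drift m w N (mirror N e) <= Dr by exact: row_drift_mirror.
have d1 := rootsum_diag (l := (k - 2 * rho).+1) re k1 k2 r3 l1.
have d2 := rootsum_diag (l := (k - 2 * rho).-1) re k1 k2 r3 l2.
rewrite -/w -/D -/Phi in d1 d2.
rewrite (rootsum_mirror _ _ l3) E1 in Lr.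
have := ler_wpM2r Phi0 c1; have := ler_wpM2r Phi0 c2.
rewrite -/Phi in cover.
lra.
Qed.

End Rows.

(** * The effect of a value swap on a row *)

Section Mixing.
Variable R : rcfType.
Implicit Types (m rho w k N l : nat) (e : nat -> nat).

(** Twice the difference of the sides is the double sum of
    [- b i * b j * (A i - A j) * (G i - G j)]. *)
Lemma chebyshev_sum (r : seq nat) (b A G : nat -> R) :
  (forall i, 0 <= b i) -> (forall i j, (A i - A j) * (G i - G j) <= 0) ->
  (\sum_(i <- r) b i * (A i * G i)) * (\sum_(i <- r) b i) <=
  (\sum_(i <- r) b i * A i) * (\sum_(i <- r) b i * G i).
Proof.
move=> b0 AG; rewrite -subr_ge0 !big_distrlr /= -sumrB.
set X := \sum_(_ <- r) _.
have X1 : X = \sum_(i <- r) \sum_(j <- r) b i * b j * (A i * G j - A i * G i).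
  apply: eq_bigr => i _; rewrite -sumrB; apply: eq_bigr => j _; ring.
have X2 : X = \sum_(i <- r) \sum_(j <- r) b i * b j * (A j * G i - A j * G j).
  rewrite X1 exchange_big /=; apply: eq_bigr => i _; apply: eq_bigr => j _; ring.
suff : 0 <= X + X by lra.
rewrite {1}X1 X2 -big_split /=; apply: sumr_ge0 => i _.
rewrite -big_split /=; apply: sumr_ge0 => j _.
rewrite -mulrDr; apply: mulr_ge0; first exact: mulr_ge0.
have := AG i j; lra.
Qed.

(* [e1], [e], [e2] are three consecutive rows, and [e'] is the middle one after a
   swap of the two values next to it; [al] and [ga] tell whether those values
   occur before a given position. *)
Record swapped_row (e1 e e2 e' : nat -> nat) := SwappedRow {
  sr_al : nat -> bool;
  sr_ga : nat -> bool;
  sr_almono : forall i j, (i <= j)%N -> sr_al i -> sr_al j;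
  sr_gamono : forall i j, (i <= j)%N -> sr_ga i -> sr_ga j;
  sr_e1 : forall j, (e1 j + 1 = e j + 2 * sr_al j)%N;
  sr_e2 : forall j, (e2 j + 2 * sr_ga j = e j + 1)%N;
  sr_e' : forall j, (e' j + 2 * sr_ga j = e j + 2 * sr_al j)%N
}.

(** With weights [2 ^+ e], the other three rows carry the densities [A / 2], [2 * G] and [A * G],
    where [A] is nondecreasing and [G] nonincreasing in the position. *)
Lemma winsum_swap w e1 e e2 e' l : swapped_row e1 e e2 e' ->
  winsum R w e' l * winsum R w e l <= winsum R w e1 l * winsum R w e2 l.
Proof.
case=> al ga almono gamono h1 h2 h'.
set A := fun j : nat => 4 ^+ (al j) : R; set G := fun j : nat => (4 ^+ (ga j))^-1 : R.
have E1 : winsum R w e1 l = (\sum_(l <= j < l + w.+1) 2 ^+ e j * A j) / 2.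
  rewrite /winsum mulr_suml; apply: eq_bigr => j _; rewrite /A.
  have := h1 j; case: (al j) => /= E.
    have -> : e1 j = (e j).+1 by lia.
    by rewrite exprS expr1; field.
  have -> : e j = (e1 j).+1 by lia.
  by rewrite exprS expr0; field.
have E2 : winsum R w e2 l = (\sum_(l <= j < l + w.+1) 2 ^+ e j * G j) * 2.
  rewrite /winsum mulr_suml; apply: eq_bigr => j _; rewrite /G.
  have := h2 j; case: (ga j) => /= E.
    have -> : e j = (e2 j).+1 by lia.
    by rewrite exprS expr1; field.
  have -> : e2 j = (e j).+1 by lia.
  by rewrite exprS expr0; field.
have E' : winsum R w e' l = \sum_(l <= j < l + w.+1) 2 ^+ e j * (A j * G j).
  rewrite /winsum; apply: eq_bigr => j _; rewrite /A /G.
  have := h' j; case: (ga j); case: (al j) => /= E.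
  - have -> : e' j = e j by lia.
    by rewrite expr1; field.
  - have -> : e j = (e' j).+2 by lia.
    by rewrite !exprS expr0; field.
  - have -> : e' j = (e j).+2 by lia.
    by rewrite !exprS expr0; field.
  - have -> : e' j = e j by lia.
    by rewrite expr0; field.
rewrite E1 E2 E' [leRHS]mulrACA mulVf ?pnatr_eq0 // mulr1; apply: chebyshev_sum.
  by move=> i; exact: exp2_ge0.
have A14 : (4 : R) ^+ 1 = 4 by rewrite expr1.
have mono i j : (i <= j)%N -> (A i - A j) * (G i - G j) <= 0.
  move=> ij; rewrite /A /G; have := almono i j ij; have := gamono i j ij.
  case: (al i); case: (al j); case: (ga i); case: (ga j) => /= a b;
    try (by have := a isT); try (by have := b isT);
    rewrite ?expr0 ?expr1; lra.
move=> i j; have [ij|ji] := leqP i j; first exact: mono.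
have := mono j i (ltnW ji); lra.
Qed.

Lemma winsum_scale w e1 e2 l d :
  (forall j, (l <= j <= l + w)%N -> e2 j = (e1 j + d)%N) ->
  winsum R w e2 l = 2 ^+ d * winsum R w e1 l.
Proof.
move=> h; rewrite /winsum mulr_sumr; apply: eq_big_nat => j hj.
by rewrite h ?exprD 1?mulrC //; lia.
Qed.

Lemma rootsum_scale m w e1 e2 l :
  (forall j, (l <= j <= l + w)%N -> e2 j = (e1 j).+1) ->
  rootsum R m w e2 l = s2 R m * rootsum R m w e1 l.
Proof.
move=> h; rewrite /rootsum (@winsum_scale w e1 e2 l 1) ?expr1 ?root2M //.
by move=> j /h; rewrite addn1.
Qed.

Lemma rootsum_le_scale m w e1 e2 l :
  (forall j, (l <= j <= l + w)%N -> (e2 j <= (e1 j).+1)%N) ->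
  rootsum R m w e2 l <= s2 R m * rootsum R m w e1 l.
Proof.
move=> h; rewrite -(@rootsum_scale m w e1 (fun j => (e1 j).+1)) //.
exact: rootsum_mono.
Qed.

(** Linearises the product bound [H' * H <= H1 * H2]. Neighbouring rows differ by one, so [a * H1]
    and [a^-1 * H2] lie on opposite sides of [H], and the product of their differences from [H] is
    at most 0. *)
Lemma rootsum_swap m w e1 e e2 e' l (a : R) : swapped_row e1 e e2 e' ->
  a = s2 R m \/ a = (s2 R m)^-1 ->
  rootsum R m w e' l <=
    a * rootsum R m w e1 l + a^-1 * rootsum R m w e2 l - rootsum R m w e l.
Proof.
move=> sw ha; have s0 := s2_gt0 R m.
have := root2_le m (winsum_swap w l sw).
rewrite !root2M ?(ltW (winsum_gt0 _ _ _ _)) // -!/(rootsum _ _ _ _ _).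
have H0 := rootsum_gt0 R m w e l.
have up1 : rootsum R m w e1 l <= s2 R m * rootsum R m w e l.
  by apply: rootsum_le_scale => j _; have := sr_e1 sw j; lia.
have dn1 : rootsum R m w e l <= s2 R m * rootsum R m w e1 l.
  by apply: rootsum_le_scale => j _; have := sr_e1 sw j; lia.
have up2 : rootsum R m w e2 l <= s2 R m * rootsum R m w e l.
  by apply: rootsum_le_scale => j _; have := sr_e2 sw j; lia.
have dn2 : rootsum R m w e l <= s2 R m * rootsum R m w e2 l.
  by apply: rootsum_le_scale => j _; have := sr_e2 sw j; case: (sr_ga sw j); lia.
move: (rootsum R m w e' l) (rootsum R m w e1 l) (rootsum R m w e2 l)
  (rootsum R m w e l) H0 up1 dn1 up2 dn2 => H' H1 H2 H H0 up1 dn1 up2 dn2 HH.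
have div (x y : R) : x <= s2 R m * y -> (s2 R m)^-1 * x <= y.
  by move=> xy; rewrite ler_pdivrMl.
suff : H * H' <= H * (a * H1 + a^-1 * H2 - H) by rewrite ler_pM2l.
have aa : a * a^-1 = 1.
  by case: ha => ->; rewrite ?invrK ?mulVf ?mulfV // lt0r_neq0.
have : (a * H1 - H) * (a^-1 * H2 - H) <= 0.
  case: ha => ->.
    rewrite mulr_ge0_le0 ?subr_ge0 ?subr_le0 //; exact: div.
  rewrite invrK mulr_le0_ge0 ?subr_ge0 ?subr_le0 //; exact: div.
have -> : (a * H1 - H) * (a^-1 * H2 - H) =
  a * a^-1 * (H1 * H2) - H * (a * H1 + a^-1 * H2 - H) by ring.
rewrite aa; lra.
Qed.

(** The value of [a] that balances the baselines: left of the diagonal [base k.-1] is one below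
    [base k], right of it one above. It switches as the centre of the window passes [k]. *)
Definition tilt m rho k l : R :=
  if (l + 2 * rho <= k)%N then s2 R m else (s2 R m)^-1.

Lemma tiltP m rho k l : tilt m rho k l = s2 R m \/ tilt m rho k l = (s2 R m)^-1.
Proof. by rewrite /tilt; case: ifP => _; [left|right]. Qed.

Lemma tilt_gt0 m rho k l : 0 < tilt m rho k l.
Proof. by case: (tiltP m rho k l) => ->; rewrite ?invr_gt0 s2_gt0. Qed.

Lemma base_rows m rho k l : (0 < k)%N ->
  tilt m rho k l * rootsum R m (4 * rho) (base k.-1) l
  + (tilt m rho k l)^-1 * rootsum R m (4 * rho) (base k.+1) l
  - 2 * rootsum R m (4 * rho) (base k) l <=
  if (l <= k <= l + 4 * rho)%N then 4 * ((4 * rho).+1%:R * 2 ^+ (4 * rho).+1) else 0.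
Proof.
move=> k0; set w := (4 * rho)%N; have s0 := s2_gt0 R m.
have H0 e : 0 < rootsum R m w e l by exact: rootsum_gt0.
case: ifP => [kin|kout].
  have b e : (forall j, (l <= j <= l + w)%N -> (e j <= w.+1)%N) ->
      rootsum R m w e l <= w.+1%:R * 2 ^+ w.+1.
    move=> he; set D : R := w.+1%:R * 2 ^+ w.+1.
    have D1 : 1 <= D.
      by apply: (@le_trans _ _ (1 * 1)); [lra | apply: ler_pM; rewrite ?exp2_ge1 // ler1n].
    apply: (@le_trans _ _ (root2 m D)); first exact/root2_le/winsum_le_const.
    have D0 : 0 < D by lra.
    have := root2_div_le m (ltr01 : (0 : R) < 1) D1; rewrite root2_1 divr1.
    by rewrite ler_pdivrMr // mul1r.
  have b1 : rootsum R m w (base k.-1) l <= w.+1%:R * 2 ^+ w.+1.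
    by apply: b => j hj; rewrite /base; lia.
  have b2 : rootsum R m w (base k.+1) l <= w.+1%:R * 2 ^+ w.+1.
    by apply: b => j hj; rewrite /base; lia.
  have sl := s2_ge1 R m; have su := s2_le2 R m.
  have si : (s2 R m)^-1 <= 1 by rewrite invf_le1.
  have t2 : tilt m rho k l <= 2 by case: (tiltP m rho k l) => ->; lra.
  have ti2 : (tilt m rho k l)^-1 <= 2.
    by case: (tiltP m rho k l) => ->; rewrite ?invrK; lra.
  have t0 := tilt_gt0 m rho k l.
  have ti0 : 0 < (tilt m rho k l)^-1 by rewrite invr_gt0.
  have := ler_pM (ltW t0) (ltW (H0 _)) t2 b1.
  have := ler_pM (ltW ti0) (ltW (H0 _)) ti2 b2.
  have := H0 (base k); lra.
have [kl|lk] := ltnP k l.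
  have -> : tilt m rho k l = (s2 R m)^-1 by rewrite /tilt; case: ifP => //; lia.
  rewrite (@rootsum_scale m w (base k) (base k.-1)); last first.
    by move=> j hj; rewrite /base; lia.
  rewrite (@rootsum_scale m w (base k.+1) (base k)); last first.
    by move=> j hj; rewrite /base; lia.
  by rewrite invrK mulKf ?lt0r_neq0 //; lra.
have -> : tilt m rho k l = s2 R m by rewrite /tilt; case: ifP => //; lia.
rewrite (@rootsum_scale m w (base k) (base k.+1)); last first.
  by move=> j hj; rewrite /base; lia.
rewrite (@rootsum_scale m w (base k.-1) (base k)); last first.
  by move=> j hj; rewrite /base; lia.
by rewrite mulKf ?lt0r_neq0 //; lra.
Qed.

Lemma excess_swap m rho k e1 e e2 e' l : (0 < k)%N -> swapped_row e1 e e2 e' ->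
  excess R m (4 * rho) k e' l - excess R m (4 * rho) k e l <=
  tilt m rho k l * excess R m (4 * rho) k.-1 e1 l
  + (tilt m rho k l)^-1 * excess R m (4 * rho) k.+1 e2 l
  - 2 * excess R m (4 * rho) k e l
  + (if (l <= k <= l + 4 * rho)%N then 4 * ((4 * rho).+1%:R * 2 ^+ (4 * rho).+1) else 0).
Proof.
move=> k0 sw; have := base_rows m rho l k0.
have := @rootsum_swap m (4 * rho) e1 e e2 e' l _ sw (tiltP m rho k l).
rewrite /excess; set X := (if _ then _ else _).
set a := tilt m rho k l; set b := a^-1; rewrite !mulrBr; lra.
Qed.

End Mixing.

Section RowSums.
Variable R : rcfType.
Implicit Types (m rho w k N l : nat).

(** The coefficient of row [k] after summation by parts. In general it is at most
    [s + s^-1 - 2 = (s - 1) ^+ 2 / s], of second order; at the switch both tilts contribute [s] and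
    [2 * (s - 1)] remains. *)
Lemma tilt_coeff m rho k l : (0 < k)%N ->
  tilt R m rho k.+1 l + (tilt R m rho k.-1 l)^-1 - 2 <=
  1 / (2 ^ m)%:R ^+ 2
  + 2 / (2 ^ m)%:R * ((l + 2 * rho == k) || (l + 2 * rho == k.+1))%N%:R.
Proof.
move=> k0; have s0 := s2_gt0 R m; have s1 := s2_ge1 R m; have su := s2_ub R m.
have q0 : 0 < (2 ^ m)%:R :> R by rewrite ltr0n expn_gt0.
set s := s2 R m in s0 s1 su *; set p : R := 1 / (2 ^ m)%:R in su.
have -> : 1 / (2 ^ m)%:R ^+ 2 = p ^+ 2 by rewrite /p expr_div_n expr1n.
have -> : 2 / (2 ^ m)%:R = 2 * p by rewrite /p; field; rewrite lt0r_neq0.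
have p0 : 0 < p by rewrite divr_gt0.
have gap : s + s^-1 - 2 <= p ^+ 2.
  have -> : s + s^-1 - 2 = (s - 1) ^+ 2 / s by field; rewrite lt0r_neq0.
  rewrite ler_pdivrMr //; apply: (@le_trans _ _ (p ^+ 2)).
    by rewrite ler_sqr ?nnegrE; lra.
  by rewrite ler_peMr // sqr_ge0.
have p2 : 0 <= p ^+ 2 by exact: sqr_ge0.
have b0 : 0 <= 2 * p * ((l + 2 * rho == k) || (l + 2 * rho == k.+1))%N%:R.
  by rewrite mulr_ge0 // mulr_ge0 // ltW.
rewrite /tilt -/s.
have [h1|h1] := leqP (l + 2 * rho) k.-1.
  have -> : (l + 2 * rho <= k.+1)%N by lia.
  by rewrite -/s; lra.
have [h2|h2] := leqP (l + 2 * rho) k.+1; last by rewrite invrK; lra.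
have -> : ((l + 2 * rho == k) || (l + 2 * rho == k.+1))%N by lia.
by rewrite invrK mulr1; lra.
Qed.

(** Summation by parts over the rows; the two extreme rows have no excess. *)
Lemma tilt_sum m rho a b l (h : nat -> R) : (a < b)%N -> (forall k, 0 <= h k) ->
  h a = 0 -> h b = 0 ->
  \sum_(a.+1 <= k < b)
    (tilt R m rho k l * h k.-1 + (tilt R m rho k l)^-1 * h k.+1 - 2 * h k) <=
  1 / (2 ^ m)%:R ^+ 2 * \sum_(a.+1 <= k < b) h k
  + 2 / (2 ^ m)%:R * \sum_(a.+1 <= k < b)
      ((l + 2 * rho == k) || (l + 2 * rho == k.+1))%N%:R * h k.
Proof.
move=> ab h0 ha hb; rewrite !big_split /= sumrN -mulr_sumr.
have T0 k : 0 < tilt R m rho k l by exact: tilt_gt0.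
have s1 : \sum_(a.+1 <= k < b) tilt R m rho k l * h k.-1 <=
    \sum_(a.+1 <= k < b) tilt R m rho k.+1 l * h k.
  case: b ab hb => // b; rewrite ltnS leq_eqVlt => /orP[/eqP->|ab] hb.
    by rewrite !big_geq.
  rewrite big_add1 /= big_ltn // ha mulr0 add0r [leRHS]big_nat_recr //=.
  by rewrite lerDl mulr_ge0 // ltW.
have s2 : \sum_(a.+1 <= k < b) (tilt R m rho k l)^-1 * h k.+1 <=
    \sum_(a.+1 <= k < b) (tilt R m rho k.-1 l)^-1 * h k.
  case: b ab hb {s1} => // b; rewrite ltnS leq_eqVlt => /orP[/eqP->|ab] hb.
    by rewrite !big_geq.
  rewrite big_nat_recr //= hb mulr0 addr0 [leRHS]big_add1 /= [leRHS]big_ltn //=.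
  by rewrite lerDr mulr_ge0 // invr_ge0 ltW.
apply: (le_trans (lerD (lerD s1 s2) (lexx _))).
rewrite !mulr_sumr -sumrN -!big_split /=; apply: ler_sum_nat => k hk.
have := ler_wpM2r (h0 k) (tilt_coeff m rho l (_ : 0 < k)%N).
move=> /(_ ltac:(lia)); set B := (_ || _)%:R.
set t := tilt R m rho k.+1 l; set u := (tilt R m rho k.-1 l)^-1.
by rewrite !mulrDl mulNr mulrA; lra.
Qed.

Lemma sum_indicator (F : nat -> R) a b (i : nat) :
  \sum_(a <= l < b) (l == i)%:R * F l = (a <= i < b)%N%:R * F i.
Proof.
have [hi|hi] := boolP (a <= i < b)%N; last first.
  rewrite mul0r big_nat big1 // => l hl.
  rewrite (_ : (l == i) = false) ?mul0r //; lia.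
rewrite (big_cat_nat (n := i)) //=; [|lia|lia].
rewrite big_nat big1 ?add0r; last first.
  by move=> l hl; rewrite (_ : (l == i) = false) ?mul0r //; lia.
rewrite big_ltn; last by lia.
rewrite eqxx big_nat big1 ?addr0 // => l hl.
by rewrite (_ : (l == i) = false) ?mul0r //; lia.
Qed.

End RowSums.

(** * Heights of a permutation *)

Section Heights.
Variables (n a : nat).
Implicit Types (p : 'S_n) (i j k x : nat).
Local Open Scope nat_scope.

(* [p] acting on the positions and values [a, .., a + n - 1], extended by the
   identity. *)
Definition padded p i : nat :=
  if i < a then i else oapp (fun x : 'I_n => a + p x) i (insub (i - a)).

Lemma padded_in p (x : 'I_n) : padded p (a + x) = a + p x.
Proof.
rewrite /padded ltnNge leq_addr /= addKn.
by case: insubP => [y _ /val_inj->//|]; rewrite ltn_ord.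
Qed.

Lemma padded_out p i : ~~ (a <= i < a + n) -> padded p i = i.
Proof.
move=> out; rewrite /padded; case: ltnP => //= ai; case: insubP => //= y yn E.
lia.
Qed.

Lemma paddedP i : ~~ (a <= i < a + n) \/ exists x : 'I_n, i = a + x.
Proof.
case: (boolP (a <= i < a + n)) => [h|]; last by left.
have hx : i - a < n by lia.
by right; exists (Ordinal hx) => /=; lia.
Qed.

Lemma padded_mul p p' i : padded (p * p')%g i = padded p' (padded p i).
Proof.
case: (paddedP i) => [out|[x ->]]; first by rewrite !padded_out.
by rewrite !padded_in permM.
Qed.

Lemma padded_id i : padded 1%g i = i.
Proof.
case: (paddedP i) => [out|[x ->]]; first by rewrite padded_out.
by rewrite padded_in perm1.
Qed.

Lemma paddedK p : cancel (padded p) (padded p^-1%g).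
Proof. by move=> i; rewrite -padded_mul mulgV padded_id. Qed.

Lemma paddedVK p : cancel (padded p^-1%g) (padded p).
Proof. by move=> i; rewrite -padded_mul mulVg padded_id. Qed.

Lemma padded_lt p i : (padded p i < a) = (i < a).
Proof.
case: (paddedP i) => [out|[x ->]]; first by rewrite padded_out.
by rewrite padded_in; lia.
Qed.

Lemma padded_lt2 p i : (padded p i < a + n) = (i < a + n).
Proof.
case: (paddedP i) => [out|[x ->]]; first by rewrite padded_out.
by rewrite padded_in !ltn_add2l !ltn_ord.
Qed.

Definition smaller p k j := \sum_(0 <= i < j) (padded p i < k).

Lemma sum_eq_lt x j : \sum_(0 <= i < j) (i == x) = (x < j) :> nat.
Proof.
elim: j => [|j IH]; first by rewrite big_geq.
by rewrite big_nat_recr //= IH; lia.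
Qed.

(** Both sides count the pairs of a position below [j] and its value below [k]. Through this
    duality, swaps of values are handled as swaps of positions of the inverse. *)
Lemma smaller_dual p k j : smaller p k j = smaller p^-1%g j k.
Proof.
rewrite /smaller.
have E i : (padded p i < k : nat) = \sum_(0 <= x < k) (padded p i == x).
  rewrite -sum_eq_lt; apply: eq_bigr => x _; by rewrite eq_sym.
rewrite (eq_bigr _ (fun i _ => E i)) exchange_big_nat /=.
apply: eq_bigr => x _; rewrite -sum_eq_lt; apply: eq_bigr => i _.
by rewrite (can2_eq (paddedK p) (paddedVK p)).
Qed.

Lemma smallerS p k j : smaller p k j.+1 = smaller p k j + (padded p j < k).
Proof. by rewrite /smaller big_nat_recr. Qed.

Lemma smallerSl p k j : smaller p k.+1 j = smaller p k j + (padded p^-1%g k < j).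
Proof. by rewrite smaller_dual smallerS -smaller_dual. Qed.

Lemma smaller_lej p k j : smaller p k j <= j.
Proof.
elim: j => [|j IH]; first by rewrite /smaller big_geq.
by rewrite smallerS; case: (_ < k); lia.
Qed.

Lemma smaller_lek p k j : smaller p k j <= k.
Proof. by rewrite smaller_dual smaller_lej. Qed.

Lemma smaller_fix p k j : (forall i, i < j -> (padded p i < k) = (i < k)) ->
  smaller p k j = minn j k.
Proof.
elim: j => [|j IH] h; first by rewrite /smaller big_geq // min0n.
by rewrite smallerS IH => [|i ij]; [rewrite h //; lia | apply: h; lia].
Qed.

Lemma smaller_low p k j : j <= a -> smaller p k j = minn j k.
Proof. by move=> ja; apply: smaller_fix => i ij; rewrite padded_out //; lia. Qed.

Lemma smaller_high p k j : a + n <= j -> smaller p k j = minn j k.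
Proof.
move=> jn; rewrite smaller_dual minnC; apply: smaller_fix => i ij.
case: (paddedP i) => [out|[x ->]]; first by rewrite padded_out.
by rewrite padded_in; have := ltn_ord (p^-1%g x); have := ltn_ord x; lia.
Qed.

Definition height p k j := j + k - 2 * smaller p k j.

Lemma heightE p k j : height p k j + 2 * smaller p k j = j + k.
Proof.
by rewrite /height; have := smaller_lej p k j; have := smaller_lek p k j; lia.
Qed.

Lemma height_base p k j : (j <= a) || (a + n <= j) || (k <= a) || (a + n <= k) ->
  height p k j = base k j.
Proof.
move=> h; suff E : smaller p k j = minn j k by rewrite /height E /base; lia.
case/orP: h => [/orP[/orP[]|]|].
- exact: smaller_low.
- exact: smaller_high.
- by move=> h; rewrite smaller_dual smaller_low // minnC.
- by move=> h; rewrite smaller_dual smaller_high // minnC.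
Qed.

Lemma height_unit_steps p k N : unit_steps N (height p k).
Proof.
move=> j _; have := heightE p k j; have := heightE p k j.+1.
by rewrite smallerS; case: (padded p j < k); lia.
Qed.

Lemma height_ge_base p k j : base k j <= height p k j.
Proof.
have := heightE p k j; have := smaller_lej p k j; have := smaller_lek p k j.
by rewrite /base; lia.
Qed.

Lemma height_row w p k : w <= a -> row_path w k (n + 2 * a) (height p k).
Proof.
move=> wa; split; first exact: height_unit_steps.
- by move=> j _; exact: height_ge_base.
- by move=> j jw; apply: height_base; lia.
- by move=> j jw; apply: height_base; lia.
Qed.

Lemma height_up p k j : (height p k j < height p k j.+1) = (k <= padded p j).
Proof.
have := heightE p k j; have := heightE p k j.+1.
by rewrite smallerS; case: (ltnP (padded p j) k); lia.
Qed.

Lemma height_down p k j : (height p k j.+1 < height p k j) = (padded p j < k).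
Proof.
have := heightE p k j; have := heightE p k j.+1.
by rewrite smallerS; case: (ltnP (padded p j) k); lia.
Qed.

(** A peak is a descent straddling [k], so one descent makes peaks in all rows between its two
    values. *)
Lemma height_peak p k j : peak (height p k) j.+1 =
  (padded p j.+1 < k) && (k <= padded p j).
Proof. by rewrite /peak /= height_up height_down andbC. Qed.

Lemma height_le p k j : a <= j <= a + n -> a <= k <= a + n -> height p k j <= n.
Proof.
move=> hj hk.
have h1 d : height p k (a + d) <= height p k a + d.
  elim: d => [|d IH]; first by rewrite !addn0.
  by rewrite addnS; have := height_unit_steps p k (ltnSn (a + d)); lia.
have h2 d : height p k (a + n - d) <= height p k (a + n) + d.
  elim: d => [|d IH]; first by rewrite subn0 addn0.
  have [E|lt] := leqP (a + n) d.
    rewrite (_ : a + n - d.+1 = a + n - d); lia.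
  have E : a + n - d = (a + n - d.+1).+1 by lia.
  rewrite E in IH.
  by have := height_unit_steps p k (ltnSn (a + n - d.+1)); lia.
have := h1 (j - a); have := h2 (a + n - j).
have -> : a + (j - a) = j by lia.
have -> : a + n - (a + n - j) = j by lia.
rewrite (@height_base p k a); last by lia.
rewrite (@height_base p k (a + n)); last by lia.
by rewrite /base; lia.
Qed.

Lemma peak_range p k j : peak (height p k) j -> a < j < a + n.
Proof.
case: j => [//|j]; rewrite height_peak => /andP[lt ge].
have [ja|aj] := ltnP j a.
  move: ge; rewrite padded_out => [ge|]; last by lia.
  have ja' : j.+1 < a by have := padded_lt p j.+1; lia.
  by move: lt; rewrite padded_out; lia.
have [nj|jn] := leqP (a + n) j.+1; last by lia.
move: lt; rewrite padded_out => [lt|]; last by lia.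
have [nj'|jn'] := leqP (a + n) j; first by move: ge; rewrite padded_out; lia.
by have := padded_lt2 p j; lia.
Qed.

Section Transposition.
Variable i : 'I_n.-1.

Let x := a + i.

Lemma padded_tperm j : padded (tperm (lo i) (hi i)) j =
  if j == x then x.+1 else if j == x.+1 then x else j.
Proof.
case: (paddedP j) => [out|[y ->]].
  rewrite padded_out //; have := ltn_ord (hi i); rewrite /x /= => hin.
  by case: eqP => [E|_]; [lia | case: eqP => [E|_//]; lia].
rewrite padded_in permE /=.
have -> : (a + y == x) = (y == lo i) by rewrite -val_eqE /= /x; lia.
have -> : (a + y == x.+1) = (y == hi i) by rewrite -val_eqE /= /x; lia.
by case: eqP => [_|_]; [rewrite /= addnS | case: eqP].
Qed.

Lemma smaller_tperm_l p k j : j != x.+1 ->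
  smaller (tperm (lo i) (hi i) * p)%g k j = smaller p k j.
Proof.
move=> jx.
have low j' : j' <= x -> smaller (tperm (lo i) (hi i) * p)%g k j' = smaller p k j'.
  elim: j' => [|j' IH] h; first by rewrite /smaller !big_geq.
  rewrite !smallerS IH; last by lia.
  by rewrite padded_mul padded_tperm !ifF //; apply/eqP; lia.
have [|jx'] := leqP j x; first exact: low.
have [d ->] : exists d, j = x.+2 + d by exists (j - x.+2); lia.
elim: d => [|d IH].
  rewrite addn0 !smallerS low // !padded_mul !padded_tperm eqxx.
  by rewrite -addnA [X in _ + X]addnC addnA (_ : (x.+1 == x) = false) ?eqxx //; lia.
rewrite addnS [LHS]smallerS IH [RHS]smallerS padded_mul padded_tperm.
by rewrite !ifF //; apply/eqP; lia.
Qed.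

Lemma smaller_tperm_l_at p k : smaller (tperm (lo i) (hi i) * p)%g k x.+1 =
  smaller p k x + (padded p x.+1 < k).
Proof.
by rewrite smallerS smaller_tperm_l; [rewrite padded_mul padded_tperm eqxx | lia].
Qed.

(* Sorting a descent flattens the peaks it causes, in every row. *)
Lemma height_sort p k j : height p k j =
  height (sort_step p i) k j + 2 * ((j == x.+1) && peak (height p k) x.+1).
Proof.
rewrite height_peak; have := heightE p k j; have := heightE (sort_step p i) k j.
have plo : padded p x = a + p (lo i) by rewrite -padded_in.
have phi : padded p x.+1 = a + p (hi i) by rewrite -padded_in /= addnS.
rewrite /sort_step plo phi; case: ifP => desc; last by case: (j == x.+1); lia.
have [->|jx] := eqVneq j x.+1; last by rewrite smaller_tperm_l //=; lia.
by rewrite smaller_tperm_l_at smallerS plo phi /=; lia.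
Qed.

Lemma mix_stepV p : (mix_step p i)^-1%g = (tperm (lo i) (hi i) * p^-1)%g.
Proof. by rewrite /mix_step invMg tpermV. Qed.

Lemma height_mix_other p k j : k != x.+1 -> height (mix_step p i) k j = height p k j.
Proof.
by move=> kx; rewrite /height smaller_dual mix_stepV smaller_tperm_l // -smaller_dual.
Qed.

Lemma height_mix p : swapped_row (height p x) (height p x.+1) (height p x.+2)
  (height (mix_step p i) x.+1).
Proof.
have E' j : smaller (mix_step p i) x.+1 j = smaller p x j + (padded p^-1%g x.+1 < j).
  by rewrite smaller_dual mix_stepV smaller_tperm_l_at -smaller_dual.
apply: (@SwappedRow _ _ _ _ (fun j => padded p^-1%g x < j)
  (fun j => padded p^-1%g x.+1 < j)) => [j j' jj h|j j' jj h|j|j|j]; try lia;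
  have E1 := smallerSl p x j; have E2 := smallerSl p x.+1 j;
  have H0 := heightE p x j; have H1 := heightE p x.+1 j;
  have H2 := heightE p x.+2 j; have := heightE (mix_step p i) x.+1 j;
  rewrite E'; lia.
Qed.

End Transposition.

End Heights.

(** * Drift of the potential *)

Section Drift.
Variable R : rcfType.
Variables (m rho n : nat).
Implicit Types (p : 'S_n) (k l j : nat).
Local Notation a := (8 * rho)%N.
Local Notation w := (4 * rho)%N.
Local Notation N := (n + 2 * (8 * rho))%N.
Local Notation q := (2 ^ m)%N.

(** The padding [8 * rho] is twice the window length, so each inner row has the room on both sides
    of its diagonal that the row estimates demand. *)
Definition potential p : R :=
  \sum_(a.+1 <= k < a + n) row_excess R m w N k (height a p k).

Lemma height_pad_row p k : row_path w k N (height a p k).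
Proof. by apply: height_row; lia. Qed.

Lemma excess_height_ge0 p k l : 0 <= excess R m w k (height a p k) l.
Proof.
rewrite subr_ge0; apply: rootsum_mono => j _; exact: height_ge_base.
Qed.

Lemma row_excess_height_ge0 p k : 0 <= row_excess R m w N k (height a p k).
Proof. by apply: sumr_ge0 => l _; exact: excess_height_ge0. Qed.

Lemma potential_ge0 p : 0 <= potential p.
Proof. by apply: sumr_ge0 => k _; exact: row_excess_height_ge0. Qed.

Lemma excess_height_out p k l : (k <= a)%N || (a + n <= k)%N ->
  excess R m w k (height a p k) l = 0.
Proof.
move=> hk; apply/eqP; rewrite subr_eq0; apply/eqP; congr (root2 _ _).
by apply: eq_winsum => j _; apply: height_base; lia.
Qed.

Lemma sum_inner (F : nat -> R) :
  \sum_(i < n.-1) F (a + i).+1 = \sum_(a.+1 <= k < a + n) F k.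
Proof.
rewrite -(big_mkord predT (fun i => F (a + i).+1)) [RHS]sum_from0.
have -> : (a + n - a.+1 = n.-1)%N by lia.
by apply: eq_bigr => i _; congr F; lia.
Qed.

Lemma sum_const_inner (c : R) : 0 <= c -> \sum_(a.+1 <= k < a + n) c <= n%:R * c.
Proof.
move=> c0; rewrite sumr_const_nat -[leLHS]mulr_natl; apply: ler_wpM2r => //.
by rewrite ler_nat; lia.
Qed.

Lemma potential_mix_diff p (i : 'I_n.-1) :
  potential (mix_step p i) - potential p =
  row_excess R m w N (a + i).+1 (height a (mix_step p i) (a + i).+1)
  - row_excess R m w N (a + i).+1 (height a p (a + i).+1).
Proof.
rewrite /potential -sumrB.
set F := fun k => row_excess R m w N k (height a (mix_step p i) k)
  - row_excess R m w N k (height a p k).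
rewrite -/(F (a + i).+1) -[RHS]mul1r.
have hin : (a.+1 <= (a + i).+1 < a + n)%N by have := ltn_ord i; lia.
have -> : 1 = (a.+1 <= (a + i).+1 < a + n)%N%:R :> R by rewrite hin.
rewrite -(sum_indicator F); apply: eq_bigr => k _.
have [->|nk] := eqVneq k (a + i).+1; first by rewrite mul1r.
rewrite mul0r; apply/eqP; rewrite subr_eq0; apply/eqP; apply: eq_bigr => l _.
by congr (_ - _); congr root2; apply: eq_winsum => j _; exact: height_mix_other.
Qed.

Definition mix_const : R :=
  (4 * rho).+1%:R * (4 * ((4 * rho).+1%:R * 2 ^+ (4 * rho).+1))
  + 8 * ((4 * rho).+1%:R * 2 ^+ (8 * rho)).

Lemma mix_const_ge0 : 0 <= mix_const.
Proof. by rewrite addr_ge0 // !mulr_ge0 // ?mulr_ge0 // exp2_ge0. Qed.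

(** The coefficient is [1 + 2 * 4]: the second-order part of the tilt, and its first-order part
    [2 / q] at two windows per row, each holding at most [2 / q] of the row excess up to a
    constant. *)
Lemma mix_drift p : (q + 3 <= rho)%N ->
  \sum_(i < n.-1) (potential (mix_step p i) - potential p) <=
  9 / q%:R ^+ 2 * potential p + mix_const * n%:R.
Proof.
move=> rq; have [n0|n_gt0] := posnP n.
  rewrite big1 ?addr_ge0 ?mulr_ge0 ?mix_const_ge0 ?potential_ge0 //.
    by rewrite invr_ge0 exprn_ge0.
  by move=> i _; have := ltn_ord i; lia.
set h := fun k l => excess R m w k (height a p k) l.
pose X k l : R := if (l <= k <= l + w)%N
  then 4 * (w.+1%:R * 2 ^+ w.+1) else 0.
pose ind k l : R := ((l + 2 * rho == k) || (l + 2 * rho == k.+1))%N%:R.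
have hsum : potential p = \sum_(a.+1 <= k < a + n) \sum_(0 <= l < (N - w).+1) h k l.
  by [].
have q0 : 0 < q%:R :> R by rewrite ltr0n expn_gt0.
have q1 : 1 <= q%:R :> R by rewrite ler1n expn_gt0.
have c0 : 0 <= 4 * (w.+1%:R * 2 ^+ w.+1) :> R.
  by rewrite !mulr_ge0 // exp2_ge0.
apply: (@le_trans _ _ (\sum_(a.+1 <= k < a + n) \sum_(0 <= l < (N - w).+1)
    (tilt R m rho k l * h k.-1 l + (tilt R m rho k l)^-1 * h k.+1 l
     - 2 * h k l + X k l))).
  rewrite -sum_inner; apply: ler_sum => i _; rewrite potential_mix_diff.
  rewrite /row_excess -sumrB; apply: ler_sum => l _.
  exact: (@excess_swap R m rho (a + i).+1 _ _ _ _ l isT (height_mix a i p)).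
rewrite exchange_big_nat /=.
have step l : \sum_(a.+1 <= k < a + n)
    (tilt R m rho k l * h k.-1 l + (tilt R m rho k l)^-1 * h k.+1 l
     - 2 * h k l + X k l) <=
    1 / q%:R ^+ 2 * \sum_(a.+1 <= k < a + n) h k l
    + 2 / q%:R * \sum_(a.+1 <= k < a + n) ind k l * h k l
    + \sum_(a.+1 <= k < a + n) X k l.
  rewrite big_split /= lerD2r; apply: (@tilt_sum _ m rho a (a + n) l (h ^~ l)).
  - by lia.
  - by move=> k; exact: excess_height_ge0.
  - by apply: excess_height_out; lia.
  - by apply: excess_height_out; lia.
apply: (le_trans (ler_sum _ (fun l _ => step l))).
rewrite !big_split /= -!mulr_sumr.
have B1 : \sum_(0 <= l < (N - w).+1) \sum_(a.+1 <= k < a + n) h k l = potential p.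
  by rewrite exchange_big_nat.
have B3 : \sum_(0 <= l < (N - w).+1) \sum_(a.+1 <= k < a + n) X k l <=
    n%:R * (w.+1%:R * (4 * (w.+1%:R * 2 ^+ w.+1))).
  rewrite exchange_big_nat /=; apply: le_trans (sum_const_inner _); last first.
    by apply: mulr_ge0.
  apply: ler_sum_nat => k hk; rewrite /X -big_mkcond /=.
  have kw : (w <= k)%N by lia.
  rewrite (big_cat_nat (n := k - w)) //=; last by lia.
  rewrite big_nat_cond big1 ?add0r; last by move=> l; lia.
  rewrite (big_cat_nat (n := k.+1)) //=; [|lia|lia].
  rewrite [X in _ + X]big_nat_cond [X in _ + X]big1 ?addr0; last by move=> l; lia.
  rewrite big_mkcond /=.
  apply: (@le_trans _ _ (\sum_(k - w <= l < k.+1) 4 * (w.+1%:R * 2 ^+ w.+1))).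
    by apply: ler_sum => l _; case: ifP.
  rewrite sumr_const_nat -[leLHS]mulr_natl; apply: ler_wpM2r => //.
  by rewrite ler_nat; lia.
have B2 : \sum_(0 <= l < (N - w).+1) \sum_(a.+1 <= k < a + n) ind k l * h k l <=
    4 / q%:R * potential p + n%:R * (4 * (w.+1%:R * 2 ^+ (8 * rho))).
  rewrite exchange_big_nat /=; set D : R := w.+1%:R * 2 ^+ (8 * rho).
  have D0 : 0 <= D by rewrite mulr_ge0 // exp2_ge0.
  apply: le_trans (lerD (lexx _) (sum_const_inner _)); last by rewrite mulr_ge0.
  rewrite /potential mulr_sumr -big_split /=; apply: ler_sum_nat => k hk.
  apply: (@le_trans _ _ (\sum_(0 <= l < (N - w).+1)
      ((l == (k - 2 * rho)%N)%:R * h k l + (l == (k.+1 - 2 * rho)%N)%:R * h k l))).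
    apply: ler_sum => l _; rewrite -mulrDl; apply: ler_wpM2r.
      exact: excess_height_ge0.
    rewrite /ind; have := eqVneq (l + 2 * rho)%N k; case=> [E|E].
      have -> : (l == (k - 2 * rho)%N) by lia.
      by rewrite /= lerDl.
    have := eqVneq (l + 2 * rho)%N k.+1; case=> [E'|E'] /=; last by rewrite addr_ge0.
    have -> : (l == (k.+1 - 2 * rho)%N) by lia.
    by rewrite lerDr.
  rewrite big_split /= !sum_indicator.
  have hin1 : (0 <= k - 2 * rho < (N - w).+1)%N by lia.
  have hin2 : (0 <= k.+1 - 2 * rho < (N - w).+1)%N by lia.
  rewrite hin1 hin2 !mul1r.
  have hk1 : (2 * w <= k)%N by lia.
  have hk2 : (k + 2 * w <= N)%N by lia.
  have hl1 : (k <= k - 2 * rho + 2 * rho + 1 <= k + 2)%N by lia.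
  have hl2 : (k <= k.+1 - 2 * rho + 2 * rho + 1 <= k + 2)%N by lia.
  have := rootsum_diag R (m := m) (height_pad_row p k) hk1 hk2 rq hl1.
  have := rootsum_diag R (m := m) (height_pad_row p k) hk1 hk2 rq hl2.
  rewrite -/D /h /excess => H1 H2.
  have := rootsum_gt0 R m w (base k) (k - 2 * rho).
  have := rootsum_gt0 R m w (base k) (k.+1 - 2 * rho).
  set E := row_excess _ _ _ _ _ _ in H1 H2 *.
  have -> : 4 / q%:R * E = 2 / q%:R * E + 2 / q%:R * E by field; rewrite lt0r_neq0.
  lra.
rewrite B1; apply: (le_trans (lerD (lerD (lexx _) (ler_wpM2l _ B2)) B3)).
  by rewrite divr_ge0 // ltW.
set P := potential p; set D : R := w.+1%:R * 2 ^+ (8 * rho).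
set Y : R := w.+1%:R * (4 * _).
have -> : mix_const = Y + 8 * D by [].
have D0 : 0 <= D by rewrite mulr_ge0 // exp2_ge0.
have -> : 9 / q%:R ^+ 2 * P = 1 / q%:R ^+ 2 * P + 2 / q%:R * (4 / q%:R * P).
  by field; rewrite lt0r_neq0.
rewrite mulrDr.
have : 2 / q%:R * (n%:R * (4 * D)) <= 2 * (n%:R * (4 * D)).
  apply: ler_wpM2r; first by apply: mulr_ge0 => //; exact: mulr_ge0.
  by rewrite ler_pdivrMr //; lra.
lra.
Qed.

End Drift.

(** * Drift of a sorting step *)

Section SortDrift.
Variable R : rcfType.
Variables (m rho n : nat).
Implicit Types (p : 'S_n) (k l j : nat).
Local Notation a := (8 * rho)%N.
Local Notation w := (4 * rho)%N.
Local Notation N := (n + 2 * (8 * rho))%N.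
Local Notation q := (2 ^ m)%N.
Local Notation pot := (@potential R m rho n).

(** Lowering a peak by 2 removes three quarters of its weight; the tangent bound turns this into a
    drop of the root. *)
Lemma rootsum_sort p (i : 'I_n.-1) k l :
  rootsum R m w (height a (sort_step p i) k) l <= rootsum R m w (height a p k) l
  - ((l <= (a + i).+1 <= l + w)%N && peak (height a p k) (a + i).+1)%:R
    * (3 / 4 / q%:R * (rootsum R m w (height a p k) l / winsum R w (height a p k) l)
       * 2 ^+ height a p k (a + i).+1).
Proof.
set j := (a + i).+1; set e := height a p k; set e' := height a (sort_step p i) k.
have E x : e x = (e' x + 2 * ((x == j) && peak e j))%N by exact: height_sort.
have [/andP[hj pj]|no] := boolP (_ && _); last first.
  rewrite mul0r subr0; apply: rootsum_mono => x hx; rewrite (E x); lia.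
rewrite mul1r; have S0 := winsum_gt0 R w e l.
have ej : e j = (e' j + 2)%N by rewrite {1}(E j) eqxx pj.
have dS : winsum R w e' l = winsum R w e l - 3 / 4 * 2 ^+ e j.
  have : winsum R w e l - winsum R w e' l =
      \sum_(l <= x < l + w.+1) (x == j)%:R * (2 ^+ e x - 2 ^+ e' x).
    rewrite /winsum -sumrB; apply: eq_bigr => x _.
    have [->|nx] := eqVneq x j; first by rewrite mul1r.
    by rewrite (E x) (negbTE nx) addn0 subrr mulr0.
  rewrite (sum_indicator (fun x => 2 ^+ e x - 2 ^+ e' x)).
  have -> : (l <= j < l + w.+1)%N by lia.
  by rewrite mul1r ej exprD; lra.
have fS : 2 ^+ e j <= winsum R w e l by apply: winsum_ge1.
have f0 := exp2_ge0 R (e j).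
rewrite /rootsum dS; apply: (le_trans (root2_drop_ge m S0 _)); first by lra.
rewrite le_eqVlt; apply/orP; left; apply/eqP; field.
by rewrite pnatr_eq0 expn_eq0 /= (lt0r_neq0 S0).
Qed.

(** Peaks occur only strictly inside the unpadded range, so each of them is hit by exactly one index
    of the sorting step. *)
Lemma sum_peaks_inner p k l : (l + w <= N)%N ->
  \sum_(a.+1 <= j < a + n)
    ((l <= j <= l + w)%N && peak (height a p k) j)%:R * 2 ^+ height a p k j =
  peaksum R w (height a p k) l.
Proof.
move=> lN; set e := height a p k; rewrite /peaksum.
transitivity (\sum_(0 <= j < N.+1)
    (if (l <= j <= l + w)%N && peak e j then 2 ^+ e j else 0 : R)).
  rewrite [RHS](big_cat_nat (n := a.+1)) //=; last by lia.
  rewrite [X in _ = X + _]big_nat_cond [X in _ = X + _]big1 ?add0r; last first.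
    move=> j hj; case: ifP => // /andP[_ pj].
    by have := peak_range pj; lia.
  have [n1|n1] := leqP n 0.
    rewrite big_geq; last by lia.
    rewrite big_nat_cond big1 // => j hj; case: ifP => // /andP[_ pj].
    by have := peak_range pj; lia.
  rewrite [RHS](big_cat_nat (n := a + n)) //=; [|lia|lia].
  rewrite [X in _ = _ + X]big_nat_cond [X in _ = _ + X]big1 ?addr0; last first.
    move=> j hj; case: ifP => // /andP[_ pj].
    by have := peak_range pj; lia.
  by apply: eq_bigr => j _; case: ifP => _; rewrite ?mul1r ?mul0r.
rewrite (big_cat_nat (n := l)) //=; last by lia.
rewrite [X in X + _]big_nat_cond [X in X + _]big1 ?add0r; last first.
  by move=> j hj; rewrite ifF //; lia.
rewrite (big_cat_nat (n := l + w.+1)) //=; [|lia|lia].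
rewrite [X in _ + X]big_nat_cond [X in _ + X]big1 ?addr0; last first.
  by move=> j hj; rewrite ifF //; lia.
rewrite [RHS]big_mkcond /=; apply: eq_big_nat => j hj.
by have -> : (l <= j <= l + w)%N by lia.
Qed.

Lemma sort_drift p :
  \sum_(i < n.-1) (pot (sort_step p i) - pot p) <=
  - (3 / 4 / q%:R * \sum_(a.+1 <= k < a + n) row_drift R m w N (height a p k)).
Proof.
set e := height a p.
pose t j k l := ((l <= j <= l + w)%N && peak (e k) j)%:R * 2 ^+ e k j : R.
pose c k l := 3 / 4 / q%:R * (rootsum R m w (e k) l / winsum R w (e k) l).
apply: (@le_trans _ _ (\sum_(i < n.-1) \sum_(a.+1 <= k < a + n)
    \sum_(0 <= l < (N - w).+1) - (c k l * t (a + i).+1 k l))).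
  apply: ler_sum => i _; rewrite /potential -sumrB; apply: ler_sum => k _.
  rewrite /row_excess -sumrB; apply: ler_sum => l _.
  have := rootsum_sort p i k l; rewrite -/e /excess /c /t.
  set b := (_ && _)%:R; set C := 3 / 4 / q%:R * _; lra.
rewrite (sum_inner rho n (fun j => \sum_(a.+1 <= k < a + n)
    \sum_(0 <= l < (N - w).+1) - (c k l * t j k l))) exchange_big_nat /=.
rewrite mulr_sumr -sumrN; apply: ler_sum => k _.
rewrite exchange_big_nat /= mulr_sumr -sumrN; apply: ler_sum_nat => l hl.
rewrite sumrN -mulr_sumr sum_peaks_inner; last by lia.
by rewrite /c /peakterm -!mulrA.
Qed.

Lemma sort_contract (K : R) p :
  (forall k N e, row_path w k N e -> (2 * w <= k)%N -> (k + 2 * w <= N)%N ->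
    row_excess R m w N k e <= 160 * row_drift R m w N e + K) -> 0 <= K ->
  \sum_(i < n.-1) (pot (sort_step p i) - pot p) <=
  - (3 / 640 / q%:R * pot p) + K * n%:R.
Proof.
move=> hK K0; apply: (le_trans (sort_drift p)).
have q1 : 1 <= q%:R :> R by rewrite ler1n expn_gt0.
set Dr := \sum_(_ <= _ < _) _.
have : pot p <= 160 * Dr + n%:R * K.
  apply: le_trans (lerD (lexx _) (sum_const_inner rho n K0)).
  rewrite /Dr mulr_sumr -big_split /=; apply: ler_sum_nat => k hk.
  by apply: hK; [exact: height_pad_row | lia | lia].
move=> h; have c0 : 0 <= 3 / 640 / q%:R :> R.
  by apply: divr_ge0; lra.
have := ler_wpM2l c0 h.
have -> : 3 / 640 / q%:R * (160 * Dr + n%:R * K) =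
  3 / 4 / q%:R * Dr + 3 / 640 / q%:R * (n%:R * K) by field; rewrite lt0r_neq0 //; lra.
have : 3 / 640 / q%:R * (n%:R * K) <= 1 * (n%:R * K).
  apply: ler_wpM2r; first exact: mulr_ge0.
  by rewrite ler_pdivrMr; lra.
lra.
Qed.

End SortDrift.

(** * Fourth moments of the increments *)

Section Quartic.
Variable R : rcfType.
Implicit Types (m rho w k l j N n : nat).

Lemma weighted_cauchy (I : Type) (r : seq I) (v y : I -> R) :
  (forall i, 0 <= v i) ->
  (\sum_(i <- r) v i * y i) ^+ 2 <=
  (\sum_(i <- r) v i) * \sum_(i <- r) v i * y i ^+ 2.
Proof.
move=> v0; rewrite -subr_ge0 expr2 !big_distrlr /= -sumrB.
set X := \sum_(_ <- r) _.
have X1 : X = \sum_(i <- r) \sum_(j <- r) v i * v j * (y j ^+ 2 - y i * y j).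
  by apply: eq_bigr => i _; rewrite -sumrB; apply: eq_bigr => j _; ring.
have X2 : X = \sum_(i <- r) \sum_(j <- r) v i * v j * (y i ^+ 2 - y i * y j).
  by rewrite X1 exchange_big /=; apply: eq_bigr => i _; apply: eq_bigr => j _; ring.
suff : 0 <= X + X by lra.
rewrite {1}X1 X2 -big_split /=; apply: sumr_ge0 => i _.
rewrite -big_split /=; apply: sumr_ge0 => j _.
have -> : v i * v j * (y j ^+ 2 - y i * y j) + v i * v j * (y i ^+ 2 - y i * y j)
  = v i * v j * (y i - y j) ^+ 2 by ring.
by rewrite mulr_ge0 ?sqr_ge0 // mulr_ge0.
Qed.

(** Cauchy-Schwarz applied twice. *)
Lemma weighted_quartic (I : Type) (r : seq I) (v y : I -> R) (V : R) :
  (forall i, 0 <= v i) -> \sum_(i <- r) v i <= V ->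
  (\sum_(i <- r) v i * y i) ^+ 4 <= V ^+ 3 * \sum_(i <- r) v i * y i ^+ 4.
Proof.
move=> v0 vV; set A := \sum_(i <- r) v i.
have A0 : 0 <= A by exact: sumr_ge0.
have V0 : 0 <= V by exact: le_trans vV.
set B := \sum_(i <- r) v i * y i ^+ 2; set D := \sum_(i <- r) v i * y i ^+ 4.
have B0 : 0 <= B by apply: sumr_ge0 => i _; rewrite mulr_ge0 // sqr_ge0.
have D0 : 0 <= D by apply: sumr_ge0 => i _; rewrite mulr_ge0 // (exprM _ 2 2) sqr_ge0.
have BD : B ^+ 2 <= A * D.
  apply: (le_trans (weighted_cauchy r (fun i => y i ^+ 2) v0)).
  rewrite le_eqVlt; apply/orP; left; apply/eqP; congr (_ * _).
  by apply: eq_bigr => i _; rewrite -exprM.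
have := weighted_cauchy r y v0; rewrite -/A -/B => AB.
rewrite (exprM _ 2 2); apply: (@le_trans _ _ ((A * B) ^+ 2)).
  by rewrite ler_sqr ?nnegrE ?sqr_ge0 ?mulr_ge0.
rewrite exprMn; apply: (@le_trans _ _ (A ^+ 3 * D)).
  have -> : A ^+ 3 * D = A ^+ 2 * (A * D) by ring.
  by apply: ler_wpM2l => //; exact: sqr_ge0.
by rewrite ler_wpM2r // ler_pXn2r.
Qed.

Lemma geometric_sum_le (t : R) b : 0 < t < 1 -> \sum_(0 <= i < b) t ^+ i <= (1 - t)^-1.
Proof.
move=> /andP[t0 t1]; have d0 : 0 < 1 - t by lra.
rewrite -[leRHS]mul1r ler_pdivlMr //.
suff -> : (\sum_(0 <= i < b) t ^+ i) * (1 - t) = 1 - t ^+ b.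
  by have := exprn_gt0 b t0; lra.
elim: b => [|b IH]; first by rewrite big_geq // mul0r expr0 subrr.
by rewrite big_nat_recr //= mulrDl IH exprS; ring.
Qed.

Lemma two_sided_sum_le (t : R) a b k : 0 < t < 1 ->
  \sum_(a <= i < b) t ^+ base k i <= 2 * (1 - t)^-1.
Proof.
move=> t01; have /andP[t0 t1] := t01.
have p0 i : 0 <= t ^+ i by apply: exprn_ge0; exact: ltW.
apply: (@le_trans _ _ (\sum_(0 <= i < k + b) t ^+ base k i)).
  have [ab|ba] := leqP a b; last by rewrite big_geq ?sumr_ge0 // ltnW.
  rewrite [leRHS](big_cat_nat (n := a)) //=; last by lia.
  rewrite [X in _ <= _ + X](big_cat_nat (n := b)) //=; last by lia.
  by rewrite addrCA lerDl addr_ge0 // sumr_ge0.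
rewrite (big_cat_nat (n := k)) //=; last by lia.
rewrite mulr_natl mulr2n; apply: lerD.
  rewrite big_nat_rev /=; apply: le_trans (geometric_sum_le k.+1 t01).
  rewrite [leRHS]big_ltn // [X in _ <= _ + X]big_add1 /=.
  rewrite (@eq_big_nat _ _ _ _ _ _ (fun i => t ^+ i.+1)) ?lerDr //.
  by move=> i hi; congr (_ ^+ _); rewrite /base; lia.
rewrite sum_from0 addKn; apply: le_trans (geometric_sum_le b t01).
rewrite (@eq_big_nat _ _ _ _ _ _ (fun i => t ^+ i)) //.
by move=> i hi; congr (_ ^+ _); rewrite /base; lia.
Qed.

(* The exponent of [s2 R m.+3] is an eighth of that of [s2 R m]: the margin
   between the two pays for both the fourth power and the weight. *)
Lemma excess_quartic m w k e l j :
  (forall i, (l <= i <= l + w)%N -> (base k i <= e i)%N) -> (l <= j <= l + w)%N ->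
  excess R (m + 3) w k e l ^+ 4 * (s2 R (m + 3) ^+ base k j) ^+ 3 <= excess R m w k e l.
Proof.
move=> ge jl; set h := excess R (m + 3) w k e l; set om := s2 R (m + 3) ^+ base k j.
have E x : rootsum R m w x l = rootsum R (m + 3) w x l ^+ 8.
  by rewrite /rootsum root2_add3 // ltW // winsum_gt0.
rewrite /excess !E.
have B0 := rootsum_gt0 R (m + 3) w (base k) l.
have BH : rootsum R (m + 3) w (base k) l <= rootsum R (m + 3) w e l by exact: rootsum_mono.
have om1 : 1 <= om by apply: exprn_ege1; exact: s2_ge1.
have omB : om <= rootsum R (m + 3) w (base k) l.
  by rewrite /om -root2_pow; apply: root2_le; exact: winsum_ge1.
move: B0 BH omB; rewrite /h /excess.
move: (rootsum _ _ _ (base k) _) (rootsum _ _ _ e _) => B H B0 BH oB.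
have H1 : 1 <= H by lra.
have H0 : 0 <= H by lra.
have h0 : 0 <= H - B by lra.
apply: (@le_trans _ _ ((H - B) * H ^+ 7)).
  rewrite (exprS _ 3) -mulrA; apply: ler_wpM2l => //.
  apply: (@le_trans _ _ (H ^+ 3 * H ^+ 3)).
    have om0 : 0 <= om by lra.
    have x1 : (H - B) ^+ 3 <= H ^+ 3 by apply: lerXn2r; rewrite ?nnegrE //; lra.
    have x2 : om ^+ 3 <= H ^+ 3 by apply: lerXn2r; rewrite ?nnegrE //; lra.
    exact: ler_pM (exprn_ge0 _ h0) (exprn_ge0 _ om0) x1 x2.
  by rewrite -exprD (exprS _ 6) ler_peMl // exprn_ge0.
have : B * B ^+ 7 <= B * H ^+ 7.
  by rewrite ler_pM2l // ler_pXn2r ?nnegrE // ltW.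
rewrite (exprS H 7) (exprS B 7); lra.
Qed.

(** Bounds the two-sided geometric series of ratio [1 / s2], uniformly in its length. *)
Definition tail_weight m : R := 4 * (2 ^ m)%:R.

Lemma s2_inv_lt1 m : 0 < (s2 R m)^-1 < 1.
Proof.
rewrite invr_gt0 s2_gt0 /=; have := s2_lb R m.
have : 0 < 1 / 2 / (2 ^ m)%:R :> R by rewrite !divr_gt0 // ltr0n expn_gt0.
lra.
Qed.

Lemma tail_weight_ge m a b k :
  \sum_(a <= i < b) (s2 R m)^-1 ^+ base k i <= tail_weight m.
Proof.
apply: (le_trans (two_sided_sum_le a b k (s2_inv_lt1 m))).
have q0 : 0 < (2 ^ m)%:R :> R by rewrite ltr0n expn_gt0.
have lb := s2_lb R m; rewrite ler_pdivrMr; last first.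
  have : 0 < 1 / 2 / (2 ^ m)%:R :> R by rewrite !divr_gt0.
  lra.
have := ler_wpM2l (ltW q0) lb.
have -> : (2 ^ m)%:R * (1 / 2 / (2 ^ m)%:R) = 1 / 2 :> R by field; rewrite lt0r_neq0.
rewrite /tail_weight; lra.
Qed.

Lemma tail_weight_ge0 m : 0 <= tail_weight m.
Proof. by rewrite mulr_ge0. Qed.

(** Weights decaying with the distance from the diagonal keep the constant independent of the number
    of windows; [excess_quartic] pays for the inverse weights. *)
Lemma row_quartic m w N k e : (w <= N)%N -> row_path w k N e ->
  row_excess R (m + 3) w N k e ^+ 4 <= tail_weight (m + 3) ^+ 3 * row_excess R m w N k e.
Proof.
move=> wN re; set s := s2 R (m + 3).
have s0 : 0 < s := s2_gt0 R (m + 3).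
rewrite /row_excess.
have -> : \sum_(0 <= l < (N - w).+1) excess R (m + 3) w k e l =
  \sum_(0 <= l < (N - w).+1) s^-1 ^+ base k l * (s ^+ base k l * excess R (m + 3) w k e l).
  apply: eq_bigr => l _.
  by rewrite mulrA exprVn mulVf ?mul1r // lt0r_neq0 // exprn_gt0.
apply: (le_trans (weighted_quartic (V := tail_weight (m + 3)) _ _ _)).
- by move=> l; rewrite exprn_ge0 // invr_ge0 ltW.
- exact: tail_weight_ge.
apply: ler_wpM2l; first exact: exprn_ge0 (tail_weight_ge0 _).
apply: ler_sum_nat => l hl.
have hq := @excess_quartic m w k e l l
  ltac:(by move=> i hi; apply: (row_ge re); lia) ltac:(lia).
apply: le_trans hq.
rewrite -/s; set x := s ^+ base k l; have x0 : 0 < x by exact: exprn_gt0.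
rewrite le_eqVlt; apply/orP; left; apply/eqP.
by rewrite exprVn -/x; field; rewrite lt0r_neq0.
Qed.

End Quartic.

(** * Fourth powers of the jumps in one step *)

Section Jumps.
Variable R : rcfType.
Variables (m rho n : nat).
Implicit Types (p : 'S_n) (k l j : nat).
Local Notation a := (8 * rho)%N.
Local Notation w := (4 * rho)%N.
Local Notation N := (n + 2 * (8 * rho))%N.
Local Notation q := (2 ^ m)%N.
Local Notation pot := (@potential R m rho n).
Local Notation pot' := (@potential R (m + 3) rho n).
Local Notation V := (tail_weight R (m + 3)).

Lemma quartic_diff (x y : R) : 0 <= x -> 0 <= y -> (x - y) ^+ 4 <= x ^+ 4 + y ^+ 4.
Proof.
move=> x0 y0; have d (u v : R) : 0 <= v -> v <= u -> (u - v) ^+ 4 <= u ^+ 4 + v ^+ 4.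
  move=> v0 vu; apply: (@le_trans _ _ (u ^+ 4)).
    by apply: lerXn2r; rewrite ?nnegrE //; lra.
  by rewrite lerDl exprn_ge0.
have [xy|yx] := leP x y; last by apply: d => //; exact: ltW.
have -> : (x - y) ^+ 4 = (y - x) ^+ 4 by ring.
by rewrite [leRHS]addrC; exact: d.
Qed.

(** A swap changes one row, so the jump is controlled by the old and new excess of that row. The new
    one is averaged through [mix_drift], and [11 = 9 + 2]. *)
Lemma mix_quartic p : (q + 3 <= rho)%N ->
  \sum_(i < n.-1) (pot' (mix_step p i) - pot' p) ^+ 4 <=
  V ^+ 3 * (11 * pot p + mix_const R rho * n%:R).
Proof.
move=> rq; have V0 : 0 <= V ^+ 3 by rewrite exprn_ge0 // tail_weight_ge0.
have q0 : 0 < q%:R :> R by rewrite ltr0n expn_gt0.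
have q1 : 1 <= q%:R :> R by rewrite ler1n expn_gt0.
pose row p' k := row_excess R m w N k (height a p' k).
have row4 p' k : row_excess R (m + 3) w N k (height a p' k) ^+ 4 <= V ^+ 3 * row p' k.
  by apply: row_quartic; [lia | exact: height_pad_row].
apply: (@le_trans _ _ (\sum_(i < n.-1)
    V ^+ 3 * ((pot (mix_step p i) - pot p) + 2 * row p (a + i).+1))).
  apply: ler_sum => i _; rewrite !potential_mix_diff.
  apply: (le_trans (quartic_diff (row_excess_height_ge0 R _ _ _ _)
                                 (row_excess_height_ge0 R _ _ _ _))).
  have := row4 (mix_step p i) (a + i).+1; have := row4 p (a + i).+1.
  rewrite /row mulrDr mulrBr; lra.
rewrite -mulr_sumr; apply: ler_wpM2l => //; rewrite big_split /=.
have -> : \sum_(i < n.-1) 2 * row p (a + i).+1 = 2 * pot p.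
  by rewrite -mulr_sumr (sum_inner rho n (row p)).
have := mix_drift R p rq; have P0 : 0 <= pot p := potential_ge0 R m rho p.
have : 9 / q%:R ^+ 2 * pot p <= 9 * pot p.
  apply: ler_wpM2r => //; rewrite ler_pdivrMr ?exprn_gt0 //.
  by have := exprn_ege1 2 q1; lra.
lra.
Qed.

(** Many rows may change, but only in windows containing the sorted position. The weights now decay
    across rows, with the distance of [k] from that position. Three factors [w.+1] come from the
    windows within a row, the fourth from the positions within a window. *)
Lemma sort_quartic p :
  \sum_(i < n.-1) (pot' (sort_step p i) - pot' p) ^+ 4 <=
  V ^+ 3 * w.+1%:R ^+ 4 * pot p.
Proof.
set s := s2 R (m + 3); have s0 : 0 < s := s2_gt0 R (m + 3).
have V0 : 0 <= V ^+ 3 by rewrite exprn_ge0 // tail_weight_ge0.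
pose h k l := excess R (m + 3) w k (height a p k) l.
pose hP k l := excess R m w k (height a p k) l.
pose ind j l : R := (l <= j <= l + w)%N%:R.
have ind0 j l : 0 <= ind j l by [].
have h0 k l : 0 <= h k l by exact: excess_height_ge0.
have hP0 k l : 0 <= hP k l by exact: excess_height_ge0.
have indsum j : \sum_(0 <= l < (N - w).+1) ind j l <= w.+1%:R.
  rewrite /ind; apply: (@le_trans _ _ (\sum_(j - w <= l < j.+1) 1)); last first.
    by rewrite sumr_const_nat ler_nat; lia.
  apply: (@le_trans _ _ (\sum_(0 <= l < (N - w).+1 + j.+1) ind j l)).
    by rewrite [leRHS](big_cat_nat (n := (N - w).+1)) ?leq_addr //= lerDl sumr_ge0.
  rewrite (big_cat_nat (n := j - w)) //=; last by lia.
  rewrite [X in _ + X](big_cat_nat (n := j.+1)) //=; [|lia|lia].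
  rewrite big_nat big1 ?add0r; last first.
    by move=> l hl; rewrite /ind (_ : (l <= j <= l + w)%N = false) //; lia.
  rewrite [X in _ + X]big_nat [X in _ + X]big1 ?addr0; last first.
    by move=> l hl; rewrite /ind (_ : (l <= j <= l + w)%N = false) //; lia.
  by apply: ler_sum => l _; rewrite /ind; case: (_ && _).
have jump i : (pot' (sort_step p i) - pot' p) ^+ 4 <=
    V ^+ 3 * w.+1%:R ^+ 3 * \sum_(a.+1 <= k < a + n) \sum_(0 <= l < (N - w).+1)
      ind (a + i).+1 l * hP k l.
  set j := (a + i).+1.
  pose z k := \sum_(0 <= l < (N - w).+1) ind j l * h k l.
  have z0 k : 0 <= z k by apply: sumr_ge0 => l _; exact: mulr_ge0.
  have drop k l : excess R (m + 3) w k (height a (sort_step p i) k) l <= h k l.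
    have := rootsum_sort R (m + 3) rho p i k l; rewrite /h /excess.
    set T := _%:R * _; suff : 0 <= T by lra.
    apply: mulr_ge0 => //; apply: mulr_ge0; last exact: exp2_ge0.
    apply: mulr_ge0; first by rewrite !divr_ge0.
    by apply: divr_ge0; apply: ltW; [exact: rootsum_gt0 | exact: winsum_gt0].
  have le1 : pot' (sort_step p i) <= pot' p.
    by apply: ler_sum => k _; apply: ler_sum => l _; exact: drop.
  have le2 : pot' p - pot' (sort_step p i) <= \sum_(a.+1 <= k < a + n) z k.
    rewrite /potential -sumrB; apply: ler_sum => k _.
    rewrite /row_excess -sumrB; apply: ler_sum => l _.
    rewrite -/(h k l) /ind; have [hj|nj] := boolP (l <= j <= l + w)%N.
      rewrite mul1r gerBl; exact: excess_height_ge0.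
    rewrite mul0r subr_le0 /h /excess lerD2r.
    apply: rootsum_mono => x hx; rewrite (height_sort _ i p k x).
    rewrite (_ : (x == (a + i).+1) = false) ?addn0 //.
    by apply/eqP => E; move: nj; rewrite /j -E; lia.
  have -> : (pot' (sort_step p i) - pot' p) ^+ 4 = (pot' p - pot' (sort_step p i)) ^+ 4.
    by ring.
  apply: (@le_trans _ _ ((\sum_(a.+1 <= k < a + n) z k) ^+ 4)).
    by apply: lerXn2r; rewrite ?nnegrE ?subr_ge0 ?sumr_ge0.
  have -> : \sum_(a.+1 <= k < a + n) z k =
      \sum_(a.+1 <= k < a + n) s^-1 ^+ base j k * (s ^+ base j k * z k).
    apply: eq_bigr => k _.
    by rewrite mulrA exprVn mulVf ?mul1r // lt0r_neq0 // exprn_gt0.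
  apply: (le_trans (weighted_quartic (V := V) _ _ _)).
  - by move=> k; rewrite exprn_ge0 // invr_ge0 ltW.
  - exact: tail_weight_ge.
  rewrite -mulrA; apply: ler_wpM2l => //; rewrite mulr_sumr.
  apply: ler_sum => k _.
  set x := s ^+ base j k; have x0 : 0 < x by exact: exprn_gt0.
  have -> : s^-1 ^+ base j k * (x * z k) ^+ 4 = x ^+ 3 * z k ^+ 4.
    by rewrite exprVn -/x; field; rewrite lt0r_neq0.
  have := weighted_quartic (h k) (ind0 j) (indsum j).
  move=> /(ler_wpM2l (exprn_ge0 3 (ltW x0))) /le_trans; apply.
  rewrite mulrCA; apply: ler_wpM2l; first exact: exprn_ge0.
  rewrite mulr_sumr; apply: ler_sum => l _; rewrite /ind.
  have [hj|nj] := boolP (l <= j <= l + w)%N; last by rewrite !mul0r mulr0.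
  rewrite !mul1r mulrC; have hq := @excess_quartic R m w k (height a p k) l j
    (fun i _ => height_ge_base a p k i) hj.
  by move: hq; rewrite -/s -/(h k l) -/(hP k l) /x (_ : base k j = base j k) // /base addnC.
apply: (le_trans (ler_sum _ (fun i _ => jump i))).
have -> : V ^+ 3 * w.+1%:R ^+ 4 * pot p = V ^+ 3 * w.+1%:R ^+ 3 * (w.+1%:R * pot p).
  by ring.
rewrite -mulr_sumr; apply: ler_wpM2l; first by rewrite mulr_ge0 // exprn_ge0.
rewrite (sum_inner rho n (fun j => \sum_(a.+1 <= k < a + n)
    \sum_(0 <= l < (N - w).+1) ind j l * hP k l)) exchange_big_nat /=.
rewrite /potential mulr_sumr; apply: ler_sum => k _.
rewrite exchange_big_nat /= mulr_sumr; apply: ler_sum => l _.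
rewrite -mulr_suml; apply: ler_wpM2r => //.
apply: (@le_trans _ _ (\sum_(l <= j < l + w.+1) 1)); last first.
  by rewrite sumr_const_nat addKn.
apply: (@le_trans _ _ (\sum_(0 <= j < (a + n) + (l + w.+1)) ind j l)).
  have [an|na] := leqP a.+1 (a + n); last by rewrite big_geq ?sumr_ge0 //; lia.
  rewrite [leRHS](big_cat_nat (n := a.+1)) //=; last by lia.
  rewrite [X in _ <= _ + X](big_cat_nat (n := a + n)) //=; last by lia.
  by rewrite addrCA lerDl addr_ge0 // sumr_ge0.
rewrite (big_cat_nat (n := l)) //=; last by lia.
rewrite [X in _ + X](big_cat_nat (n := l + w.+1)) //=; [|lia|lia].
rewrite big_nat big1 ?add0r; last first.
  by move=> j hj; rewrite /ind (_ : (l <= j <= l + w)%N = false) //; lia.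
rewrite [X in _ + X]big_nat [X in _ + X]big1 ?addr0; last first.
  by move=> j hj; rewrite /ind (_ : (l <= j <= l + w)%N = false) //; lia.
by apply: ler_sum => j _; rewrite /ind; case: (_ && _).
Qed.

End Jumps.

(** * Means over the random choices *)

Section Expectation.
Variable R : realType.
Variables (b n : nat).
Implicit Types (p : 'S_n) (g : 'S_n -> R) (t M r : nat) (i : 'I_n.-1).

Definition mean (F : 'I_n.-1 -> R) : R := (\sum_i F i) / n.-1%:R.

Fixpoint expect t M g p : R :=
  if M is M'.+1 then mean (fun i => expect t.+1 M' g (step b t p i)) else g p.

Lemma mean_le F G : (forall i, F i <= G i) -> mean F <= mean G.
Proof.
by move=> h; apply: ler_wpM2r; [rewrite invr_ge0 | apply: ler_sum => i _].
Qed.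

Lemma eq_mean F G : F =1 G -> mean F = mean G.
Proof. by move=> h; congr (_ / _); apply: eq_bigr. Qed.

Lemma expect_le t M g g' p : (forall x, g x <= g' x) -> expect t M g p <= expect t M g' p.
Proof.
move=> h; elim: M t p => [|M IH] t p /=; first exact: h.
by apply: mean_le => i; exact: IH.
Qed.

Lemma eq_expect t M g g' p : g =1 g' -> expect t M g p = expect t M g' p.
Proof.
move=> h; elim: M t p => [|M IH] t p /=; first exact: h.
by apply: eq_mean => i; exact: IH.
Qed.

Lemma meanD F G : mean (fun i => F i + G i) = mean F + mean G.
Proof. by rewrite /mean big_split /= mulrDl. Qed.

Lemma meanZ c F : mean (fun i => c * F i) = c * mean F.
Proof. by rewrite /mean -mulr_sumr mulrA. Qed.

Lemma expectD t M g g' p :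
  expect t M (fun x => g x + g' x) p = expect t M g p + expect t M g' p.
Proof.
elim: M t p => [//|M IH] t p /=; rewrite -meanD.
by apply: eq_mean => i; exact: IH.
Qed.

Lemma expectZ t M c g p : expect t M (fun x => c * g x) p = c * expect t M g p.
Proof.
elim: M t p => [//|M IH] t p /=; rewrite -meanZ.
by apply: eq_mean => i; exact: IH.
Qed.

Lemma expect_add t M M' g p :
  expect t (M + M') g p = expect t M (expect (t + M) M' g) p.
Proof.
elim: M t p => [|M IH] t p /=; first by rewrite addn0.
by apply: eq_mean => i; rewrite IH addnS addSn.
Qed.

Lemma expect_period t M g p : expect (t + b.+1) M g p = expect t M g p.
Proof.
elim: M t p => [//|M IH] t p /=; apply: eq_mean => i.
by rewrite -addSn IH /step dvdn_addl.
Qed.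

Hypothesis n2 : (2 <= n)%N.

Lemma n1_gt0 : 0 < n.-1%:R :> R.
Proof. by rewrite ltr0n; lia. Qed.

Lemma mean_const c : mean (fun=> c) = c.
Proof.
rewrite /mean sumr_const card_ord -[X in X / _]mulr_natr mulfK //.
exact: lt0r_neq0 n1_gt0.
Qed.

Lemma expect_const t M c p : expect t M (fun=> c) p = c.
Proof.
elim: M t p => [//|M IH] t p /=; rewrite -[RHS]mean_const.
by apply: eq_mean => i; exact: IH.
Qed.

Definition cycle_op g p := expect 0 b.+1 g p.

Lemma expect_cycles c r g p :
  expect 0 (b.+1 * c + r) g p = iter c cycle_op (expect 0 r g) p.
Proof.
elim: c p => [|c IH] p; first by rewrite muln0.
rewrite mulnS -addnA expect_add iterS; apply: eq_expect => x.
by rewrite expect_period IH.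
Qed.

Lemma iter_cycle_le c g g' p : (forall x, g x <= g' x) ->
  iter c cycle_op g p <= iter c cycle_op g' p.
Proof.
by move=> h; elim: c p => [|c IH] p //=; apply: expect_le.
Qed.

Lemma iter_cycle_affine c u v g p :
  iter c cycle_op (fun x => u * g x + v) p = u * iter c cycle_op g p + v.
Proof.
elim: c p => [//|c IH] p /=.
rewrite /cycle_op (eq_expect _ _ _ IH) expectD expectZ.
by congr (_ + _); exact: expect_const.
Qed.

Lemma iter_cycle_contract (gam D : R) g c p : 0 < gam <= 1 -> 0 <= D ->
  (forall x, cycle_op g x <= (1 - gam) * g x + D) ->
  iter c cycle_op g p <= (1 - gam) ^+ c * g p + D / gam.
Proof.
move=> /andP[g0 g1] D0 h.
(* The partial geometric sum is the form that passes through the induction. *)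
suff H x : iter c cycle_op g x <= (1 - gam) ^+ c * g x + D / gam * (1 - (1 - gam) ^+ c).
  apply: (le_trans (H p)); rewrite lerD2l ler_piMr //.
    by apply: divr_ge0 => //; exact: ltW.
  by rewrite gerBl exprn_ge0 //; lra.
elim: c x => [|c IH] x; first by rewrite expr0 mul1r subrr mulr0 addr0.
rewrite iterS; apply: (le_trans (expect_le 0 b.+1 x IH)).
rewrite expectD expect_const expectZ -/(cycle_op g x).
have c0 : 0 <= (1 - gam) ^+ c by apply: exprn_ge0; lra.
apply: (le_trans (lerD (ler_wpM2l c0 (h x)) (lexx _))).
rewrite le_eqVlt; apply/orP; left; apply/eqP; rewrite exprSr; field.
exact: lt0r_neq0.
Qed.

Lemma expect_words t M g p :
  expect t M g p = (\sum_(v : M.-tuple 'I_n.-1) g (run_from b t p v)) / (n.-1 ^ M)%:R.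
Proof.
elim: M t p => [|M IH] t p.
  by rewrite expn0 divr1 (big_pred1 [tuple]) // => v; apply/esym/eqP; exact: tuple0.
have -> : \sum_(v : M.+1.-tuple 'I_n.-1) g (run_from b t p v) =
    \sum_i \sum_(v : M.-tuple 'I_n.-1) g (run_from b t.+1 (step b t p i) v).
  rewrite pair_big /= (reindex (fun x : 'I_n.-1 * M.-tuple 'I_n.-1 => [tuple of x.1 :: x.2])) //.
  exists (fun v => (thead v, [tuple of behead v])) => [[i v] _|v _] /=.
    by congr pair; apply: val_inj.
  by rewrite [RHS](tuple_eta v); apply: val_inj.
rewrite expnSr natrM invfM mulrA /= /mean.
congr (_ / _); rewrite mulr_suml; apply: eq_bigr => i _; exact: IH.
Qed.

Lemma prob_expect M p (P : pred 'S_n) :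
  uniform_prob R [set v : M.-tuple 'I_n.-1 | P (run b p v)] =
  expect 0 M (fun x => (P x)%:R) p.
Proof.
rewrite /uniform_prob expect_words card_tuple card_ord; congr (_ / _).
rewrite -sum1_card natr_sum [LHS]big_mkcond /=; apply: eq_bigr => v _.
by rewrite inE /run; case: (P _).
Qed.

End Expectation.

(** * One sorting step followed by b mixing steps *)

Section Cycle.
Variable R : realType.
Variables (b m rho : nat).
Local Notation q := (2 ^ m)%N.
Local Notation pot := (potential R m rho).
Hypothesis q800 : (800 <= q)%N.
Hypothesis qb : (128 * 60 * b <= q)%N.
Hypothesis rq : (2560 * q <= rho)%N.

Let rq3 : (q + 3 <= rho)%N. Proof. lia. Qed.
Let q_gt0 : 0 < q%:R :> R. Proof. by rewrite ltr0n expn_gt0. Qed.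
Let q_ge1 : 1 <= q%:R :> R. Proof. by rewrite ler1n expn_gt0. Qed.

Lemma ratio_le2 n : (2 <= n)%N -> n%:R / n.-1%:R <= 2 :> R.
Proof.
move=> n2; have n1 := n1_gt0 R n2; rewrite ler_pdivrMr // -natrM ler_nat; lia.
Qed.

Lemma mean_shift n (F : 'I_n.-1 -> R) (c : R) : (2 <= n)%N ->
  mean F = c + (\sum_i (F i - c)) / n.-1%:R.
Proof.
move=> n2; have n1 := n1_gt0 R n2.
have n1' := lt0r_neq0 n1.
rewrite sumrB sumr_const card_ord mulrBl -(mulr_natr c) mulfK //.
by rewrite addrC subrK.
Qed.

Lemma mean_mix n (p : 'S_n) : (2 <= n)%N ->
  mean (fun i => pot (mix_step p i)) <=
  (1 + 9 / q%:R ^+ 2 / n.-1%:R) * pot p + 2 * mix_const R rho.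
Proof.
move=> n2; have n1 := n1_gt0 R n2; rewrite (mean_shift _ (pot p) n2).
have := mix_drift R p rq3; rewrite -(ler_pM2r (_ : 0 < n.-1%:R^-1)) ?invr_gt0 // => h.
have := ler_wpM2l (mix_const_ge0 R rho) (ratio_le2 n2).
move: h; rewrite mulrDl; lra.
Qed.

Lemma mean_sort : exists2 K : R, 0 <= K & forall n (p : 'S_n), (2 <= n)%N ->
  mean (fun i => pot (sort_step p i)) <=
  (1 - 3 / 640 / q%:R / n.-1%:R) * pot p + K.
Proof.
have [K K0 hK] := row_excess_le_drift R q800 rq.
exists (2 * K) => [|n p n2]; first exact: mulr_ge0.
have n1 := n1_gt0 R n2; rewrite (mean_shift _ (pot p) n2).
have := sort_contract p hK K0; rewrite -(ler_pM2r (_ : 0 < n.-1%:R^-1)) ?invr_gt0 // => h.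
have := ler_wpM2l K0 (ratio_le2 n2).
move: h; rewrite mulrDl mulNr; lra.
Qed.

Lemma mix_phase n (p : 'S_n) t r : (2 <= n)%N -> (0 < t)%N -> (t + r <= b.+1)%N ->
  expect b t r (@potential R m rho n) p <= (1 + 9 / q%:R ^+ 2 / n.-1%:R) ^+ r
    * (pot p + r%:R * (2 * mix_const R rho)).
Proof.
move=> n2; have n1 := n1_gt0 R n2; have mc := mix_const_ge0 R rho.
set eps := 9 / q%:R ^+ 2 / n.-1%:R.
have e0 : 0 <= eps by rewrite !divr_ge0 // exprn_ge0.
elim: r t p => [|r IH] t p t0 tr; first by rewrite expr0 mul1r mul0r addr0.
rewrite /=; have e1 : 0 <= (1 + eps) ^+ r by apply: exprn_ge0; lra.
set kap := 2 * mix_const R rho; have kap0 : 0 <= kap by exact: mulr_ge0.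
apply: (@le_trans _ _ (mean (fun i => (1 + eps) ^+ r * (pot (mix_step p i) + r%:R * kap)))).
  apply: mean_le => i; have -> : step b t p i = mix_step p i.
    by rewrite /step gtnNdvd //; lia.
  by apply: IH; lia.
rewrite meanZ meanD mean_const // exprSr -mulrA; apply: ler_wpM2l => //.
have := mean_mix p n2; rewrite -/eps -/kap => h.
have x0 : 0 <= r%:R * kap by exact: mulr_ge0.
have := mulr_ge0 e0 x0; have := mulr_ge0 e0 kap0.
rewrite -natr1; lra.
Qed.

Lemma bernoulli_ub (x : R) j : 0 <= x -> 2 * j%:R * x <= 1 -> (1 + x) ^+ j <= 1 + 2 * j%:R * x.
Proof.
move=> x0; elim: j => [|j IH] jx; first by rewrite expr0 mulr0 mul0r addr0.
have j1 : 2 * j%:R * x <= 1.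
  apply: le_trans jx; apply: ler_wpM2r => //; apply: ler_wpM2l => //.
  by rewrite ler_nat.
have x1 : 0 <= 1 + x by lra.
have := ler_wpM2l x1 (IH j1); have := ler_wpM2r x0 j1.
rewrite exprS -natr1; lra.
Qed.

(** Hypothesis [qb], with [128 * 60 = 4 * 9 * 640 / 3], says that the growth [2 * b * eps] over the
    mixing steps is at most half of the sorting gain [3 / 640]; the other half is kept. *)
Lemma cycle_potential : exists2 C : R, 0 <= C & forall n (p : 'S_n), (2 <= n)%N ->
  cycle_op b (@potential R m rho n) p <= (1 - 3 / 1280 / q%:R / n.-1%:R) * pot p + C.
Proof.
have [K K0 hK] := mean_sort; have mc := mix_const_ge0 R rho.
set kap := b%:R * (2 * mix_const R rho).
have kap0 : 0 <= kap by rewrite !mulr_ge0.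
exists (2 * (K + kap)) => [|n p n2]; first by rewrite mulr_ge0 // addr_ge0.
have n1 := n1_gt0 R n2; have n1' : 1 <= n.-1%:R :> R by rewrite ler1n; lia.
pose eps : R := 9 / q%:R ^+ 2 / n.-1%:R; pose al : R := 3 / 640 / q%:R / n.-1%:R.
have e0 : 0 <= eps by rewrite !divr_ge0 // exprn_ge0.
have P0 : 0 <= pot p := potential_ge0 R m rho p.
have eal : 4 * b%:R * eps <= al.
  have qb' : 128 * 60 * b%:R <= q%:R :> R by rewrite -!natrM ler_nat.
  have -> : 4 * b%:R * eps = 128 * 60 * b%:R / q%:R * al.
    by rewrite /eps /al; field; rewrite !lt0r_neq0.
  rewrite -[leRHS]mul1r; apply: ler_wpM2r; first by rewrite !divr_ge0.
  by rewrite ler_pdivrMr // mul1r.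
have al1 : al <= 1.
  rewrite /al ler_pdivrMr // mul1r; apply: le_trans n1'.
  by rewrite ler_pdivrMr // mul1r; have := q_ge1; lra.
have be : 2 * b%:R * eps <= 1 by move: eal al1; lra.
rewrite /cycle_op /=.
apply: (@le_trans _ _ (mean (fun i => (1 + eps) ^+ b * (pot (sort_step p i) + kap)))).
  apply: mean_le => i; have -> : step b 0 p i = sort_step p i by rewrite /step dvdn0.
  by apply: mix_phase => //; rewrite add1n.
rewrite meanZ meanD mean_const //.
have ub := bernoulli_ub e0 be; have hs := hK n p n2; rewrite -/al in hs.
have X0 : 0 <= mean (fun i => pot (sort_step p i)) + kap.
  apply: addr_ge0 => //; apply: divr_ge0 => //.
  by apply: sumr_ge0 => i _; exact: potential_ge0.
apply: (le_trans (ler_wpM2r X0 ub)).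
set u := 2 * b%:R * eps in be ub *; have u0 : 0 <= u by apply: mulr_ge0 => //; exact: mulr_ge0.
have u1 : 0 <= 1 + u by lra.
have := ler_wpM2l u1 (lerD hs (lexx kap)) => /le_trans; apply.
have -> : 3 / 1280 / q%:R / n.-1%:R = al / 2 by rewrite /al; field; rewrite !lt0r_neq0.
have ual : u <= al / 2 by rewrite /u; lra.
have al0 : 0 <= al by rewrite /al !divr_ge0.
have a1 : (1 + u) * (1 - al) <= 1 - al / 2 by have := mulr_ge0 u0 al0; lra.
have := ler_wpM2r P0 a1.
have : u * (K + kap) <= 1 * (K + kap) by apply: ler_wpM2r => //; exact: addr_ge0.
lra.
Qed.

Lemma mean_step : exists2 A : R, 1 <= A & forall n t (p : 'S_n), (2 <= n)%N ->
  mean (fun i => pot (step b t p i)) <= A * (pot p + n%:R).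
Proof.
have [K K0 hK] := mean_sort; have mc := mix_const_ge0 R rho.
exists (10 + K + 2 * mix_const R rho) => [|n t p n2]; first lra.
have P0 : 0 <= pot p := potential_ge0 R m rho p.
have n1 := n1_gt0 R n2; have n1' : 1 <= n.-1%:R :> R by rewrite ler1n; lia.
have n0 : 1 <= n%:R :> R by rewrite ler1n; lia.
have m1 := mulr_ge0 K0 P0; have m2 := mulr_ge0 mc P0.
have m3 : K <= K * n%:R by rewrite ler_peMr.
have m4 : mix_const R rho <= mix_const R rho * n%:R by rewrite ler_peMr.
rewrite /step; case: (b.+1 %| t)%N.
  apply: le_trans (hK n p n2) _.
  have : 0 <= 3 / 640 / q%:R / n.-1%:R * pot p by rewrite mulr_ge0 // !divr_ge0.
  lra.
apply: (le_trans (mean_mix p n2)).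
have : 9 / q%:R ^+ 2 / n.-1%:R * pot p <= 9 * pot p.
  apply: ler_wpM2r => //; rewrite ler_pdivrMr // ler_pdivrMr ?exprn_gt0 //.
  have q2 : 1 <= q%:R ^+ 2 :> R by exact: exprn_ege1.
  have := ler_pM ler01 ler01 n1' q2; lra.
lra.
Qed.

(** Splits at the first step with [(u + v) ^+ 4 <= 8 * (u ^+ 4 + v ^+ 4)]; [mean_step] controls the
    potential from which the later jumps start. *)
Lemma cycle_jump M : exists2 C : R, 0 <= C & forall n t (p : 'S_n), (2 <= n)%N ->
  expect b t M (fun x => (potential R (m + 3) rho x - potential R (m + 3) rho p) ^+ 4) p
  <= C / n.-1%:R * (pot p + n%:R).
Proof.
have [A A1 hA] := mean_step.
set V := tail_weight R (m + 3); have V0 : 0 <= V ^+ 3.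
  by rewrite exprn_ge0 // tail_weight_ge0.
set W := (4 * rho).+1%:R ^+ 4 : R; have W0 : 0 <= W by exact: exprn_ge0.
have mc := mix_const_ge0 R rho.
set C1 := V ^+ 3 * (W + 11 + mix_const R rho).
have C10 : 0 <= C1 by apply: mulr_ge0 => //; lra.
set pot' := @potential R (m + 3) rho.
have jump1 n t (p : 'S_n) : (2 <= n)%N ->
    mean (fun i => (pot' n (step b t p i) - pot' n p) ^+ 4) <= C1 / n.-1%:R * (pot p + n%:R).
  move=> n2; have n1 := n1_gt0 R n2; have P0 : 0 <= pot p := potential_ge0 R m rho p.
  rewrite /mean mulrAC; apply: ler_wpM2r; first by rewrite invr_ge0 ltW.
  have x1 := mulr_ge0 V0 P0; have x2 := mulr_ge0 V0 (ler0n R n).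
  have x3 := mulr_ge0 W0 x1; have x4 := mulr_ge0 W0 x2.
  have x5 := mulr_ge0 mc x1; have x6 := mulr_ge0 mc x2.
  rewrite /step; case: (b.+1 %| t)%N.
    apply: (le_trans (sort_quartic R m rho p)); rewrite -/V -/W /C1; lra.
  apply: (le_trans (mix_quartic R p rq3)); rewrite -/V /C1; lra.
elim: M => [|M [C C0 IH]].
  exists 0 => // n t p n2 /=; by rewrite subrr expr0n !mul0r.
exists (8 * (C * (A + 1) + C1)) => [|n t p n2].
  by rewrite mulr_ge0 // addr_ge0 // mulr_ge0 //; lra.
have n1 := n1_gt0 R n2; have P0 : 0 <= pot p := potential_ge0 R m rho p.
rewrite /=; apply: (@le_trans _ _ (mean (fun i =>
    8 * (C / n.-1%:R * (pot (step b t p i) + n%:R))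
    + 8 * (pot' n (step b t p i) - pot' n p) ^+ 4))).
  apply: mean_le => i; set y := step b t p i.
  apply: (@le_trans _ _ (expect b t.+1 M (fun x =>
     8 * (pot' n x - pot' n y) ^+ 4 + 8 * (pot' n y - pot' n p) ^+ 4) y)).
    apply: expect_le => x.
    have -> : pot' n x - pot' n p = (pot' n x - pot' n y) + (pot' n y - pot' n p) by ring.
    move: (pot' n x - pot' n y) (pot' n y - pot' n p) => u v.
    rewrite -subr_ge0.
    have -> : 8 * u ^+ 4 + 8 * v ^+ 4 - (u + v) ^+ 4 =
      (u - v) ^+ 2 * (2 * (u ^+ 2 + v ^+ 2) + 5 * (u + v) ^+ 2) by ring.
    have u2 := sqr_ge0 u; have v2 := sqr_ge0 v; have w2 := sqr_ge0 (u + v).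
    by apply: mulr_ge0; [exact: sqr_ge0 | lra].
  rewrite expectD expectZ expect_const //.
  by rewrite lerD2r; apply: ler_wpM2l => //; exact: IH.
rewrite meanD !meanZ meanD mean_const //.
have j1 := jump1 n t p n2; have a1 := hA n t p n2.
have Cn0 : 0 <= C / n.-1%:R by apply: divr_ge0 => //; exact: ltW.
have := ler_wpM2l Cn0 a1.
have := mulr_ge0 Cn0 P0.
have -> : 8 * (C * (A + 1) + C1) / n.-1%:R =
  8 * (C / n.-1%:R * A + C / n.-1%:R + C1 / n.-1%:R) by field; rewrite lt0r_neq0.
lra.
Qed.

End Cycle.

(** * The truncated quartic potential *)

Section Lyapunov.
Variable R : realType.

Definition trunc (T x : R) := Num.max (x - T) 0.

Lemma trunc_ge0 T x : 0 <= trunc T x.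
Proof. by rewrite le_max lexx orbT. Qed.

Lemma trunc_quartic (T x y be : R) : 0 < be ->
  trunc T y ^+ 4 <= (1 + be) * trunc T x ^+ 4 + 4 * trunc T x ^+ 3 * (y - x)
    + (16 / be + 3) * (y - x) ^+ 4.
Proof.
move=> be0; set X := trunc T x; set d := y - x; have X0 : 0 <= X := trunc_ge0 T x.
have d2 : 0 <= d ^+ 2 := sqr_ge0 d.
have d4 : 0 <= d ^+ 4 by rewrite (exprM _ 2 2) sqr_ge0.
have young : 8 * X ^+ 2 * d ^+ 2 <= be * X ^+ 4 + 16 / be * d ^+ 4.
  rewrite -subr_ge0.
  have -> : be * X ^+ 4 + 16 / be * d ^+ 4 - 8 * X ^+ 2 * d ^+ 2 =
    (be * X ^+ 2 - 4 * d ^+ 2) ^+ 2 / be by field; rewrite lt0r_neq0.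
  by apply: divr_ge0; [exact: sqr_ge0 | exact: ltW].
(* In the expansion of [(X + d) ^+ 4], the term [4 * X * d ^+ 3] is at most
   [2 * X ^+ 2 * d ^+ 2 + 2 * d ^+ 4]. *)
suff : trunc T y ^+ 4 <= X ^+ 4 + 4 * X ^+ 3 * d + 8 * X ^+ 2 * d ^+ 2 + 3 * d ^+ 4.
  by lra.
have [xT|Tx] := leP x T.
  have -> : X = 0 by rewrite /X /trunc max_r //; lra.
  rewrite !expr0n /= !mulr0 !mul0r !add0r.
  apply: (@le_trans _ _ (d ^+ 4)); last lra.
  have [yT|Ty] := leP y T.
    by rewrite /trunc max_r ?expr0n //=; lra.
  rewrite /trunc max_l; last lra.
  by apply: lerXn2r; rewrite ?nnegrE /d; lra.
have XE : X = x - T by rewrite /X /trunc max_l //; lra.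
apply: (@le_trans _ _ ((X + d) ^+ 4)).
  have [yT|Ty] := leP y T.
    by rewrite /trunc max_r ?expr0n /= ?(exprM _ 2 2) ?sqr_ge0 //; lra.
  rewrite /trunc max_l; last lra.
  by rewrite XE /d; have -> : x - T + (y - x) = y - T by ring.
rewrite -subr_ge0.
have -> : X ^+ 4 + 4 * X ^+ 3 * d + 8 * X ^+ 2 * d ^+ 2 + 3 * d ^+ 4 - (X + d) ^+ 4
  = 2 * d ^+ 2 * (X - d) ^+ 2 by ring.
by apply: mulr_ge0; [exact: mulr_ge0 | exact: sqr_ge0].
Qed.

Variables (b m rho : nat).
Local Notation q := (2 ^ m)%N.
Local Notation pot := (potential R m rho).
Local Notation pot' := (potential R (m + 3) rho).
Hypothesis q800 : (800 <= q)%N.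
Hypothesis qb : (128 * 60 * b <= q)%N.
Hypothesis rq : (2560 * 2 ^ (m + 3) <= rho)%N.

Definition rate n : R := 3 / (1280 * 8) / q%:R / n.-1%:R.

Definition lyapunov (K lam : R) n (p : 'S_n) : R :=
  trunc (K * n%:R) (pot' p) ^+ 4 + lam * n%:R * pot p.

(** With [be = rate n], the finer potential contracts by [be] and the coarser by [8 * be] per cycle.
    The truncated quartic gains [be] and loses [4 * be]; of the [8 * be] of the other part, [5 * be]
    pays for the fourth moments. Both keep [3 * be], and neither [lam] nor [C] depends on [K]. *)
Lemma cycle_lyapunov : exists K0 lam C : R, [/\ 0 <= K0, 0 <= lam, 0 <= C &
  forall K n (p : 'S_n), K0 <= K -> (2 <= n)%N ->
  cycle_op b (@lyapunov K lam n) p <=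
  (1 - 3 * rate n) * lyapunov K lam p + C * n%:R].
Proof.
have rq1 : (2560 * q <= rho)%N by move: rq; rewrite expnD; lia.
have [C0 C00 hC0] := cycle_potential R q800 qb rq1.
have q800' : (800 <= 2 ^ (m + 3))%N by rewrite expnD; lia.
have qb' : (128 * 60 * b <= 2 ^ (m + 3))%N by rewrite expnD; lia.
have [C1 C10 hC1] := cycle_potential R q800' qb' rq.
have [CJ CJ0 hCJ] := cycle_jump R q800 qb rq1 b.+1.
clear q800 qb rq q800' qb' rq1.
have q0 : 0 < q%:R :> R by rewrite ltr0n expn_gt0.
have q1 : 1 <= q%:R :> R by rewrite ler1n expn_gt0.
pose kap : R := 1280 * 8.
have kap0 : 0 < kap by exact: mulr_gt0.
have kapE : kap = 1280 * 8 by [].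
have rateE n : rate n = 3 / kap / q%:R / n.-1%:R by [].
clearbody kap.
have q8 : (2 ^ (m + 3))%:R = q%:R * 8 :> R by rewrite expnD natrM.
have q3 : 0 <= kap / 3 * q%:R :> R by apply: mulr_ge0; [apply: divr_ge0 |]; exact: ltW.
have q5 : 0 <= kap / 15 * q%:R :> R by apply: mulr_ge0; [apply: divr_ge0 |]; exact: ltW.
pose B : R := 16 * (kap / 3 * q%:R) + 3.
have B0 : 0 <= B by apply: addr_ge0 => //; exact: mulr_ge0.
pose D := CJ * B; have D0 : 0 <= D by exact: mulr_ge0.
(* Equals [D / (5 * be * n.-1)], so that [lam * n * 5 * be] covers [D]. *)
pose lam := D * (kap / 15 * q%:R).
have lam0 : 0 <= lam by exact: mulr_ge0.
(* The first witness is [C1 / (be * n.-1)]: above the level [K * n] the contraction outweighs the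
   additive constant [C1]. *)
exists (C1 * (kap / 3 * q%:R)), lam, (D + lam * C0).
split=> //; first exact: mulr_ge0.
  by apply: addr_ge0 => //; exact: mulr_ge0.
move=> K n p KK0 n2; have n1 := n1_gt0 R n2.
have n1' : 1 <= n.-1%:R :> R by rewrite ler1n -ltnS prednK // ltnW.
have nn : n.-1%:R <= n%:R :> R by rewrite ler_nat leq_pred.
have n0 : 0 <= n%:R :> R by [].
set be := rate n.
have beE : be = 3 / kap / q%:R / n.-1%:R := rateE n.
have be0 : 0 < be by rewrite beE !divr_gt0.
clearbody be.
have P0 : 0 <= pot p := potential_ge0 R m rho p.
set X := trunc (K * n%:R) (pot' p); have X0 : 0 <= X := trunc_ge0 _ _.
have hp' := hC1 n p n2; rewrite q8 in hp'.
have E1 : 3 / 1280 / (q%:R * 8) / n.-1%:R = be.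
  by rewrite beE kapE; field; rewrite !lt0r_neq0.
rewrite {}E1 in hp'.
have hp := hC0 n p n2.
have E2 : 3 / 1280 / q%:R / n.-1%:R = 8 * be.
  by rewrite beE kapE; field; rewrite !lt0r_neq0.
rewrite {}E2 {kapE} in hp.
have hJ := hCJ n 0%N p n2.
set J := expect _ _ _ _ _ in hJ.
have ub : cycle_op b (@lyapunov K lam n) p <=
    (1 + be) * X ^+ 4 + 4 * X ^+ 3 * (cycle_op b (@potential R (m + 3) rho n) p - pot' p)
    + (16 / be + 3) * J + lam * n%:R * cycle_op b (@potential R m rho n) p.
  apply: (@le_trans _ _ (cycle_op b (fun x : 'S_n =>
      (((1 + be) * X ^+ 4 - 4 * X ^+ 3 * pot' p) + 4 * X ^+ 3 * pot' x
    + (16 / be + 3) * (pot' x - pot' p) ^+ 4) + lam * n%:R * pot x) p)).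
    apply: expect_le => x; rewrite /lyapunov lerD2r.
    apply: (le_trans (trunc_quartic _ (pot' p) _ be0)); rewrite -/X; lra.
  rewrite /cycle_op !expectD !expect_const // !expectZ -/J -!/(cycle_op b _ p); lra.
apply: (le_trans ub).
have s1 : 4 * X ^+ 3 * (cycle_op b (@potential R (m + 3) rho n) p - pot' p) <= - (4 * be * X ^+ 4).
  have X30 : 0 <= 4 * X ^+ 3 by rewrite mulr_ge0 // exprn_ge0.
  apply: (@le_trans _ _ (4 * X ^+ 3 * (C1 - be * pot' p))).
    by apply: ler_wpM2l => //; lra.
  have [XE|XE] : X = 0 \/ pot' p = X + K * n%:R.
  - rewrite /X /trunc; have [h|h] := leP (pot' p - K * n%:R) 0.
      by left.
    by right; rewrite subrK.
  - by rewrite XE !expr0n /= !mulr0 mul0r oppr0.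
  have bK : C1 <= be * (K * n%:R).
    have -> : C1 = C1 * (kap / 3 * q%:R) * (be * n.-1%:R).
      by rewrite beE; field; rewrite !lt0r_neq0.
    rewrite mulrCA; apply: ler_wpM2l; first exact: ltW.
    by apply: ler_pM => //; exact: mulr_ge0.
  have -> : - (4 * be * X ^+ 4) = 4 * X ^+ 3 * (- (be * X)) by ring.
  by apply: ler_wpM2l => //; rewrite XE mulrDr; lra.
have s2 : (16 / be + 3) * J <= D * (pot p + n%:R).
  have b3 : 0 <= 16 / be + 3 by apply: addr_ge0 => //; apply: divr_ge0 => //; exact: ltW.
  apply: (le_trans (ler_wpM2l b3 hJ)); rewrite mulrA; apply: ler_wpM2r.
    exact: addr_ge0.
  rewrite mulrA ler_pdivrMr // /D mulrC -mulrA; apply: ler_wpM2l => //.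
  have -> : 16 / be = 16 * (kap / 3 * q%:R) * n.-1%:R.
    by rewrite beE; field; rewrite !lt0r_neq0.
  rewrite /B mulrDl; lra.
have s3 : lam * n%:R * cycle_op b (@potential R m rho n) p <=
    lam * n%:R * ((1 - 8 * be) * pot p + C0).
  by apply: ler_wpM2l => //; exact: mulr_ge0.
have s4 : D * pot p <= lam * n%:R * (5 * be) * pot p.
  apply: ler_wpM2r => //.
  have -> : D = lam * n.-1%:R * (5 * be).
    by rewrite /lam beE; field; rewrite !lt0r_neq0.
  apply: ler_wpM2r; first by apply: mulr_ge0 => //; exact: ltW.
  exact: ler_wpM2l.
rewrite /lyapunov -/X; lra.
Qed.

End Lyapunov.

(** * Deviation and heights *)

Section Deviation.
Variable n : nat.
Implicit Types (p : 'S_n) (i : 'I_n.-1).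
Local Open Scope nat_scope.

Lemma sum_between u v N : \sum_(0 <= k < N) (u < k <= v) = minn N v.+1 - u.+1.
Proof.
elim: N => [|N IH]; first by rewrite big_geq.
by rewrite big_nat_recr //= IH; lia.
Qed.

Lemma sum_perm_val p : \sum_(x < n) (p x : nat) = \sum_(x < n) x.
Proof. by rewrite [RHS](reindex_inj (@perm_inj _ p)). Qed.

(** The upward and the downward displacements of a permutation have equal sums. *)
Lemma dev_pos p : dev p = 2 * \sum_(x < n) (p x - x).
Proof.
have E : \sum_(x < n) (p x - x) = \sum_(x < n) (x - p x).
  apply/eqP; rewrite -(eqn_add2r (\sum_(x < n) x)) -{2}(sum_perm_val p) -!big_split /=.
  by apply/eqP; apply: eq_bigr => x _; lia.
rewrite mul2n -addnn {2}E -big_split /=; apply: eq_bigr => x _; lia.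
Qed.

Lemma height_diag a p k : a < k < a + n ->
  2 * \sum_(x < n) (a + x < k <= a + p x) <= height a p k k.
Proof.
move=> hk; have hE := heightE a p k k.
have E : smaller a p k k + \sum_(0 <= i < k) (k <= padded a p i) = k.
  rewrite /smaller -big_split /= -[RHS]subn0 -[RHS]muln1 -sum_nat_const_nat.
  by apply: eq_bigr => i _; rewrite ltnNge; case: (_ <= _).
suff : \sum_(x < n) (a + x < k <= a + p x) <= \sum_(0 <= i < k) (k <= padded a p i) by lia.
have -> : \sum_(0 <= i < k) (k <= padded a p i) =
    \sum_(0 <= i < a + n) (i < k <= padded a p i).
  rewrite (big_nat_widen 0 k (a + n)); last by lia.
  by rewrite [LHS]big_mkcond; apply: eq_bigr => i _ /=; case: (i < k).
rewrite (big_cat_nat (n := a)) ?leq_addr //= -[X in _ <= _ + \sum_(X <= _ < _) _]add0n.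
rewrite (addnC a n) big_addn addnK.
apply: leq_trans (leq_addl _ _); rewrite big_mkord.
by apply: leq_sum => x _; rewrite (addnC x) padded_in.
Qed.

(** Double counting of the pairs with [x < k <= p x]: each [x] meets [p x - x] rows. *)
Lemma dev_le_heights a p : dev p <= \sum_(a.+1 <= k < a + n) height a p k k.
Proof.
apply: (@leq_trans (\sum_(a.+1 <= k < a + n) 2 * \sum_(x < n) (a + x < k <= a + p x))); last first.
  rewrite big_nat [leqRHS]big_nat; apply: leq_sum => k hk; exact: height_diag.
rewrite dev_pos -big_distrr leq_mul2l /= exchange_big /=.
apply: leq_sum => x _; have xn := ltn_ord x; have pn := ltn_ord (p x).
have := sum_between (a + x) (a + p x) (a + n).
rewrite (big_cat_nat (n := a.+1)) //=; last by lia.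
by rewrite sum_between; lia.
Qed.

Lemma sum_tperm_move i :
  \sum_(x < n) `|tperm (lo i) (hi i) x - x|%N <= 2.
Proof.
apply: (@leq_trans (\sum_(x < n) ((x == lo i) + (x == hi i)))).
  by apply: leq_sum => x _; case: tpermP => [->|->|_ _]; rewrite ?eqxx /=; lia.
rewrite big_split /= -!big_mkcond /= !sum1_card !card1; lia.
Qed.

Lemma dev_step b t p i : dev (step b t p i) <= dev p + 2.
Proof.
have tri (x y z : nat) : `|x - z| <= `|x - y| + `|y - z| by lia.
rewrite /step; case: (b.+1 %| t); last first.
  apply: leq_trans (leq_add (leqnn _) (sum_tperm_move i)).
  rewrite (reindex_inj (@perm_inj _ p)) /= -big_split /=.
  by apply: leq_sum => x _; rewrite /mix_step permM addnC; exact: tri.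
rewrite /sort_step; case: ifP => _; last by exact: leq_addr.
apply: leq_trans (leq_add (leqnn _) (sum_tperm_move i)).
rewrite /dev (reindex_inj (@perm_inj _ (tperm (lo i) (hi i)))) /= -big_split /=.
apply: leq_sum => x _; rewrite permM tpermK; lia.
Qed.

End Deviation.

(** * The potential against the deviation, and its largest value *)

Section PotentialBounds.
Variable R : rcfType.
Variables (m rho n : nat).
Implicit Types (p : 'S_n) (k l j : nat).
Local Notation a := (8 * rho)%N.
Local Notation w := (4 * rho)%N.
Local Notation N := (n + 2 * (8 * rho))%N.
Local Notation q := (2 ^ m)%N.

Definition diag_const : R := (4 * rho).+1%:R * 2 ^+ (8 * rho).

(** The root of the diagonal window is at least [s2 ^+ h], which is at least [1 + h * (s2 - 1)] by
    Bernoulli; the bound of [rootsum_diag] is then multiplied by [2 * q]. *)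
Lemma height_le_row_excess p k : (q + 3 <= rho)%N -> (a < k < a + n)%N ->
  (height a p k k)%:R <= 4 * row_excess R m w N k (height a p k)
    + 4 * q%:R * diag_const.
Proof.
move=> rq hk; set h := height a p k k.
have k1 : (2 * (4 * rho) <= k)%N by lia.
have k2 : (k + 2 * (4 * rho) <= N)%N by lia.
have hl : (k <= (k - 2 * rho) + 2 * rho + 1 <= k + 2)%N by lia.
have hw : (k - 2 * rho <= k <= k - 2 * rho + w)%N by lia.
have := rootsum_diag R (height_pad_row rho p k) k1 k2 rq hl.
rewrite -/diag_const; set rs := rootsum _ _ _ _ _; set re := row_excess _ _ _ _ _ _.
have q0 : 0 < q%:R :> R by rewrite ltr0n expn_gt0.
have s0 := s2_gt0 R m; have s1 := s2_ge1 R m.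
have lb : 1 + h%:R * (s2 R m - 1) <= rs.
  apply: (@le_trans _ _ (s2 R m ^+ h)).
    rewrite -{2}[s2 R m](subrK 1) [_ - 1 + 1]addrC; apply: bernoulli; lra.
  by rewrite -root2_pow; apply: root2_le; exact: winsum_ge1.
have sq : 1 <= 2 * q%:R * (s2 R m - 1).
  have := ler_wpM2l (ltW (mulr_gt0 s0 q0)) (s2_lb R m).
  have -> : s2 R m * q%:R * (1 / 2 / q%:R) = s2 R m / 2 by field; exact: lt0r_neq0.
  have -> : s2 R m * q%:R * (1 - (s2 R m)^-1) = q%:R * (s2 R m - 1).
    by field; exact: lt0r_neq0.
  lra.
have h0 : 0 <= h%:R :> R by [].
have := ler_wpM2l h0 sq; rewrite mulr1 => hh.
have q20 : 0 <= 2 * q%:R :> R by rewrite mulr_ge0 // ltW.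
have := ler_wpM2l q20 lb.
move=> lb2 /(ler_wpM2l q20).
have -> : 2 * q%:R * (2 / q%:R * re + 2 * diag_const) = 4 * re + 4 * q%:R * diag_const.
  by field; exact: lt0r_neq0.
lra.
Qed.

Lemma dev_le_potential p : (q + 3 <= rho)%N ->
  (dev p)%:R <= 4 * potential R m rho p + n%:R * (4 * q%:R * diag_const).
Proof.
move=> rq; have D0 : 0 <= 4 * q%:R * diag_const.
  by rewrite !mulr_ge0 // exp2_ge0.
apply: (@le_trans _ _ (\sum_(a.+1 <= k < a + n) (height a p k k)%:R)).
  by rewrite -natr_sum ler_nat; exact: dev_le_heights.
apply: (@le_trans _ _ (\sum_(a.+1 <= k < a + n)
    (4 * row_excess R m w N k (height a p k) + 4 * q%:R * diag_const))).
  by rewrite big_nat [leRHS]big_nat; apply: ler_sum => k hk; exact: height_le_row_excess.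
by rewrite big_split -mulr_sumr /= lerD2l; exact: sum_const_inner.
Qed.

Lemma potential_le p : (0 < n)%N ->
  potential R m rho p <= root2 m diag_const * (12 * rho).+2%:R * n%:R ^+ 2 * s2 R m ^+ n.
Proof.
move=> n0; have D0 : 0 <= diag_const by rewrite mulr_ge0 // exp2_ge0.
have s0 := s2_gt0 R m.
set D := root2 m diag_const.
have DD : 0 <= D by exact: root2_ge0.
have sn : 0 <= s2 R m ^+ n by rewrite exprn_ge0 // ltW.
set c := D * s2 R m ^+ n; have c0 : 0 <= c by exact: mulr_ge0.
have ex k l : (a < k < a + n)%N -> (l < (N - w).+1)%N ->
    excess R m w k (height a p k) l <= c.
  move=> hk hl; apply: (@le_trans _ _ (rootsum R m w (height a p k) l)).
    by rewrite /excess lerBlDr lerDl ltW // rootsum_gt0.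
  rewrite /c /D -root2_pow -root2M //; apply: root2_le.
  rewrite /diag_const -mulrA -exprD; apply: winsum_le_const => j hj.
  have [hj'|hj'] := boolP (a <= j <= a + n)%N.
    have := @height_le n a p k j hj'; lia.
  rewrite height_base; last by lia.
  rewrite /base; lia.
have row k : (a < k < a + n)%N ->
    row_excess R m w N k (height a p k) <= n%:R * ((12 * rho).+2%:R * c).
  move=> hk; apply: (@le_trans _ _ (\sum_(0 <= l < (N - w).+1) c)).
    rewrite /row_excess big_nat [leRHS]big_nat; apply: ler_sum => l hl; exact: ex.
  rewrite sumr_const_nat subn0 -[leLHS]mulr_natl mulrA -natrM.
  apply: ler_wpM2r => //; rewrite ler_nat; nia.
apply: (@le_trans _ _ (\sum_(a.+1 <= k < a + n) n%:R * ((12 * rho).+2%:R * c))).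
  rewrite /potential big_nat [leRHS]big_nat; apply: ler_sum => k hk; exact: row.
have := @sum_const_inner R rho n (n%:R * ((12 * rho).+2%:R * c)).
move=> /(_ (mulr_ge0 (ler0n _ _) (mulr_ge0 (ler0n _ _) c0))) /le_trans; apply.
by rewrite /c; rewrite le_eqVlt; apply/orP; left; apply/eqP; ring.
Qed.

Lemma s2_pow_le : s2 R m ^+ n <= 2 ^+ (n %/ q).+1.
Proof.
rewrite -[X in _ <= X ^+ _](s2K R m) -exprM; apply: ler_weXn2l; first exact: s2_ge1.
have q0 : (0 < q)%N by rewrite expn_gt0.
by rewrite mulnC; apply: ltnW; exact: ltn_ceil.
Qed.

End PotentialBounds.

(** * Decay of the initial value and Markov's inequality *)

Section Concentration.
Variable R : realType.
Variables (b m rho : nat).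
Local Notation q := (2 ^ m)%N.
Local Notation lyap := (@lyapunov R m rho).

(** The fourth power of the finer potential grows no faster than the coarser one, since
    [s = s' ^+ 8]. The constant is uniform in [K]. *)
Lemma lyapunov_le (lam : R) : 0 <= lam -> exists2 C : R, 0 <= C &
  forall K n (p : 'S_n), 0 <= K -> (0 < n)%N ->
  lyap K lam p <= C * n%:R ^+ 8 * 2 ^+ (n %/ q).+1.
Proof.
move=> lam0.
have D0 : 0 <= diag_const R rho by rewrite mulr_ge0 // exp2_ge0.
set A := fun m => root2 m (diag_const R rho) * (12 * rho).+2%:R : R.
have A0 m' : 0 <= A m' by rewrite mulr_ge0 // root2_ge0.
exists (A (m + 3)%N ^+ 4 + lam * A m).
  by rewrite addr_ge0 ?exprn_ge0 // mulr_ge0.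
move=> K n p K0 n0; have n1 : 1 <= n%:R :> R by rewrite ler1n.
have s1 := s2_ge1 R m; have s1' := s2_ge1 R (m + 3).
set s := s2 R m in s1 *; set s' := s2 R (m + 3) in s1' *.
have sn0 : 0 <= s ^+ n by rewrite exprn_ge0 //; lra.
have P0 := potential_ge0 R (m + 3) rho p.
have P1 := potential_ge0 R m rho p.
have Tr : trunc (K * n%:R) (potential R (m + 3) rho p) <= potential R (m + 3) rho p.
  by rewrite ge_max P0 andbT gerBl mulr_ge0.
apply: (@le_trans _ _ ((A (m + 3)%N ^+ 4 + lam * A m) * n%:R ^+ 8 * s ^+ n)); last first.
  apply: ler_wpM2l; last exact: s2_pow_le.
  by rewrite mulr_ge0 ?exprn_ge0 // addr_ge0 ?exprn_ge0 // mulr_ge0.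
rewrite /lyapunov mulrDl mulrDl; apply: lerD.
  apply: (@le_trans _ _ (potential R (m + 3) rho p ^+ 4)).
    by apply: lerXn2r; rewrite ?nnegrE // trunc_ge0.
  apply: (@le_trans _ _ ((A (m + 3)%N * n%:R ^+ 2 * s' ^+ n) ^+ 4)).
    apply: lerXn2r; rewrite ?nnegrE //; last exact: potential_le.
    by apply: mulr_ge0; [apply: mulr_ge0 => //; exact: exprn_ge0 | apply: exprn_ge0; lra].
  have -> : (A (m + 3)%N * n%:R ^+ 2 * s' ^+ n) ^+ 4 =
      A (m + 3)%N ^+ 4 * (n%:R ^+ 8 * s' ^+ (n * 4)) by rewrite exprM; ring.
  rewrite -[leRHS]mulrA; apply: ler_wpM2l; first exact: exprn_ge0.
  apply: ler_wpM2l; first exact: exprn_ge0.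
  have -> : s = s' ^+ 8 by rewrite /s' /s2 root2_add3.
  by rewrite -exprM; apply: ler_weXn2l => //; lia.
have -> : lam * A m * n%:R ^+ 8 * s ^+ n = lam * (A m * (n%:R ^+ 8 * s ^+ n)) by ring.
rewrite -mulrA; apply: ler_wpM2l => //.
apply: (@le_trans _ _ (n%:R * (A m * n%:R ^+ 2 * s ^+ n))).
  by apply: ler_wpM2l => //; exact: potential_le.
have -> : n%:R * (A m * n%:R ^+ 2 * s ^+ n) = A m * (n%:R ^+ 3 * s ^+ n) by ring.
apply: ler_wpM2l => //; apply: ler_wpM2r => //.
by apply: ler_weXn2l.
Qed.

Lemma pow_one_sub_inv_le M : (0 < M)%N -> (1 - M%:R^-1 : R) ^+ M <= 1 / 2.
Proof.
move=> M0; have Mr : 0 < M%:R :> R by rewrite ltr0n.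
have Mi : 0 < M%:R^-1 :> R by rewrite invr_gt0.
have Mi1 : M%:R^-1 <= 1 :> R by rewrite invf_le1 // ler1n.
have B : 2 <= (1 + M%:R^-1 : R) ^+ M.
  have := @bernoulli R M M%:R^-1; rewrite mulfV ?lt0r_neq0 //; apply; lra.
have H : (1 - M%:R^-1 : R) ^+ M * (1 + M%:R^-1) ^+ M <= 1.
  rewrite -exprMn; apply: exprn_ile1; nra.
have := exprn_ge0 M (_ : 0 <= 1 - M%:R^-1 :> R); rewrite subr_ge0 => /(_ Mi1) P.
have := ler_wpM2l P B; lra.
Qed.

Lemma rate_decay n c : (2 <= n)%N -> (800 <= q)%N -> (16 * 128 * 4 * n ^ 2 <= c)%N ->
  (1 - 3 * rate R m n) ^+ c <= (1 / 2) ^+ (7 * (n %/ q)).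
Proof.
move=> n2 q800 hc; have n1 := n1_gt0 R n2.
have q0 : 0 < q%:R :> R by rewrite ltr0n expn_gt0.
(* As [1138 >= 1280 * 8 / 9], every [M] cycles at least halve the value; and [7 * 1138 = 7966] fits
   into [16 * 128 * 4 = 8192]. *)
set M := (1138 * q * n)%N.
have M0 : (0 < M)%N by rewrite /M !muln_gt0 expn_gt0; lia.
have Mc : (M * (7 * (n %/ q)) <= c)%N.
  have := leq_trunc_div n q; move: hc; rewrite /M expnS expn1; nia.
have lo : M%:R^-1 <= 3 * rate R m n.
  have nn : n.-1%:R <= n%:R :> R by rewrite ler_nat leq_pred.
  rewrite -[leLHS]mul1r ler_pdivrMr ?ltr0n //.
  have -> : 3 * rate R m n * M%:R = 9 * 1138 / (1280 * 8) * (n%:R / n.-1%:R).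
    by rewrite /M !natrM /rate; field; rewrite !lt0r_neq0.
  have : 1 <= n%:R / n.-1%:R :> R by rewrite ler_pdivlMr // mul1r.
  lra.
have hi : 3 * rate R m n <= 1.
  have n1' : 1 <= n.-1%:R :> R by rewrite ler1n -ltnS prednK // ltnW.
  have q1 : 1 <= q%:R :> R by rewrite ler1n expn_gt0.
  have -> : 3 * rate R m n = 9 / (1280 * 8) * (q%:R^-1 * n.-1%:R^-1).
    by rewrite /rate; field; rewrite !lt0r_neq0.
  have : q%:R^-1 * n.-1%:R^-1 <= 1 :> R.
    by rewrite mulr_ile1 ?invr_ge0 ?invf_le1 //; apply: ltW.
  lra.
have u0 : 0 <= 1 - 3 * rate R m n by lra.
apply: (@le_trans _ _ ((1 - 3 * rate R m n) ^+ (M * (7 * (n %/ q))))).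
  by apply: ler_wiXn2l => //; have : 0 < M%:R^-1 :> R; [rewrite invr_gt0 ltr0n | lra].
rewrite exprM; apply: lerXn2r; rewrite ?nnegrE; [exact: exprn_ge0 | lra |].
apply: le_trans (pow_one_sub_inv_le M0); apply: lerXn2r; rewrite ?nnegrE //; lra.
Qed.

Lemma sqr_le_exp2 y : (y.+1 ^ 2 <= 4 * 2 ^ y)%N.
Proof.
elim: y => [//|[|[|y]] IH] //; rewrite [in leqRHS]expnS mulnCA.
have : (y.+4 ^ 2 <= 2 * y.+3 ^ 2)%N by rewrite !expnS !expn0; nia.
by move=> h; apply: (leq_trans h); rewrite leq_mul2l.
Qed.

(** With [y = n %/ q], the factor [n ^+ 8] costs at most [2 ^+ (4 * y)] up to a constant, and
    [4 * y + y.+1 <= 7 * y + 1]. *)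
Lemma decay_le_const n : (0 < n)%N ->
  n%:R ^+ 8 * 2 ^+ (n %/ q).+1 * (1 / 2) ^+ (7 * (n %/ q)) <= 2 * (256 * q%:R ^+ 8) :> R.
Proof.
move=> n0; set y := (n %/ q)%N.
have q0 : (0 < q)%N by rewrite expn_gt0.
have hy : (n <= y.+1 * q)%N by apply: ltnW; exact: ltn_ceil.
have h8 : n%:R ^+ 8 <= 256 * q%:R ^+ 8 * 2 ^+ (4 * y) :> R.
  apply: (@le_trans _ _ ((y.+1 * q)%:R ^+ 8)).
    by apply: lerXn2r; rewrite ?nnegrE ?ler_nat.
  rewrite natrM exprMn mulrC -mulrA [leRHS]mulrCA; apply: ler_wpM2l; first exact: exprn_ge0.
  have -> : 256 = 4 ^+ 4 :> R by ring.
  rewrite (mulnC 4) exprM -exprMn (exprM _ 2 4); apply: lerXn2r; rewrite ?nnegrE.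
  - exact: exprn_ge0.
  - by rewrite mulr_ge0 // exp2_ge0.
  - by have := sqr_le_exp2 y; rewrite -(ler_nat R) natrX natrM natrX.
have E : (1 / 2) ^+ (7 * y) = (2 ^+ (7 * y))^-1 :> R by rewrite div1r exprVn.
have p7 : 0 < 2 ^+ (7 * y) :> R := exp2_gt0 R _.
rewrite E ler_pdivrMr //.
apply: (le_trans (ler_wpM2r (exp2_ge0 R _) h8)).
have -> : 2 * (256 * q%:R ^+ 8) * 2 ^+ (7 * y) =
  256 * q%:R ^+ 8 * (2 * 2 ^+ (7 * y)) :> R by rewrite [2 * _ in LHS]mulrC mulrA.
rewrite -[leLHS]mulrA; apply: ler_wpM2l; first by apply: mulr_ge0 => //; exact: exprn_ge0.
rewrite -exprD -exprS; apply: exp2_le; lia.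
Qed.

(** Deterministic: a step raises the deviation by at most 2. *)
Lemma expect_dev_le n t r T (p : 'S_n) : (2 <= n)%N -> (dev p + 2 * r)%:R <= T :> R ->
  expect b t r (fun x => ((dev x)%:R <= T)%R%:R) p = 1 :> R.
Proof.
move=> n2; elim: r t p => [|r IH] t p h /=; first by rewrite addn0 in h; rewrite h.
rewrite -[RHS](mean_const n2); apply: eq_mean => i; apply: IH.
apply: le_trans h; rewrite ler_nat.
have := dev_step b t p i; lia.
Qed.

End Concentration.

(** Pointwise Markov bound, including the incomplete last cycle. If the finer potential is at most
    [2 * K * n], the deviation stays small surely; otherwise the Lyapunov function is at least
    [(K * n) ^+ 4] and the left side is at most 0. *)
Lemma expect_small_dev_ge (R : realType) b m rho (lam K : R) n r (p : 'S_n) :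
  (2 <= n)%N -> (2 ^ (m + 3) + 3 <= rho)%N -> 0 <= lam -> 0 < K -> (r <= b)%N ->
  1 - lyapunov m rho K lam p / (K * n%:R) ^+ 4 <=
  expect b 0 r (fun x : 'S_n => ((dev x)%:R <=
    (8 * K + 4 * (2 ^ (m + 3))%:R * diag_const R rho + 2 * b%:R) * n%:R)%R%:R) p.
Proof.
move=> n2 rq lam0 K0 rb; set A := _ + 2 * b%:R.
have n0 : 0 < n%:R :> R by rewrite ltr0n ltnW.
have Kn : 0 < K * n%:R by exact: mulr_gt0.
have Kn4 : 0 < (K * n%:R) ^+ 4 by exact: exprn_gt0.
have [small|large] := leP (potential R (m + 3) rho p) (2 * (K * n%:R)).
  rewrite expect_dev_le //.
    rewrite lerBlDr lerDl; apply: divr_ge0; last exact: ltW.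
    apply: addr_ge0; first by apply: exprn_ge0; exact: trunc_ge0.
    by apply: mulr_ge0; [exact: mulr_ge0 | exact: potential_ge0].
  have := dev_le_potential R p rq; rewrite natrD natrM => h.
  have : r%:R <= b%:R * n%:R :> R.
    by rewrite -natrM ler_nat (leq_trans rb) // leq_pmulr // ltnW.
  rewrite /A; lra.
apply: (@le_trans _ _ 0); last first.
  have := @expect_le R b n 0 r (fun=> 0) (fun x => ((dev x)%:R <= A * n%:R)%R%:R) p (fun=> ler0n _ _).
  by rewrite expect_const.
rewrite subr_le0 ler_pdivlMr // mul1r.
apply: (@le_trans _ _ (trunc (K * n%:R) (potential R (m + 3) rho p) ^+ 4)); last first.
  by rewrite /lyapunov lerDl; apply: mulr_ge0; [exact: mulr_ge0 | exact: potential_ge0].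
apply: lerXn2r; rewrite ?nnegrE ?trunc_ge0 ?(ltW Kn) //.
by rewrite /trunc le_max; apply/orP; left; lra.
Qed.

Theorem theorem4p3 (R : realType) (b : nat) (hb : (1 <= b)%N) :
  exists2 c : R, 0 < c &
    exists n0 : nat, forall n : nat, (2 <= n)%N -> (n0 <= n)%N ->
      forall (pi0 : 'S_n) (m : nat),
        (16 * 128 * 4 * (b + 1) * n ^ 2 <= m)%N ->
        1 - n%:R ^- 2 <=
          uniform_prob R [set w : m.-tuple 'I_n.-1 |
                           (dev (run b pi0 w))%:R <= c * n%:R].
Proof.
have [m q800 qb] : exists2 m, (800 <= 2 ^ m)%N & (128 * 60 * b <= 2 ^ m)%N.
  exists (800 + 128 * 60 * b)%N; apply: ltnW; apply: leq_trans (ltn_expl _ (ltnSn 1)).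
    by rewrite ltnS leq_addr.
  by rewrite ltnS leq_addl.
have [rho rq] : exists rho, (2560 * 2 ^ (m + 3) <= rho)%N by eexists.
have rq' : (2 ^ (m + 3) + 3 <= rho)%N.
  by apply: leq_trans rq; have : (0 < 2 ^ (m + 3))%N; [rewrite expn_gt0 | lia].
have [K0 [lam [C [K00 lam0 C0 contract]]]] := cycle_lyapunov R q800 qb rq.
have [C1 C10 start] := lyapunov_le m rho lam0.
set q : R := (2 ^ m)%:R.
have q1 : 1 <= q by rewrite ler1n expn_gt0.
have q0 : 0 < q by lra.
pose kap : R := 1280 * 8 / 9.
have kap0 : 0 < kap by rewrite divr_gt0 // mulr_gt0.
(* The decayed initial value, and the stationary part [C * n / (3 * rate)] with
   [1 / (3 * rate) = kap * q * n.-1]. *)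
pose C5 := C1 * (2 * (256 * q ^+ 8)) + C * (kap * q).
have C50 : 0 <= C5.
  apply: addr_ge0; apply: mulr_ge0 => //; last by apply: mulr_ge0; exact: ltW.
  by apply: mulr_ge0 => //; apply: mulr_ge0 => //; apply: exprn_ge0; exact: ltW.
(* [K >= K0] gives the contraction; [K >= C5] and [K >= 1] give [C5 <= K ^+ 4], so the error
   [C5 * n ^+ 2 / (K * n) ^+ 4] is at most [n ^- 2]. *)
pose K := K0 + C5 + 1.
have K1 : 1 <= K by rewrite /K; lra.
have KK0 : K0 <= K by rewrite /K; lra.
have KC5 : C5 <= K by rewrite /K; lra.
have Kpos : 0 < K by lra.
exists (8 * K + 4 * (2 ^ (m + 3))%:R * diag_const R rho + 2 * b%:R).
  apply: ltr_pwDl; last exact: mulr_ge0.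
  apply: ltr_pwDl; first exact: mulr_gt0.
  by apply: mulr_ge0; [exact: mulr_ge0 | apply: mulr_ge0 => //; exact: exp2_ge0].
exists 0%N => n n2 _ p M hM.
have n0 : 0 < n%:R :> R by rewrite ltr0n ltnW.
rewrite (prob_expect R b M p (fun x => (dev x)%:R <= _ * n%:R)).
(* The run is cut into complete cycles and at most [b] remaining steps. *)
rewrite {1}(divn_eq M b.+1) mulnC expect_cycles //.
set c := (M %/ b.+1)%N; set r := (M %% b.+1)%N.
have rb : (r <= b)%N by rewrite -ltnS ltn_pmod.
have hc : (16 * 128 * 4 * n ^ 2 <= c)%N.
  by move: hM; rewrite addn1 mulnAC /c leq_divRL.
set Kn4 := (K * n%:R) ^+ 4.
have Kn40 : 0 < Kn4 by apply: exprn_gt0; exact: mulr_gt0.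
apply: le_trans (@iter_cycle_le R b n c (fun x : 'S_n => 1 - lyapunov m rho K lam x / Kn4)
  _ p (fun x => expect_small_dev_ge x n2 rq' lam0 Kpos rb)).
have -> : iter c (@cycle_op R b n) (fun x : 'S_n => 1 - lyapunov m rho K lam x / Kn4) p =
    1 - iter c (@cycle_op R b n) (@lyapunov R m rho K lam n) p / Kn4.
  have E x : 1 - lyapunov m rho K lam x / Kn4 = - Kn4^-1 * lyapunov m rho K lam x + 1.
    by rewrite mulNr mulrC addrC.
  transitivity (iter c (@cycle_op R b n) (fun x : 'S_n => - Kn4^-1 * lyapunov m rho K lam x + 1) p).
    by apply/eqP; rewrite eq_le !iter_cycle_le // => x; rewrite E.
  by rewrite iter_cycle_affine // mulNr mulrC addrC.
rewrite lerD2l lerN2.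
have n1 := n1_gt0 R n2.
have nn : n.-1%:R <= n%:R :> R by rewrite ler_nat leq_pred.
have rateE : 3 * rate R m n = (kap * q * n.-1%:R)^-1.
  rewrite /rate /kap -/q; field; rewrite !lt0r_neq0 //.
have g0 : 0 < 3 * rate R m n <= 1.
  have n1' : 1 <= n.-1%:R :> R by rewrite ler1n -ltnS prednK // ltnW.
  have k1 : 1 <= kap by rewrite /kap; lra.
  have z0 : 0 < kap * q * n.-1%:R by apply: mulr_gt0 => //; exact: mulr_gt0.
  rewrite rateE invr_gt0 z0 invf_le1 //=.
  apply: (@le_trans _ _ (1 * 1 * 1)); first by rewrite !mulr1.
  by apply: ler_pM => //; [lra | apply: ler_pM => //; lra].
have Cn : 0 <= C * n%:R by exact: mulr_ge0.
have := iter_cycle_contract n2 c p g0 Cn (fun x => contract K n x KK0 n2).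
set E := iter _ _ _ _ => hE.
have EC5 : E <= C5 * n%:R ^+ 2.
  apply: (le_trans hE); rewrite /C5 [leRHS]mulrDl; apply: lerD.
    have u0 : 0 <= (1 - 3 * rate R m n) ^+ c.
      by apply: exprn_ge0; rewrite subr_ge0; case/andP: g0.
    have nat_pos : (0 < n)%N by exact: ltnW.
    apply: (le_trans (ler_wpM2l u0 (start K n p (ltW Kpos) nat_pos))).
    apply: (@le_trans _ _ ((1 / 2) ^+ (7 * (n %/ 2 ^ m)) *
        (C1 * n%:R ^+ 8 * 2 ^+ (n %/ 2 ^ m).+1))).
      apply: ler_wpM2r; last exact: rate_decay.
      by apply: mulr_ge0; [apply: mulr_ge0 => //; exact: exprn_ge0 | exact: exp2_ge0].
    rewrite mulrC -!(mulrA C1); apply: ler_wpM2l => //.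
    apply: (le_trans (decay_le_const R m nat_pos)); rewrite -/q.
    have n1e : 1 <= n%:R ^+ 2 :> R by apply: exprn_ege1; rewrite ler1n.
    rewrite ler_peMr //; apply: mulr_ge0 => //; apply: mulr_ge0 => //.
    by apply: exprn_ge0; exact: ltW.
  rewrite rateE invrK.
  have -> : C * n%:R * (kap * q * n.-1%:R) = C * (kap * q) * (n%:R * n.-1%:R) by ring.
  apply: ler_wpM2l; first by apply: mulr_ge0 => //; apply: mulr_ge0; exact: ltW.
  by rewrite expr2; apply: ler_wpM2l.
rewrite ler_pdivrMr //; apply: (le_trans EC5).
have -> : n%:R ^- 2 * Kn4 = K ^+ 4 * n%:R ^+ 2.
  by rewrite /Kn4; field; exact: lt0r_neq0.
apply: ler_wpM2r; first by apply: exprn_ge0.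
by apply: (le_trans KC5); apply: ler_eXnr.
Qed.
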